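(* Let $K \subset \mathbb{C}$ be a compact, non-polar and polynomially convex set and let $\omega$ be the equilibrium measure on $K$. Let $(q_k)_{k>0}$ be a sequence of complex polynomials of degrees $n_k > 0$ with $n_k \to \infty$, and let $\mu_k$ be the root distribution of $q_k$. Suppose that $(q_k)_{k>0}$ is $K$-regular. Then $\mu_k$ converges weak-star to $\omega$ if and only if $(q_k)_{k>0}$ weakly centers on $J := \partial K$.
   Context: A compact set $K\subset\mathbb{C}$ is polynomially convex if and only if $\Omega := \mathbb{C}\setminus K$ is connected; non-polar means of positive logarithmic capacity. Write $I(\omega)=\iint \log|z-w|\,d\omega(z)\,d\omega(w)$ for the energy of the equilibrium measure. The Green's function of $\Omega$ with pole at $\infty$ is $g_\Omega(z) = \int \log|z-w|\,d\omega(w) - I(\omega)$. Write $\mathbb{D}(R)=\mathbb{D}(0,R)=\{z:|z|<R\}$. Root distribution: for a polynomial $q$ of degree $n\geq 1$ with roots $z_1,\dots,z_n$ repeated according to multiplicity, $\mu_q = \frac1n\sum_{j=1}^n\delta_{z_j}$. $K$-regularity: $(q_k)_{k>0}$ is $K$-regular if for some $R>0$ (which may be enlarged so that $K\subset \mathbb{D}(0,R)$), $\lim_{k\to\infty}\frac{1}{n_k}\log|q_k(z)| = g_\Omega(z)$ uniformly on $\mathbb{C}\setminus\mathbb{D}(0,R)$. Weak centering: $(q_k)_{k>0}$ weakly centers on a compact set $C$ if (1) there exist $N$ and $R>0$ such that $q_k^{-1}(\{0\})\subset\mathbb{D}(R)$ for all $k\ge N$; and (2) for every closed set $L\subset\mathbb{C}$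 with $L\cap C=\emptyset$, $\mu_k(L)\to 0$ as $k\to\infty$. Weak-star convergence $\mu_k\to\omega$ means $\int f\,d\mu_k\to\int f\,d\omega$ for every continuous compactly supported $f:\mathbb{C}\to\mathbb{R}$. *)

(* Defs.v *)
From HB Require Import structures.
From mathcomp Require Import all_boot all_order all_algebra.
From mathcomp Require Import complex.
From mathcomp Require Import all_classical all_reals all_analysis.

Set Implicit Arguments.
Unset Strict Implicit.
Unset Printing Implicit Defensive.

Import Order.TTheory GRing.Theory Num.Theory.
Import numFieldNormedType.Exports.

Local Open Scope classical_set_scope.
Local Open Scope ring_scope.
Local Open Scope complex_scope.

HB.instance Definition _ (R : realType) := NormedModule.copy R[i] R[i]^o.

(* The measurable sets of the complex plane are the Borel sets. *)
HB.instance Definition _ (R : realType) :=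
  Measurable.copy R[i] (g_sigma_algebraType (@open R[i])).

(* [`|z|] lives in [R[i]]; [cmod z] is the same number, seen in [R]. *)
Definition cmod (R : realType) (z : R[i]) : R := complex.Re `|z|.

Definition disk (R : realType) (r : R) : set R[i] := [set z | cmod z < r].

Definition frontier (T : topologicalType) (A : set T) : set T :=
  closure A `\` interior A.

(* A compact subset of the plane equals its polynomial hull if and only if it
   does not separate the plane. *)
Definition polynomially_convex (R : realType) (K : set R[i]) : Prop :=
  connected (~` K).

(* The logarithm is extended-real valued, with value [-oo] at [0]. *)
Definition logmod (R : realType) (z : R[i]) : \bar R := lne (cmod z)%:E.

Definition potential (R : realType) (nu : {measure set R[i] -> \bar R})
    (z : R[i]) : \bar R :=
  (\int[nu]_w logmod (z - w)%R)%E.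

(* No minus sign: the equilibrium measure maximizes this energy. *)
Definition energy (R : realType) (nu : {measure set R[i] -> \bar R}) : \bar R :=
  (\int[nu]_w \int[nu]_z logmod (z - w)%R)%E.

(* Meant for closed [K], where it says that the support of [nu] is in [K]. *)
Definition carried_by (R : realType) (K : set R[i])
    (nu : {measure set R[i] -> \bar R}) : Prop :=
  nu (~` K) = 0%E.

Definition log_capacity (R : realType) (K : set R[i]) : \bar R :=
  expeR (ereal_sup [set energy nu |
    nu in [set nu : probability R[i] R | carried_by K nu]]).

Definition non_polar (R : realType) (K : set R[i]) : Prop :=
  (0 < log_capacity K)%E.

Definition equilibrium_measure (R : realType) (K : set R[i])
    (omega : probability R[i] R) : Prop :=
  carried_by K omega /\
  forall nu : probability R[i] R, carried_by K nu ->
    (energy nu <= energy omega)%E.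

(* The Green's function with pole at infinity of the complement of the set
   whose equilibrium measure is [omega]. *)
Definition green (R : realType) (omega : probability R[i] R) (z : R[i]) :
    \bar R :=
  (potential omega z - energy omega)%E.

Definition pdeg (R : realType) (p : {poly R[i]}) : nat := (size p).-1.

(* The roots of [p], repeated according to multiplicity. *)
Definition proots (R : realType) (p : {poly R[i]}) : seq R[i] :=
  sval (closed_field_poly_normal p).

Definition root_distribution (R : realType) (p : {poly R[i]}) :
    {measure set R[i] -> \bar R} :=
  mscale ((pdeg p)%:R^-1)%:nng
    (msum (fun j => \d_ ((proots p)`_j)) (size (proots p))).

(* Uniform convergence on the complement of a disk, written out because the
   library's uniform structure on [\bar R] is not the one of [`|x - y|]. *)
Definition K_regular (R : realType) (K : set R[i]) (omega : probability R[i] R)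
    (q : nat -> {poly R[i]}) : Prop :=
  exists r : R, [/\ 0 < r, K `<=` disk r &
    forall e : R, 0 < e -> \forall k \near \oo, forall z, ~ disk r z ->
      (`| ((pdeg (q k))%:R^-1)%:E * logmod (q k).[z] - green omega z |
         < e%:E)%E].

Definition weakly_centers (R : realType) (q : nat -> {poly R[i]})
    (C : set R[i]) : Prop :=
  (exists (N : nat) (r : R), 0 < r /\
    forall k, (N <= k)%N -> [set z | root (q k) z] `<=` disk r) /\
  (forall L : set R[i], closed L -> L `&` C = set0 ->
    root_distribution (q k) L @[k --> \oo] --> 0%E).

Definition weak_star_cvg (R : realType)
    (mu : nat -> {measure set R[i] -> \bar R})
    (omega : {measure set R[i] -> \bar R}) : Prop :=
  forall f : R[i] -> R, continuous f -> compact (closure [set z | f z != 0]) ->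
    (\int[mu k]_z (f z)%:E)%E @[k --> \oo] --> (\int[omega]_z (f z)%:E)%E.

(* Main.v *)
(* If the root distributions converge to the equilibrium measure, they lose all mass
   off the frontier, because the equilibrium measure does not charge the interior of K:
   its potential is constant there outside a null set for every measure of finite energy,
   such as the uniform measures on circles, so that testing it against the difference of
   the potentials of two concentric circles gives 0.

   Conversely, let nu be a limit of the root distributions along an ultrafilter. Weak
   centering puts nu on the frontier of K. Regularity makes the potentials of nu and of
   the equilibrium measure differ by a constant near infinity, hence agree there, hence
   agree on the connected complement of K by unique continuation. By Frostman's theorem
   the potential of nu is thus bounded on the complement by the equilibrium constant, and
   on the frontier as well by semicontinuity; so nu has maximal energy. Two measures of
   maximal energy have the same integral against all differences of circle potentials,
   and averaging these over the plane recovers every continuous function. *)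
From HB Require Import structures.
Require Import Defs.
From mathcomp Require Import all_boot all_order all_algebra.
From mathcomp Require Import complex.
From mathcomp Require Import all_classical all_reals all_analysis.
From mathcomp Require Import measurable_realfun ring lra.

Set Implicit Arguments.
Unset Strict Implicit.
Unset Printing Implicit Defensive.

Import Order.TTheory GRing.Theory Num.Theory.
Import numFieldNormedType.Exports.

Local Open Scope classical_set_scope.
Local Open Scope ring_scope.
Local Open Scope complex_scope.

(** Regularity sees only the potentials near infinity: for the closed unit disk and [q k] = z^k it
    holds although every root is 0. Weak centering excludes this; it is used where points of the
    support must be limits of points off K.

    The logarithm is unbounded on both sides, so it is replaced by the kernel max(0, ln b - ln |x|),
    with b beyond all distances in play. Tonelli and monotone convergence then apply without
    integrability conditions, and maximal energy becomes a minimal mutual integral.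

    The potentials agree near infinity exactly, not only up to a constant, because each is ln |z| +
    O(1/|z|).

    Along an ultrafilter every bounded sequence converges, so no subsequence is extracted. The lemma
    that gives limits of root distributions also gives the uniform measure on a circle, from the
    roots of rho^n. Its potential is ln max(|w - a|, rho), so the difference for two concentric
    circles is nonnegative with bounded support and can serve as an averaging kernel. Uniqueness of
    the equilibrium measure thus comes without convexity of the energy. *)

Section complex_plane.
Context {R : realType}.
Implicit Types z w : R[i].

(** * Modulus, topology and Borel sets of the plane *)

Lemma normc_cmod z : `|z| = (cmod z)%:C.
Proof. by rewrite /cmod; case: z => a b. Qed.

Lemma cmodE (a b : R) : cmod (a +i* b) = Num.sqrt (a ^+ 2 + b ^+ 2).
Proof. by []. Qed.

Lemma cmod_ge0 z : 0 <= cmod z.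
Proof. by rewrite -lecR -normc_cmod normr_ge0. Qed.

Lemma cmod_eq0 z : (cmod z == 0) = (z == 0).
Proof.
have -> : (z == 0) = (`|z| == 0) by rewrite normr_eq0.
by rewrite normc_cmod; apply/eqP/eqP => [->|[]].
Qed.

Lemma cmod0 : cmod (0 : R[i]) = 0.
Proof. by apply/eqP; rewrite cmod_eq0. Qed.

Lemma cmod_gt0 z : (0 < cmod z) = (z != 0).
Proof. by rewrite lt_neqAle cmod_ge0 andbT eq_sym cmod_eq0. Qed.

Lemma cmodM z w : cmod (z * w) = cmod z * cmod w.
Proof. by apply: complexI; rewrite -normc_cmod normrM !normc_cmod rmorphM. Qed.

Lemma cmod1 : cmod (1 : R[i]) = 1.
Proof. by apply: complexI; rewrite -normc_cmod normr1. Qed.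

Lemma cmodX z n : cmod (z ^+ n) = cmod z ^+ n.
Proof. by elim: n => [|n ih]; rewrite ?expr0 ?cmod1// !exprS cmodM ih. Qed.

Lemma cmodV z : cmod z^-1 = (cmod z)^-1.
Proof.
have [->|z0] := eqVneq z 0; first by rewrite invr0 cmod0 invr0.
apply: (@mulfI _ (cmod z)); first by rewrite cmod_eq0.
by rewrite -cmodM !mulfV ?cmod1// cmod_eq0.
Qed.

Lemma cmodN z : cmod (- z) = cmod z.
Proof. by apply: complexI; rewrite -!normc_cmod normrN. Qed.

Lemma cmodBC z w : cmod (z - w) = cmod (w - z).
Proof. by rewrite -cmodN opprB. Qed.

Lemma cmodR (x : R) : cmod x%:C = `|x|.
Proof. by rewrite cmodE expr0n/= addr0 sqrtr_sqr. Qed.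

Lemma ler_cmodD z w : cmod (z + w) <= cmod z + cmod w.
Proof. by rewrite -lecR rmorphD/= -!normc_cmod ler_normD. Qed.

Lemma ler_cmodB z w : cmod (z - w) <= cmod z + cmod w.
Proof. by rewrite -(cmodN w) ler_cmodD. Qed.

Lemma ler_cmod_dist (y z w : R[i]) : cmod (z - w) <= cmod (z - y) + cmod (y - w).
Proof. by rewrite (le_trans _ (ler_cmodD _ _))// addrA subrK. Qed.

Lemma ler_dist_cmod z w : `|cmod z - cmod w| <= cmod (z - w).
Proof.
rewrite ler_norml; apply/andP; split.
  by rewrite lerBrDl lerBlDr cmodBC (le_trans _ (ler_cmodD _ _))// addrC subrK.
by rewrite lerBlDr (le_trans _ (ler_cmodD _ _))// subrK.
Qed.

Lemma normr_Re_le z : `|complex.Re z| <= cmod z.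
Proof.
case: z => a b; rewrite cmodE /= -sqrtr_sqr ler_wsqrtr// lerDl sqr_ge0//.
Qed.

Lemma normr_Im_le z : `|complex.Im z| <= cmod z.
Proof.
case: z => a b; rewrite cmodE /= -sqrtr_sqr ler_wsqrtr// lerDr sqr_ge0//.
Qed.

Lemma ler_cmod_ReIm z : cmod z <= `|complex.Re z| + `|complex.Im z|.
Proof.
case: z => a b; rewrite cmodE /= -[leRHS]ger0_norm ?addr_ge0// -sqrtr_sqr.
rewrite ler_wsqrtr// sqrrD !real_normK ?num_real//= -addrA lerD2l addrC lerDl.
by rewrite mulrn_wge0// mulr_ge0.
Qed.

Lemma nbhs_cmodP z (A : set R[i]) :
  nbhs z A <-> exists2 e : R, 0 < e & forall w, cmod (w - z) < e -> A w.
Proof.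
split=> [/nbhs_ballP[e /= e0 sA]|[e e0 sA]].
  exists (complex.Re e); first by move: e0; rewrite ltcE /= => /andP[].
  move=> w wz; apply: sA; rewrite -ball_normE /= distrC normc_cmod.
  by move: e0; rewrite !ltcE/= => /andP[/eqP -> _]; rewrite eqxx.
have [_ bz] := @nbhs_ballP _ R[i] z A; apply: bz.
exists e%:C; rewrite /= ?ltcR// => w.
by rewrite -ball_normE /= distrC normc_cmod ltcR => /sA.
Qed.

Lemma near_disk z (e : R) : 0 < e -> \forall w \near z, cmod (w - z) < e.
Proof. by move=> e0; apply/nbhs_cmodP; exists e. Qed.

Lemma lipschitz_continuous_cmod (f : R[i] -> R) (c : R) :
  (forall z w, `|f z - f w| <= c * cmod (z - w)) -> continuous f.
Proof.
move=> fc z; have FF : Filter (nbhs z) by typeclasses eauto.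
apply/cvgrPdist_lt => e e0.
have c1 : 0 < `|c| + 1 by rewrite ltr_wpDl.
near=> w; rewrite (le_lt_trans (fc _ _))//.
rewrite (@le_lt_trans _ _ ((`|c| + 1) * cmod (w - z)))//.
  by rewrite cmodBC ler_wpM2r ?cmod_ge0// (le_trans (ler_norm _))// lerDl.
rewrite -ltr_pdivlMl//; near: w; apply: near_disk.
by rewrite mulr_gt0// invr_gt0.
Unshelve. all: by end_near. Qed.

Lemma continuous_cmodB w : continuous (fun z => cmod (z - w)).
Proof.
apply: (@lipschitz_continuous_cmod _ 1) => x y; rewrite mul1r.
by rewrite (le_trans (ler_dist_cmod _ _))// opprB addrA subrK.
Qed.

Lemma continuous_Re : continuous (@complex.Re R).
Proof.
by apply: (@lipschitz_continuous_cmod _ 1) => x y; rewrite mul1r -raddfB normr_Re_le.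
Qed.

Lemma continuous_Im : continuous (@complex.Im R).
Proof.
by apply: (@lipschitz_continuous_cmod _ 1) => x y; rewrite mul1r -raddfB normr_Im_le.
Qed.

Lemma continuous_Complex : continuous (fun p : R * R => p.1 +i* p.2).
Proof.
move=> p; have FF : Filter (nbhs p) by typeclasses eauto.
apply/cvg_ballP => e e0.
have [e' e'0 ee] : exists2 e' : R, 0 < e' & e = e'%:C.
  exists (complex.Re e); first by move: e0; rewrite ltcE /= => /andP[].
  by case: e e0 => a b; rewrite ltcE /= => /andP[/eqP -> _].
have e2 : 0 < e' / 2 by rewrite divr_gt0.
have hb (x : R) : nbhs x [set y | `|x - y| < e' / 2].
  by have := nbhsx_ballx x _ e2; rewrite -ball_normE.
exists ([set y | `|p.1 - y| < e' / 2], [set y | `|p.2 - y| < e' / 2]).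
  by split; exact: hb.
move=> q [/= q1 q2].
rewrite ee -ball_normE /= normc_cmod ltcR.
apply: le_lt_trans (ler_cmod_ReIm _) _ => /=.
by rewrite (splitr e') ltrD.
Qed.

Definition cdisk (r : R) : set R[i] := [set z | cmod z <= r].

Definition ball_at (a : R[i]) (r : R) : set R[i] := [set z | cmod (z - a) < r].

Lemma open_ball_at a r : open (ball_at a r).
Proof.
have -> : ball_at a r = (fun z => cmod (z - a)) @^-1` [set x | x < r] by [].
by apply: open_comp => [x _|]; [exact: continuous_cmodB|exact: open_lt].
Qed.

Lemma closed_cdisk_at a r : closed [set z : R[i] | cmod (z - a) <= r].
Proof.
have -> : [set z : R[i] | cmod (z - a) <= r] = (fun z => cmod (z - a)) @^-1` [set x | x <= r] by [].
by apply: preimage_closed => [x _|]; [exact: continuous_cmodB|exact: closed_le].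
Qed.

Lemma closed_cdisk r : closed (cdisk r).
Proof. by have := @closed_cdisk_at 0 r; congr closed; apply/seteqP; split=> z /=; rewrite subr0. Qed.

Lemma compact_cdisk r : compact (cdisk r).
Proof.
have cs : compact [set p : R * R | `|p.1| <= r /\ `|p.2| <= r].
  have := compact_setX (@segment_compact R (-r) r) (@segment_compact R (-r) r).
  congr compact; apply/seteqP; split => -[x y] /=; rewrite !in_itv/= -!ler_norml//.
have sq := @continuous_compact _ _ (fun p : R * R => p.1 +i* p.2) _
   (continuous_subspaceT continuous_Complex) cs.
apply: (subclosed_compact _ sq); first exact: closed_cdisk.
move=> z /= zr; exists (complex.Re z, complex.Im z); last by case: z {zr}.
split => /=; first exact: le_trans (normr_Re_le _) zr.
exact: le_trans (normr_Im_le _) zr.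
Qed.

(** Compactness as a finite list of centres, so that sums and maxima over the cover can be formed;
    the [U z] are neighbourhoods and need not be open. *)
Lemma compact_finite_cover (K : set R[i]) (U : R[i] -> set R[i]) :
  compact K -> (forall z, K z -> nbhs z (U z)) ->
  exists s : seq R[i], (forall z, z \in s -> K z) /\
    forall z, K z -> exists2 w, w \in s & U w z.
Proof.
move=> cK KU; have : cover_compact K by rewrite -compact_cover.
move=> /(_ R[i] K (fun z => (U z)°)) [].
- by move=> z _; exact: open_interior.
- by move=> z Kz; exists z => //; exact: KU.
move=> D DK KD; exists (finmap.enum_fset D); split.
  by move=> z zD; have := DK z zD; rewrite inE.
by move=> z /KD [w /= wD Uw]; exists w => //; exact: interior_subset Uw.
Qed.

Lemma bounded_compact (K : set R[i]) : compact K -> exists2 r : R, 0 < r & K `<=` disk r.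
Proof.
move=> cK; have [|s [_ Ks]] := @compact_finite_cover K (fun z => ball_at z 1) cK.
  by move=> z _; exact: near_disk.
have s0 : 0 <= \sum_(w <- s) cmod w by rewrite sumr_ge0// => w _; exact: cmod_ge0.
exists (\sum_(w <- s) cmod w + 1); first by rewrite ltr_wpDl.
move=> z /Ks [w ws]; rewrite /ball_at /disk /= => zw.
have ww : cmod w <= \sum_(w <- s) cmod w.
  by rewrite (big_rem w)//= lerDl sumr_ge0// => v _; exact: cmod_ge0.
have := ler_dist_cmod z w; rewrite ler_norml => /andP[_]; lra.
Qed.

Lemma open_measurableC (U : set R[i]) : open U -> measurable U.
Proof. by move=> oU; exact: sub_sigma_algebra. Qed.

Lemma closed_measurableC (U : set R[i]) : closed U -> measurable U.
Proof. by move=> cU; rewrite -(setCK U); apply: measurableC; apply: open_measurableC; exact: closed_openC. Qed.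

Lemma measurable_ball_at a r : measurable (ball_at a r).
Proof. by apply: open_measurableC; exact: open_ball_at. Qed.

Lemma measurable_cdisk r : measurable (cdisk r).
Proof. by apply: closed_measurableC; exact: closed_cdisk. Qed.

Lemma compact_closedC (K : set R[i]) : compact K -> closed K.
Proof. by apply: compact_closed; exact: norm_hausdorff. Qed.

Lemma compact_measurableC (K : set R[i]) : compact K -> measurable K.
Proof. by move=> /compact_closedC; exact: closed_measurableC. Qed.

Lemma continuous_measurableC (f : R[i] -> R) : continuous f -> measurable_fun setT f.
Proof.
move=> cf; apply: (measurability _ (RGenOInfty.measurableE R)) => _ [_ [x ->] <-].
rewrite setTI; apply: open_measurableC; exact: open_comp.
Qed.

(** A countable base of the topology, indexed by [nat] through [pickle]; indices that decode to
    nothing give the empty set. It serves three times: for null sets, for measurability of maps into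
    the plane, and for the cells of the weak limit. *)
Definition ratdisk (n : nat) : set R[i] :=
  if (unpickle n : option (rat * rat * rat)) is Some (a, b, r)
  then ball_at (ratr a +i* ratr b) (ratr r) else set0.

Lemma ratdiskP (z : R[i]) (U : set R[i]) : nbhs z U ->
  exists2 n, ratdisk n z & ratdisk n `<=` U.
Proof.
move=> /nbhs_cmodP[e e0 eU].
(* The centre lies within e/8 of z in each coordinate, hence within e/4 of z, and the radius is
   between e/4 and e/2: the disk contains z and stays within 3e/4 of it. *)
have e4 : 0 < e / 4 by rewrite divr_gt0.
have [a] : exists a : rat, ratr a \in `](complex.Re z - e / 8), (complex.Re z + e / 8)[.
  by apply: rat_in_itvoo; lra.
have [b] : exists a : rat, ratr a \in `](complex.Im z - e / 8), (complex.Im z + e / 8)[.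
  by apply: rat_in_itvoo; lra.
have [r] : exists a : rat, ratr a \in `](e / 4), (e / 2)[.
  by apply: rat_in_itvoo; lra.
rewrite !in_itv /= => /andP[r1 r2] /andP[b1 b2] /andP[a1 a2].
have za : cmod (z - (ratr a +i* ratr b)) < e / 4.
  apply: (le_lt_trans (ler_cmod_ReIm _)); rewrite !raddfB /=.
  have ha : `|complex.Re z - ratr a| < e / 8 by rewrite ltr_norml; lra.
  have hb : `|complex.Im z - ratr b| < e / 8 by rewrite ltr_norml; lra.
  lra.
exists (pickle (a, b, r)); rewrite /ratdisk pickleK /ball_at /=; first lra.
move=> w /= wa; apply: eU; apply: (le_lt_trans (ler_cmod_dist (ratr a +i* ratr b) _ _)).
rewrite (cmodBC _ z); lra.
Qed.

Lemma measurable_ratdisk n : measurable (ratdisk n).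
Proof.
by rewrite /ratdisk; case: unpickle => [[[a b] r]|//]; exact: measurable_ball_at.
Qed.

(** Each neighbourhood contains a null rational disk around the point, and there are only countably
    many of these. *)
Lemma locally_null (mu : {measure set R[i] -> \bar R}) (A : set R[i]) :
  (forall z, A z -> exists2 U, nbhs z U & measurable U /\ mu U = 0%E) ->
  measurable A -> mu A = 0%E.
Proof.
move=> AU mA.
pose D n := if mu (ratdisk n) == 0%E then ratdisk n else set0.
have mD n : measurable (D n).
  by rewrite /D; case: ifP => _ //; exact: measurable_ratdisk.
have D0 n : mu (D n) = 0%E by rewrite /D; case: eqP => // _; rewrite measure0.
apply/eqP; rewrite eq_le measure_ge0 andbT.
have AD : A `<=` \bigcup_n D n.
  move=> z /AU[U /ratdiskP[n nz nU] [mU U0]]; exists n => //.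
  rewrite /D ifT//; apply/eqP; apply: (subset_measure0 _ mU nU U0).
  exact: measurable_ratdisk.
apply: (le_trans (le_measure mu _ _ AD)); rewrite ?inE//; first exact: bigcup_measurable.
apply: (le_trans (measure_sigma_subadditive _ mD _ (subset_refl _))).
- exact: bigcup_measurable.
- exact: subset_refl.
by rewrite eseries0.
Qed.

End complex_plane.

Section measurable_into_plane.
Context d (T : measurableType d) (R : realType).

Lemma measurable_fun_cmodB (f : T -> R[i]) (a : R[i]) :
  measurable_fun setT (fun x => complex.Re (f x)) -> measurable_fun setT (fun x => complex.Im (f x)) ->
  measurable_fun setT (fun x => cmod (f x - a)).
Proof.
move=> mr mi.
have -> : (fun x => cmod (f x - a)) = (fun x => Num.sqrt
    ((complex.Re (f x) - complex.Re a) ^+ 2 + (complex.Im (f x) - complex.Im a) ^+ 2)).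
  by apply/funext => x; case: (f x) a => [b c] [b' c'].
apply: (measurableT_comp (continuous_measurable_fun (@sqrt_continuous R))) => //.
apply: measurable_funD; apply: measurable_funX; apply: measurable_funB => //.
Qed.

(** An open set is a countable union of rational disks, and the preimage of a disk is a sublevel set
    of a real measurable function. *)
Lemma measurable_fun_complex (f : T -> R[i]) :
  measurable_fun setT (fun x => complex.Re (f x)) -> measurable_fun setT (fun x => complex.Im (f x)) ->
  measurable_fun setT f.
Proof.
move=> mr mi; apply: (measurability (@open R[i]) erefl) => _ [U oU <-].
rewrite setTI.
have -> : f @^-1` U = \bigcup_n (if `[< ratdisk n `<=` U >] then f @^-1` (ratdisk n) else set0).
  apply/seteqP; split => [x Ux|x [n _]]; last by case: asboolP => // nU /nU.
  have [n nx nU] := @ratdiskP R (f x) U (open_nbhs_nbhs (conj oU Ux)).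
  by exists n => //; rewrite ifT//; apply/asboolP.
apply: bigcup_measurable => n _; case: asboolP => // _.
rewrite /ratdisk; case: unpickle => [[[a b] r]|]; last by rewrite preimage_set0.
rewrite -[X in measurable X]setTI.
have := @measurable_fun_cmodB f (ratr a +i* ratr b) mr mi measurableT _ (measurable_itv `]-oo, (ratr r)[).
rewrite set_itvNyo; exact.
Qed.

End measurable_into_plane.

(** * Probability measures from normalization, images and binary trees *)

Lemma normalized_probability d (T : measurableType d) (R : realType)
    (mu : {measure set T -> \bar R}) : (0 < mu setT < +oo)%E ->
  exists P : probability T R,
    forall A, measurable A -> P A = (mu A * ((fine (mu setT))^-1)%:E)%E.
Proof.
move=> /andP[mu0 muoo]; exists (mnormalize mu (dirac point)) => A mA.
by rewrite /= /mnormalize /= gt_eqF// lt_eqF.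
Qed.

Lemma probability_of_measure d (T : measurableType d) (R : realType)
    (mu : {measure set T -> \bar R}) : mu setT = 1%E ->
  exists P : probability T R, forall A, measurable A -> P A = mu A.
Proof.
move=> mu1; have [|P PE] := @normalized_probability _ _ _ mu.
  by rewrite mu1 lte01 ltry.
by exists P => A mA; rewrite PE// mu1 invr1 mule1.
Qed.

Lemma law_exists d d' (T : measurableType d) (T' : measurableType d') (R : realType)
    (m : probability T R) (X : T -> T') : measurable_fun setT X ->
  exists nu : probability T' R, (forall A, measurable A -> nu A = m (X @^-1` A)) /\
    forall f : T' -> R, measurable_fun setT f -> m.-integrable setT (EFin \o (f \o X)) ->
      (\int[nu]_y (f y)%:E)%E = (\int[m]_x (f (X x))%:E)%E.
Proof.
move=> mX.
pose XM : {mfun T >-> T'} :=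
  MeasurableFun.Pack (MeasurableFun.Class (isMeasurableFun.Build _ _ _ _ X mX)).
exists (distribution m XM); split => // f mf mfX.
by rewrite integral_distribution//; exact/measurable_EFinP.
Qed.

(* Lays the masses [a s] of the cells out as consecutive subintervals of [0, 1[. The
   weak limit is later obtained as the law of the map sending a point of [0, 1[ to
   the point of the plane coded by the cells that contain it. *)
Section tree.
Context (R : realType) (a : seq bool -> R).
Hypothesis a_ge0 : forall s, 0 <= a s.
Hypothesis a_nil : a [::] = 1.
Hypothesis a_split : forall s, a (rcons s false) + a (rcons s true) = a s.

(** Left end of the interval of [s]: each turn to the right on the way to [s] skips the mass of the
    left sibling. *)
Let lft (s : seq bool) : R :=
  \sum_(i < size s | nth false s i) a (rcons (take i s) false).

Let cut s := lft s + a (rcons s false).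

Let lft_rcons s b : lft (rcons s b) = if b then cut s else lft s.
Proof.
have E : \sum_(i < size s | nth false (rcons s b) i)
    a (rcons (take i (rcons s b)) false) = lft s.
  apply: eq_big => [i|i _]; first by rewrite nth_rcons ltn_ord.
  by rewrite -(cats1 s b) take_cat ltn_ord.
rewrite {1}/lft size_rcons big_mkcond big_ord_recr /= -big_mkcond /= E.
rewrite nth_rcons ltnn eqxx -(cats1 s b) take_size_cat// /cut.
by case: b {E} => //; rewrite addr0.
Qed.

Let lft_nil : lft [::] = 0.
Proof. by rewrite /lft big_ord0. Qed.

Let itv s : set R := `[lft s, (lft s + a s)[%classic.

Let itv_rcons s b u : itv (rcons s b) u = (itv s u /\ (cut s <= u) = b).
Proof.
apply/propext; rewrite /itv /= !in_itv /= lft_rcons.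
have := a_split s; have := a_ge0 (rcons s true); have := a_ge0 (rcons s false).
rewrite /cut; case: b => a1 a2 aS.
  split; first by move=> /andP[u1 u2]; split => //; lra.
  by move=> [/andP[u1 u2] ->] /=; lra.
split; first by move=> /andP[u1 u2]; split; [lra|apply/negbTE; rewrite -ltNge; lra].
by move=> [/andP[u1 u2]] /negbT; rewrite -ltNge; lra.
Qed.

Let itv01 s : itv s `<=` `[0, 1[%classic.
Proof.
elim/last_ind: s => [|s b ih] u; first by rewrite /itv /= lft_nil a_nil add0r.
by rewrite itv_rcons => -[/ih].
Qed.

(** Sends the points outside [0, 1[ to 0, so that [node] is defined on all of R; these points get
    measure 0. *)
Let clip (u : R) : R := if 0 <= u < 1 then u else 0.

Let clip01 u : `[0, 1[%classic (clip u).
Proof. by rewrite /clip /= in_itv/=; case: ifP => //; rewrite lexx ltr01. Qed.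

Let clipE u : `[0, 1[%classic u -> clip u = u.
Proof. by rewrite /clip /= in_itv/= => ->. Qed.

Let measurable_clip : measurable_fun setT clip.
Proof.
rewrite /clip; apply: measurable_fun_ifT => //.
by apply: measurable_and; apply: measurable_fun_ler || apply: measurable_fun_ltr.
Qed.

Let node (u : R) : nat -> seq bool := fix F m :=
  if m is m'.+1 then rcons (F m') (cut (F m') <= clip u) else [::].

Let node_itv u m : itv (node u m) (clip u).
Proof.
elim: m => [|m ih] /=; last by rewrite itv_rcons.
by rewrite /itv lft_nil a_nil add0r; exact: clip01.
Qed.

Let node_eq u s : itv s (clip u) -> node u (size s) = s.
Proof.
elim/last_ind: s => [//|s b ih]; rewrite itv_rcons size_rcons => -[us ub] /=.
by rewrite ih// ub.
Qed.

Let size_node u m : size (node u m) = m.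
Proof. by elim: m => //= m ih; rewrite size_rcons ih. Qed.

Let node_preimage m s : size s = m -> [set u | node u m = s] = clip @^-1` itv s.
Proof.
move=> <-; apply/seteqP; split => u /=; last exact: node_eq.
by move=> us; rewrite -{1}us; exact: node_itv.
Qed.

(** The third clause holds at every point and not only almost everywhere: a half-open interval that
    contains a point has positive length. Hence every point selects cells of positive mass. *)
Lemma tree_probability : exists (m : probability (measurableTypeR R) R)
    (N : R -> nat -> seq bool),
  [/\ forall u k, size (N u k) = k,
      forall u k, exists b, N u k.+1 = rcons (N u k) b,
      forall u k, 0 < a (N u k),
      forall s k, measurable [set u | N u k = s] &
      forall s k, size s = k -> m [set u | N u k = s] = (a s)%:E].
Proof.
have m01 : measurable (`[0, 1[%classic : set R) by [].
have [|m mE] := @probability_of_measure _ _ R (mrestr lebesgue_measure m01).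
  rewrite /= /mrestr setTI lebesgue_measure_itv /= lte_fin ltr01.
  by rewrite oppr0 adde0.
have mitv s : measurable (clip @^-1` itv s).
  have mi : measurable (itv s) by exact: measurable_itv.
  by have := measurable_clip measurableT mi; rewrite setTI.
exists m, node; split => //.
- by move=> u k /=; eexists.
- move=> u k; have := node_itv u k; rewrite /itv /= in_itv /= => /andP[h1 h2].
  by have := le_lt_trans h1 h2; rewrite ltrDl.
- move=> s k; have [sk|sk] := eqVneq (size s) k; first by rewrite node_preimage.
  suff -> : [set u | node u k = s] = set0 by [].
  by apply/seteqP; split => u //= us; move: sk; rewrite -us size_node eqxx.
- move=> s k sk; rewrite node_preimage// (mE _ (mitv s)) /= /mrestr.
  have -> : clip @^-1` itv s `&` `[0, 1[%classic = itv s.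
    apply/seteqP; split => u /=; first by move=> [uc /clipE <-].
    by move=> us; rewrite clipE//; [split=> //|]; exact: itv01 us.
  rewrite lebesgue_measure_itv /= lte_fin ltrDl.
  case: ltP => [_|a0]; first by rewrite -EFinB addrAC subrr add0r.
  by congr (_%:E); apply/eqP; rewrite eq_le a0 a_ge0.
Qed.

End tree.

(** * Measures carried by a set, and integrals approximated by finite sums *)

Section carried.
Local Open Scope ereal_scope.
Context d (T : measurableType d) (R : realType).

Lemma ge0_integral_carried (mu : {measure set T -> \bar R}) (D : set T) (f : T -> \bar R) :
  measurable D -> measurable_fun setT f -> (forall x, 0 <= f x) -> mu (~` D) = 0 ->
  \int[mu]_x f x = \int[mu]_(x in D) f x.
Proof.
move=> mD mf f0 muD.
rewrite (@ge0_negligible_integral _ _ _ mu _ (~` D))//; last exact: measurableC.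
by rewrite setTD setCK.
Qed.

Lemma integral_carried (mu : {measure set T -> \bar R}) (D : set T) (f : T -> \bar R) :
  measurable D -> measurable_fun setT f -> mu (~` D) = 0 ->
  \int[mu]_x f x = \int[mu]_(x in D) f x.
Proof.
move=> mD mf muD; rewrite [LHS]integralE [RHS]integralE.
rewrite (@ge0_integral_carried mu D f^\+)//; last exact: measurable_funepos.
by rewrite (@ge0_integral_carried mu D f^\-)//; exact: measurable_funeneg.
Qed.

Lemma measure_carried (mu : {measure set T -> \bar R}) (D : set T) :
  measurable D -> mu (~` D) = 0 -> mu D = mu setT.
Proof.
move=> mD muD; have mC := measurableC mD.
by rewrite -(setUv D) measureU ?setICr// [X in _ + X]muD adde0.
Qed.

End carried.

(** There are finitely many codes of length [m], each with a measurable fibre. *)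
Lemma measurable_fun_code d (T : measurableType d) (R : realType) (D : set T)
    (m : nat) (N : T -> seq bool) (c : seq bool -> R) : measurable D ->
  (forall t, size (N t) = m) -> (forall s, measurable [set t | N t = s]) ->
  measurable_fun D (c \o N).
Proof.
move=> mD N_size mN _ Y mY.
have -> : D `&` (c \o N) @^-1` Y =
  \big[setU/set0]_(s <- index_enum (m.-tuple bool))
     (if `[< Y (c s) >] then D `&` [set t | N t = tval s] else set0).
  rewrite -bigcup_seq; apply/seteqP; split => [t [Dt /= Yt]|t [s _ /=]].
    exists (Tuple (introT eqP (N_size t))); rewrite /= ?mem_index_enum//.
    by rewrite ifT//; exact/asboolP.
  by case: asboolP => // Ys [Dt /= Nt]; split => //=; rewrite Nt.
by apply: bigsetU_measurable => s _; case: ifP => // _; exact: measurableI.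
Qed.

Section step_approximation.
Context d (T : measurableType d) (R : realType) (mu : {measure set T -> \bar R}).
Variables (D : set T) (m : nat) (N : T -> seq bool).
Hypotheses (mD : measurable D) (muD : mu D = 1%E).
Hypothesis N_size : forall t, size (N t) = m.
Hypothesis mN : forall s, measurable [set t | N t = s].

Let U (s : m.-tuple bool) : set T := D `&` [set t | N t = tval s].

Let DU : D = \big[setU/set0]_(s <- index_enum (m.-tuple bool)) U s.
Proof.
rewrite -bigcup_seq; apply/seteqP; split => [t Dt|t [s _ []]//].
by exists (Tuple (introT eqP (N_size t))); rewrite //= mem_index_enum.
Qed.

Let mU s : measurable (U s).
Proof. exact: measurableI. Qed.

Let Ucst (c : seq bool -> R) s t : U s t -> c (N t) = c s.
Proof. by move=> [_ /= ->]. Qed.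

Let mc (c : seq bool -> R) : measurable_fun D (c \o N).
Proof. exact: measurable_fun_code. Qed.

(** The finite sum depends on [mu] only through the masses of the cells, so two measures with nearly
    equal cell masses give [g] nearly equal integrals. *)
Lemma step_approximation (g : T -> R) (c : seq bool -> R) (e : R) :
  measurable_fun D g -> (forall t, D t -> `|g t - c (N t)| <= e) ->
  mu.-integrable D (EFin \o g) /\
  `|\int[mu]_(t in D) g t -
    \sum_(s : m.-tuple bool) c s * fine (mu (D `&` [set t | N t = tval s]))| <= e.
Proof.
move=> mg ge.
have muoo : (mu D < +oo)%E by rewrite muD ltry.
have bc : [bounded (c \o N) x | x in D].
  exists (\sum_(s : m.-tuple bool) `|c s|); split; first exact: num_real.
  move=> M hM t Dt; apply: le_trans (ltW hM).
  rewrite (bigD1 (Tuple (introT eqP (N_size t))))//= lerDl.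
  by rewrite sumr_ge0.
have ic := measurable_bounded_integrable mD muoo (mc c) bc.
have bd : [bounded (g \- (c \o N)) x | x in D].
  exists e; split; first exact: num_real.
  by move=> M hM t Dt; apply: le_trans (ltW hM); exact: ge.
have id := measurable_bounded_integrable mD muoo (measurable_funB mg (mc c)) bd.
have ig : mu.-integrable D (EFin \o g).
  have := integrableD mD id ic; apply: eq_integrable => // t _.
  by rewrite /= -EFinD subrK.
split=> //.
have -> : \sum_(s : m.-tuple bool) c s * fine (mu (D `&` [set t | N t = tval s]))
    = \int[mu]_(t in D) (c \o N) t.
  rewrite /Rintegral [X in fine (integral _ X _)]DU integral_bigsetU_EFin//; first last.
  - by rewrite -DU; apply/measurable_EFinP; exact: mc.
  - move=> s s' _ _ [t [[_ /= st] [_ /= st']]].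
    by apply: val_inj; rewrite /= -st -st'.
  - exact: index_enum_uniq.
  rewrite (eq_bigr (fun s : m.-tuple bool => (c s * fine (mu (U s)))%:E)).
    by rewrite sumEFin.
  move=> s _; rewrite -[LHS]fineK; last first.
    by apply: integrable_fin_num => //; apply: integrableS ic => // t [].
  rewrite -(Rintegral_cst mu (mU s) (c s)); congr EFin.
  by apply: eq_Rintegral => t; rewrite inE => Ut; exact: (Ucst c Ut).
rewrite -RintegralB//; apply: (le_trans (le_normr_Rintegral mD _)).
  exact: id.
rewrite -[leRHS]mulr1 -[X in _ * X]/(fine 1%E) -muD -(Rintegral_cst mu mD).
apply: le_Rintegral => //; first exact: integrable_norm id.
apply: measurable_bounded_integrable => //.
by exists `|e|; split; [exact: num_real|move=> M hM t _; exact: ltW].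
Qed.

End step_approximation.

Section ultrafilter_limit.
Context (R : realType) (F : set_system nat) {FU : UltraFilter F}.

(** The image of an ultrafilter is an ultrafilter; on a compact interval it has a cluster point, and
    it converges to it. *)
Lemma ultra_bounded_cvg (u : nat -> R) (b : R) :
  (\forall k \near F, 0 <= u k <= b) -> u k @[k --> F] --> lim (u k @[k --> F]) /\
  0 <= lim (u k @[k --> F]) <= b.
Proof.
move=> ub.
have [] := @segment_compact R 0 b (u @ F) _ _.
  by apply: filterS ub => k; rewrite /= in_itv.
move=> p [/= pb cp].
have up : u k @[k --> F] --> p.
  move=> V Vp; have [//|nV] := in_ultra_setVsetC (u @^-1` V) FU.
  by have [x []] := cp (~` V) V nV Vp.
have E : lim (u k @[k --> F]) = p by exact/cvg_lim.
by rewrite E; split => //; move: pb; rewrite in_itv.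
Qed.

End ultrafilter_limit.

(** * Weak limits along an ultrafilter *)

Section helly.
Context (R : realType) (F : set_system nat) {FU : UltraFilter F}.
Variables (mu : nat -> {measure set R[i] -> \bar R}) (r : R).
Hypothesis mu_setT : \forall k \near F, mu k setT = 1%E.
Hypothesis mu_cdisk : \forall k \near F, mu k (~` cdisk r) = 0%E.

(* The first [m] membership bits of [z] in an enumeration of the rational disks. *)
Let code (z : R[i]) (m : nat) : seq bool := mkseq (fun i => `[< ratdisk i z >]) m.

Let code_size z m : size (code z m) = m. Proof. exact: size_mkseq. Qed.

Let codeS z m : code z m.+1 = rcons (code z m) `[< ratdisk m z >].
Proof. exact: mkseqS. Qed.

Let measurable_code m s : measurable [set z | code z m = s].
Proof.
elim: m s => [|m ih] s.
  have [->|s0] := eqVneq s [::].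
    by rewrite (_ : mkset _ = setT)//; apply/seteqP; split.
  rewrite (_ : mkset _ = set0)//; apply/seteqP; split => z //= zs.
  by move: s0; rewrite -zs.
elim/last_ind: s {ih}(ih) => [|s b _] ih.
  by rewrite (_ : mkset _ = set0)//; apply/seteqP; split => z //=; rewrite codeS; case: (code z m).
have -> : [set z | code z m.+1 = rcons s b] = [set z | code z m = s] `&`
    (if b then ratdisk m else ~` ratdisk m).
  apply/seteqP; split => z /=; rewrite codeS.
    by move=> /rcons_inj[-> <-]; case: asboolP.
  by move=> [-> zb]; congr rcons; apply/asboolP; case: b zb.
apply: measurableI => //; case: b; first exact: measurable_ratdisk.
by apply: measurableC; exact: measurable_ratdisk.
Qed.

Let cell s := cdisk r `&` [set z | code z (size s) = s].

Let mcell s : measurable (cell s).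
Proof. by apply: measurableI => //; exact: measurable_cdisk. Qed.

Let cellU s : cell s = cell (rcons s false) `|` cell (rcons s true).
Proof.
rewrite /cell !size_rcons; apply/seteqP; split => z /=.
  move=> [zr zs]; rewrite codeS zs; case: asboolP => _; first by right.
  by left.
by rewrite codeS => -[] [zr /rcons_inj[-> _]].
Qed.

Let cellI s : cell (rcons s false) `&` cell (rcons s true) = set0.
Proof.
rewrite /cell !size_rcons; apply/seteqP; split => z //=.
by rewrite codeS => -[[_ /rcons_inj[_ ->]] [_ /rcons_inj[]]].
Qed.

Let mu_D : \forall k \near F, mu k (cdisk r) = 1%E.
Proof.
apply: filterS2 mu_setT mu_cdisk => k k1 k0.
by rewrite measure_carried//; exact: measurable_cdisk.
Qed.

Let u s k := fine (mu k (cell s)).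

Let u01 s : \forall k \near F, 0 <= u s k <= 1.
Proof.
apply: filterS mu_setT => k k1; rewrite fine_ge0//=.
rewrite -[leRHS]/(fine 1%E); apply: fine_le => //.
  rewrite ge0_fin_numE//; apply: (@le_lt_trans _ _ (mu k setT)); last by rewrite k1 ltry.
  by apply: le_measure => //; rewrite inE.
by rewrite -k1; apply: le_measure => //; rewrite inE.
Qed.

(** Limit masses of the cells. The limit keeps only finite additivity, and [a s] need not be the
    mass that the limit measure gives to [cell s]; countable additivity comes from realizing the
    limit as a law. *)
Let a s := lim (u s k @[k --> F]).

Let u_cvg s : u s k @[k --> F] --> a s.
Proof. by have [] := @ultra_bounded_cvg R F FU _ _ (u01 s). Qed.

Let a_ge0 s : 0 <= a s.
Proof. by have [_ /andP[]] := @ultra_bounded_cvg R F FU _ _ (u01 s). Qed.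

Let a_nil : a [::] = 1.
Proof.
apply/cvg_lim => //; apply: cvg_near_cst; apply: filterS mu_D => k k1.
rewrite /u; have -> : cell [::] = cdisk r; last by rewrite k1.
by apply/seteqP; split => z // [].
Qed.

Let a_split s : a (rcons s false) + a (rcons s true) = a s.
Proof.
have h : u (rcons s false) k + u (rcons s true) k @[k --> F] -->
    a (rcons s false) + a (rcons s true) by apply: cvgD; exact: u_cvg.
apply/esym/cvg_lim => //; apply: cvg_trans h; apply: near_eq_cvg.
apply: filterS mu_setT => k k1.
have fin A : measurable A -> mu k A \is a fin_num.
  move=> mA; rewrite ge0_fin_numE//; apply: (@le_lt_trans _ _ (mu k setT)); last by rewrite k1 ltry.
  by apply: le_measure => //; rewrite inE.
by rewrite /u /= -fineD ?fin// -measureU// ?cellI// -cellU.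
Qed.

(** Finitely many rational disks on which [f] oscillates little cover the disk; once [m] exceeds all
    their indices, points with the same code share such a disk. *)
Let code_osc (f : R[i] -> R) (e : R) : continuous f -> 0 < e -> exists m,
  forall z w, cdisk r z -> cdisk r w -> code z m = code w m -> `|f z - f w| <= e.
Proof.
move=> cf e0; have e2 : 0 < e / 2 by rewrite divr_gt0.
have /choice[n nP] : forall z, exists n, ratdisk n z /\
    forall w, ratdisk n w -> `|f z - f w| < e / 2.
  move=> z; have FF : Filter (nbhs z) by typeclasses eauto.
  have fz : \forall w \near z, `|f z - f w| < e / 2.
    by have [h _] := @cvgrPdist_lt _ _ _ _ FF f (f z); apply: h => //; exact: cf.
  by have [n nz nU] := ratdiskP fz; exists n.
have [|s [_ Ds]] := @compact_finite_cover R (cdisk r) (fun z => ratdisk (n z)) (@compact_cdisk R r).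
  move=> z _; apply: open_nbhs_nbhs; split; last by have [] := nP z.
  by rewrite /ratdisk; case: unpickle => [[[? ?] ?]|]; [exact: open_ball_at|exact: open0].
exists (\max_(z <- s) n z).+1 => z w zr wr zw.
have [y ys yz] := Ds z zr.
have yw : ratdisk (n y) w.
  have lt : (n y < (\max_(z <- s) n z).+1)%N by rewrite ltnS (big_rem y)//= leq_maxl.
  have := congr1 (nth false ^~ (n y)) zw; rewrite /= !nth_mkseq//.
  by move/asboolP : yz => -> /esym/asboolP.
have [_ h] := nP y; have := h _ yz; have := h _ yw; rewrite !ltr_norml ler_norml; lra.
Qed.

(** A representative of the cell, with default 0 for an empty one; cells of positive limit mass are
    nonempty. *)
Let dec s : R[i] := xget 0 (cell s).

Let dec_cell s : 0 < a s -> cell s (dec s).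
Proof.
move=> as0; rewrite /dec; case: xgetP => // nx.
suff : a s = 0 by move=> a0; move: as0; rewrite a0 ltxx.
apply/cvg_lim => //; apply: cvg_near_cst; apply: nearW => k.
rewrite /u (_ : cell s = set0) ?measure0//.
by apply/seteqP; split => x // /nx.
Qed.

Let dec_code z k : cdisk r z -> cdisk r (dec (code z k)) /\ code (dec (code z k)) k = code z k.
Proof.
move=> zr; have : cell (code z k) (dec (code z k)).
  by apply: xgetPex; exists z; rewrite /cell /= code_size.
by rewrite /cell /= code_size => -[].
Qed.

(** A point [t] of the line picks a nested sequence of cells. Their representatives converge to a
    point [X t], because every continuous function oscillates little on deep cells, and the limit
    measure is the law of [X]. *)
Lemma helly_selection : exists nu : probability R[i] R, nu (~` cdisk r) = 0%E /\
  forall f : R[i] -> R, continuous f ->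
    (\int[mu k]_z (f z)%:E)%E @[k --> F] --> (\int[nu]_z (f z)%:E)%E.
Proof.
have [m0 [N [sN NS Na mN mNE]]] := tree_probability a_ge0 a_nil a_split.
pose x t k := dec (N t k).
have xD t k : cdisk r (x t k) by have [] := dec_cell (Na t k).
have xcode t k : code (x t k) k = N t k.
  by have [_] := dec_cell (Na t k); rewrite /= sN.
(* Nestedness: the representative of a deeper cell also lies in each earlier cell along [t]. *)
have Ntake t k n : code (x t (k + n)%N) k = N t k.
  have : take k (code (x t (k + n)%N) (k + n)%N) = take k (N t (k + n)%N) by rewrite xcode.
  have -> : take k (N t (k + n)%N) = N t k.
    elim: n => [|n ih]; first by rewrite addn0 take_oversize ?sN.
    rewrite addnS; have [b ->] := NS t (k + n)%N.
    by rewrite -cats1 takel_cat ?sN ?leq_addr.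
  move=> <-; rewrite /code /mkseq -map_take take_iota.
  by rewrite (minn_idPl _)// leq_addr.
have fx_osc (f : R[i] -> R) (e : R) : continuous f -> 0 < e -> exists k,
    forall t n, `|f (x t (k + n)%N) - f (x t k)| <= e.
  move=> cf e0; have [k kP] := code_osc cf e0; exists k => t n.
  by apply: kP => //; rewrite Ntake xcode.
have fx_cvg (f : R[i] -> R) t : continuous f ->
    f (x t k) @[k --> \oo] --> lim (f (x t k) @[k --> \oo]).
  move=> cf; apply: cauchy_cvg; apply: cauchy_exP => e e0.
  have [k kP] := fx_osc f (e / 2) cf (divr_gt0 e0 (ltr0n _ 2)).
  exists (f (x t k)); exists k => // n /= kn.
  have := kP t (n - k)%N; rewrite subnKC// -ball_normE /= distrC => h.
  by apply: (le_lt_trans h); rewrite ltr_pdivrMr// mulr_natr mulr2n ltrDl.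
pose X t : R[i] := lim (complex.Re (x t k) @[k --> \oo]) +i* lim (complex.Im (x t k) @[k --> \oo]).
have Xcvg0 t : x t k @[k --> \oo] --> X t.
  move=> A /nbhs_cmodP[e e0 eA]; have e2 : 0 < e / 2 by rewrite divr_gt0.
  have /cvgrPdist_lt/(_ _ e2) hRe := fx_cvg _ t (@continuous_Re R).
  have /cvgrPdist_lt/(_ _ e2) hIm := fx_cvg _ t (@continuous_Im R).
  apply: filterS2 hRe hIm => k hRe hIm; apply: eA.
  apply: (le_lt_trans (ler_cmod_ReIm _)); rewrite !raddfB /= 2!(distrC _ (limn _)).
  by rewrite (splitr e) ltrD.
have Xcvg (f : R[i] -> R) t : continuous f -> f (x t k) @[k --> \oo] --> f (X t).
  by move=> cf; apply: cvg_comp; [exact: Xcvg0|exact: cf].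
have mX : measurable_fun setT X.
  apply: measurable_fun_complex.
    apply: (measurable_fun_cvg (h := fun k t => complex.Re (x t k))) => [k|t _].
      exact: (@measurable_fun_code _ _ R setT k (N ^~ k)
        (fun s => complex.Re (dec s)) measurableT (sN ^~ k) (mN ^~ k)).
    by apply: Xcvg; exact: continuous_Re.
  apply: (measurable_fun_cvg (h := fun k t => complex.Im (x t k))) => [k|t _].
    exact: (@measurable_fun_code _ _ R setT k (N ^~ k)
        (fun s => complex.Im (dec s)) measurableT (sN ^~ k) (mN ^~ k)).
  by apply: Xcvg; exact: continuous_Im.
have XD t : cdisk r (X t).
  rewrite /cdisk /=.
  have ccm : continuous (@cmod R).
    by have := @continuous_cmodB R 0; under eq_fun do rewrite subr0.
  have h := Xcvg _ t ccm; rewrite -(cvg_lim _ h)//.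
  by apply: limr_le; [exact: cvgP h|apply: nearW => k; exact: xD].
have [nu [nuE nuI]] := @law_exists _ _ (measurableTypeR R) _ R m0 X mX.
exists nu; split.
  rewrite nuE; last by apply: measurableC; exact: measurable_cdisk.
  rewrite (_ : _ @^-1` _ = set0) ?measure0//.
  by apply/seteqP; split => t //= /(_ (XD t)).
move=> f cf.
have mf := continuous_measurableC cf.
have mfX : measurable_fun setT (f \o X) by apply: measurableT_comp.
(* One sum [S] serves both integrals: the masses of the cells are exactly [a s] on the line and tend
   to [a s] under [mu j]. The second [e] in the last bound pays for this limit. *)
have approx (e : R) : 0 < e -> exists2 S : R, (m0.-integrable setT (EFin \o (f \o X)) /\
      `|\int[m0]_t (f \o X) t - S| <= e) &
    \forall j \near F, (mu j).-integrable (cdisk r) (EFin \o f) /\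
      `|\int[mu j]_(z in cdisk r) f z - S| <= e + e.
  move=> e0; have [k kP] := code_osc cf e0.
  exists (\sum_(s : k.-tuple bool) f (dec s) * a s).
    have Xle t : setT t -> `|f (X t) - f (dec (N t k))| <= e.
      move=> _; have h : `|f (x t n) - f (x t k)| @[n --> \oo] --> `|f (X t) - f (x t k)|.
        by apply: cvg_norm; apply: cvgB; [exact: Xcvg|exact: cvg_cst].
      rewrite -(cvg_lim _ h)//; apply: limr_le; first exact: cvgP h.
      exists k => // n /= kn; have := subnKC kn => <-.
      by apply: kP => //; rewrite Ntake xcode.
    have [i le] := @step_approximation _ _ R m0 setT k (N ^~ k) measurableT (probability_setT m0)
      (sN ^~ k) (mN ^~ k) _ (fun s => f (dec s)) e mfX Xle.
    split=> //; apply: le_trans le; rewrite le_eqVlt; apply/orP; left; apply/eqP.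
    congr (`|_ - _|); apply: eq_bigr => s _; congr (_ * _).
    by rewrite setTI; exact: esym (congr1 fine (mNE (tval s) k (size_tuple s))).
  have : (fun j => \sum_(s : k.-tuple bool) f (dec s) * u s j) @ F -->
      \sum_(s : k.-tuple bool) f (dec s) * a s.
    elim: (index_enum _) => [|s l ih].
      by under eq_fun do rewrite big_nil; rewrite big_nil; exact: cvg_cst.
    under eq_fun do rewrite big_cons; rewrite big_cons.
    by apply: cvgD => //; apply: cvgM; [exact: cvg_cst|exact: u_cvg].
  move=> /cvgrPdist_le/(_ _ e0); apply: filterS2 mu_D => j jD jS.
  have fle z : cdisk r z -> `|f z - f (dec (code z k))| <= e.
    by move=> zr; have [? ?] := dec_code k zr; apply: kP.
  have [i le] := @step_approximation _ _ R (mu j) (cdisk r) k (code ^~ k) (@measurable_cdisk R r)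
     jD (code_size ^~ k) (measurable_code k) f (fun s => f (dec s)) e (measurable_funTS mf) fle.
  split=> //; rewrite distrC in jS.
  set S1 := \sum_(s : k.-tuple bool) _ * a s in jS *.
  have E : \sum_(s : k.-tuple bool) f (dec s) * fine (mu j (cdisk r `&` [set t | code t k = s]))
    = \sum_(s : k.-tuple bool) f (dec s) * u s j.
    by apply: eq_bigr => s _; rewrite /u /cell size_tuple.
  rewrite E in le.
  apply: (@le_trans _ _ (`|\int[mu j]_(z in cdisk r) f z - \sum_(s : k.-tuple bool) f (dec s) * u s j| + `|\sum_(s : k.-tuple bool) f (dec s) * u s j - S1|)).
    by rewrite -[X in `|X| <= _](subrKA (\sum_(s : k.-tuple bool) f (dec s) * u s j)) ler_normD.
  exact: lerD.
have [S0 [ifX _] _] := approx 1 ltr01.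
have mD := @measurable_cdisk R r.
have E : (\int[nu]_z (f z)%:E)%E = (\int[m0]_t (f \o X) t)%:E.
  rewrite nuI// /Rintegral fineK//.
  exact: integrable_fin_num.
rewrite E; apply: (@cvg_trans _ ((fun j => (\int[mu j]_(z in cdisk r) f z)%:E) @ F)).
  apply: near_eq_cvg; have [S1 _] := approx 1 ltr01; apply: filterS2 mu_cdisk => j j0 [i _].
  rewrite (integral_carried mD _ j0); last exact/measurable_EFinP.
  by rewrite /Rintegral fineK//; exact: integrable_fin_num.
apply: cvg_EFin; first exact: nearW.
apply/cvgrPdist_le => e e0.
have e3 : 0 < e / 3 by rewrite divr_gt0.
have [S [_ S1]] := approx _ e3; apply: filterS => j [_ S2] /=.
have := ler_normD (\int[m0]_t (f \o X) t - S) (S - \int[mu j]_(z in cdisk r) f z).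
rewrite addrA subrK (distrC S) => /le_trans; apply.
by apply: (le_trans (lerD S1 S2)); lra.
Qed.

End helly.

(** Also valid when the integral of [g] is infinite: the positive part of the difference is at most
    |c|, while the negative part is at least g - |c| and has infinite integral. *)
Lemma integral_cstB d (T : measurableType d) (R : realType) (mu : probability T R)
    (c : R) (g : T -> \bar R) : measurable_fun setT g -> (forall x, (0 <= g x)%E) ->
  (\int[mu]_x (c%:E - g x) = c%:E - \int[mu]_x g x)%E.
Proof.
move=> mg g0.
have ic : mu.-integrable setT (EFin \o cst c) by exact: finite_measure_integrable_cst.
have mc : measurable_fun [set: T] (cst c%:E) by [].
have m1 : mu setT = 1%E := probability_setT mu.
have Ic : (\int[mu]_x (cst c%:E) x = c%:E)%E.
  by rewrite integral_cst// [X in (_ * X)%E]m1 mule1.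
have [goo|] := eqVneq (\int[mu]_x g x)%E +oo%E; last first.
  rewrite -ltey => gfin; have ig : mu.-integrable setT g.
    apply/integrableP; split => //.
    by rewrite (eq_integral g)// => x _; rewrite gee0_abs.
  by rewrite (@integralB _ _ _ mu setT _ (cst c%:E) g)// Ic.
rewrite goo [LHS]integralE.
have mh : measurable_fun setT (fun x => c%:E - g x)%E by apply: emeasurable_funB.
have h1 : (\int[mu]_x ((fun x => c%:E - g x)^\+ x) <= `|c|%:E)%E.
  have -> : `|c|%:E = (\int[mu]_x (cst `|c|%:E) x)%E.
    by rewrite integral_cst// [X in (_ * X)%E]m1 mule1.
  apply: ge0_le_integral => //; first exact: measurable_funepos.
  move=> x _; rewrite funeposE ge_max; apply/andP; split; last by rewrite lee_fin.
  have := g0 x; case: (g x) => [y| |] //= y0; last by rewrite leNye.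
  rewrite -EFinB lee_fin; move: y0; rewrite lee_fin; have := ler_norm c; lra.
have h2 : (\int[mu]_x ((fun x => c%:E - g x)^\- x) = +oo)%E.
  have : (\int[mu]_x g x <= \int[mu]_x ((fun x => c%:E - g x)^\- x + cst `|c|%:E x))%E.
    apply: ge0_le_integral => //.
      by apply: emeasurable_funD => //; exact: measurable_funeneg.
    move=> x _; rewrite funenegE /=; have := g0 x; case: (g x) => [y| |]//= _.
    rewrite -EFin_max -EFinD lee_fin.
    have := ler_norm c; have : - (c - y) <= Num.max (- (c - y)) 0 by rewrite le_max lexx.
    lra.
  rewrite goo leye_eq ge0_integralD//; last by move=> x _; rewrite /= lee_fin.
  rewrite integral_cst// [X in (_ * X)%E]m1 mule1.
    by case: (integral _ _ _).
  exact: measurable_funeneg.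
by move: h1; rewrite h2; case: (integral _ _ _).
Qed.

Lemma nbhs_infty_gerS (R : realType) (A : R) : \forall n \near \oo, A <= n.+1%:R.
Proof.
have := @nbhs_infty_ger R A; apply: filterS => n /le_trans; apply.
by rewrite ler_nat.
Qed.

(** * Logarithmic potentials *)

Section kernel.
Context (R : realType).
Implicit Types (x y z w : R[i]) (b d : R).

Lemma logmodE x : logmod x = if x == 0 then -oo%E else (ln (cmod x))%:E.
Proof.
rewrite /logmod; have [->|x0] := eqVneq x 0; first by rewrite cmod0 le0_lneNy.
by rewrite lne_EFin// cmod_gt0.
Qed.

(* The kernel [ln b - ln |x|] cut off at [0], hence nonnegative, and equal to
   [ln b - logmod x] when [|x| <= b]. *)
Definition kap b x : \bar R :=
  if x == 0 then +oo%E else (Num.max 0 (ln b - ln (cmod x)))%:E.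

(* [kap] made bounded and Lipschitz at distance less than [d] from the origin. *)
Definition ktr b d x : R := Num.max 0 (ln b - ln (Num.max (cmod x) d)).

Lemma kap_ge0 b x : (0 <= kap b x)%E.
Proof. by rewrite /kap; case: eqP => // _; rewrite lee_fin le_max lexx. Qed.

Lemma kapC b z w : kap b (z - w) = kap b (w - z).
Proof. by rewrite /kap cmodBC !subr_eq0 (eq_sym z w). Qed.

Lemma ktr_ge0 b d x : 0 <= ktr b d x.
Proof. by rewrite le_max lexx. Qed.

(** From ln (1 + x) <= x and s / t = 1 + (s - t) / t, with [t] the smaller of the two. *)
Lemma ler_ln_dist d (s t : R) : 0 < d -> d <= s -> d <= t -> `|ln s - ln t| <= `|s - t| / d.
Proof.
move=> d0; wlog ts : s t / t <= s => [hw ds dt|ds dt].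
  have [ts|/ltW st] := leP t s; first exact: hw.
  by rewrite distrC (distrC s); exact: hw.
have t0 := lt_le_trans d0 dt; have s0 := lt_le_trans d0 ds.
rewrite !ger0_norm ?subr_ge0//; last by rewrite ler_ln.
rewrite -ln_div//; have -> : s / t = 1 + (s - t) / t by field; rewrite gt_eqF.
have st : 0 <= (s - t) / t by rewrite divr_ge0 ?subr_ge0// ltW.
apply: (le_trans (le_ln1Dx _)); first lra.
by rewrite ler_wpM2l ?subr_ge0// lef_pV2.
Qed.

Lemma ler_max_dist (c s t : R) : `|Num.max s c - Num.max t c| <= `|s - t|.
Proof.
rewrite ler_norml; have := ler_norm (s - t); have := ler_norm (t - s); rewrite (distrC t).
by rewrite !maxEle; case: (leP s c) => ?; case: (leP t c) => ? ? ?; apply/andP; split; lra.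
Qed.

Lemma ktr_lipschitz b d x y : 0 < d -> `|ktr b d x - ktr b d y| <= cmod (x - y) / d.
Proof.
move=> d0; rewrite /ktr ![Num.max 0 _]maxC.
apply: (le_trans (ler_max_dist _ _ _)).
have -> (p q r : R) : p - q - (p - r) = - (q - r) by ring.
rewrite normrN.
apply: (le_trans (ler_ln_dist d0 _ _)); rewrite ?le_max ?lexx ?orbT//.
rewrite ler_wpM2r ?invr_ge0 ?(ltW d0)//.
exact: (le_trans (ler_max_dist _ _ _) (ler_dist_cmod _ _)).
Qed.

Lemma kapE b x : 0 < b -> cmod x <= b -> kap b x = ((ln b)%:E - logmod x)%E.
Proof.
move=> b0 xb; rewrite /kap logmodE; case: eqVneq => [_ |x0]; first by [].
by rewrite -EFinB max_r// subr_ge0 ler_ln// posrE// cmod_gt0.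
Qed.

Lemma ktr_le_kap b d x : 0 < d -> ((ktr b d x)%:E <= kap b x)%E.
Proof.
move=> d0; rewrite /kap; case: eqVneq => [_|x0]; first by rewrite leey.
rewrite lee_fin /ktr ge_max !le_max lexx/= lerD2l lerN2; apply/orP; right.
by rewrite ler_ln ?posrE ?cmod_gt0 ?lt_max ?d0 ?orbT// le_max lexx.
Qed.

Lemma ktr_nonincreasing b d d' x : 0 < d -> d <= d' -> ktr b d' x <= ktr b d x.
Proof.
move=> d0 dd'; rewrite /ktr ge_max !le_max lexx/= lerD2l lerN2; apply/orP; right.
have d'0 := lt_le_trans d0 dd'.
rewrite ler_ln ?posrE ?lt_max ?d0 ?d'0 ?orbT// ge_max !le_max lexx/= dd'.
by rewrite orbT.
Qed.

Lemma ktr_kap b d x : 0 < d -> d <= cmod x -> (ktr b d x)%:E = kap b x.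
Proof.
move=> d0 dx; rewrite /kap /ktr (max_l dx) ifF//; apply/negbTE.
by rewrite -cmod_gt0 (lt_le_trans d0).
Qed.

Lemma ktr_cvg b x : (ktr b n.+1%:R^-1 x)%:E @[n --> \oo] --> kap b x.
Proof.
have [->|x0] := eqVneq x 0.
  rewrite /kap eqxx; apply/cvgeryP; apply/cvgryPge => A.
  near=> n; rewrite /ktr le_max cmod0; apply/orP; right.
  rewrite max_r ?invr_ge0// lnV ?posrE// opprK.
  rewrite -lerBlDl -[leLHS]expRK ler_ln ?posrE ?expR_gt0//.
  near: n; exact: nbhs_infty_gerS.
have x0' : 0 < cmod x by rewrite cmod_gt0.
apply: cvg_near_cst; near=> n; apply: ktr_kap => //.
rewrite invf_ple ?posrE//; near: n.
exact: nbhs_infty_gerS.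
Unshelve. all: by end_near. Qed.

End kernel.

Section potential.
Context (R : realType).
Implicit Types (x y z w : R[i]) (b d : R).

Lemma measurable_lne_EFin : measurable_fun setT (fun t : R => lne t%:E).
Proof.
rewrite /lne; apply: measurable_fun_ifT => //.
  exact: measurable_fun_ler.
by apply/measurable_EFinP; exact: measurable_ln.
Qed.

Lemma measurable_cmod_sub : measurable_fun setT (fun p : R[i] * R[i] => cmod (p.1 - p.2)).
Proof.
have mRe := continuous_measurableC (@continuous_Re R).
have mIm := continuous_measurableC (@continuous_Im R).
have := @measurable_fun_cmodB _ (R[i] * R[i])%type R (fun p => p.1 - p.2) 0.
under [X in _ -> _ -> measurable_fun _ X]eq_fun do rewrite subr0.
apply; under eq_fun do rewrite raddfB /=; apply: measurable_funB;
  apply: measurableT_comp => //.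
Qed.

Lemma measurable_ktr_sub b d : measurable_fun setT (fun p : R[i] * R[i] => ktr b d (p.1 - p.2)).
Proof.
apply: measurable_maxr => //; apply: measurable_funB => //.
apply: measurableT_comp => //; apply: measurable_maxr => //; exact: measurable_cmod_sub.
Qed.

Lemma measurable_kap_sub b : measurable_fun setT (fun p : R[i] * R[i] => kap b (p.1 - p.2)).
Proof.
apply: (emeasurable_fun_cvg (fun n (p : R[i] * R[i]) => (ktr b n.+1%:R^-1 (p.1 - p.2))%:E)).
  by move=> n; apply/measurable_EFinP; exact: measurable_ktr_sub.
by move=> p _; exact: ktr_cvg.
Qed.

Lemma measurable_kapr b z : measurable_fun setT (fun w => kap b (z - w)).
Proof.
apply: (measurableT_comp (f := fun p : R[i] * R[i] => kap b (p.1 - p.2)) (g := fun w => (z, w))).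
  exact: measurable_kap_sub.
exact: pair1_measurable.
Qed.

Lemma measurable_ktrr b d z : measurable_fun setT (fun w => ktr b d (z - w)).
Proof.
apply: (measurableT_comp (f := fun p : R[i] * R[i] => ktr b d (p.1 - p.2)) (g := fun w => (z, w))).
  exact: measurable_ktr_sub.
exact: pair1_measurable.
Qed.

Lemma measurable_logmodr z : measurable_fun setT (fun w => logmod (z - w)).
Proof.
apply: (measurableT_comp measurable_lne_EFin).
apply: (measurableT_comp (f := fun p : R[i] * R[i] => cmod (p.1 - p.2)) (g := fun w => (z, w))).
  exact: measurable_cmod_sub.
exact: pair1_measurable.
Qed.

Local Open Scope ereal_scope.

(** Superharmonic convention: where all points carrying [mu] are within distance [b], this is ln b
    minus [potential], and +oo is allowed. Maximizing the energy means minimizing the integral of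
    [pot b mu] against [mu]. *)
Definition pot b (mu : {measure set R[i] -> \bar R}) (z : R[i]) : \bar R :=
  \int[mu]_w kap b (z - w)%R.

Lemma pot_ge0 b (mu : {measure set R[i] -> \bar R}) z : 0 <= pot b mu z.
Proof. by apply: integral_ge0 => w _; exact: kap_ge0. Qed.

Lemma measurable_pot b (mu : probability R[i] R) : measurable_fun setT (pot b mu).
Proof.
apply: (@measurable_fun_fubini_tonelli_F _ _ _ _ R mu (fun p : R[i] * R[i] => kap b (p.1 - p.2)%R)).
  exact: measurable_kap_sub.
by move=> p; exact: kap_ge0.
Qed.

Lemma pot_sym b (mu nu : probability R[i] R) :
  \int[nu]_z pot b mu z = \int[mu]_z pot b nu z.
Proof.
rewrite /pot (fubini_tonelli (fun p : R[i] * R[i] => kap b (p.1 - p.2)%R)).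
- by apply: eq_integral => w _; apply: eq_integral => z _; rewrite /= kapC.
- exact: measurable_kap_sub.
- by move=> p; exact: kap_ge0.
Qed.

Lemma pot_ktr_cvg b (mu : {measure set R[i] -> \bar R}) z :
  \int[mu]_w (ktr b n.+1%:R^-1 (z - w))%:E @[n --> \oo] --> pot b mu z.
Proof.
have -> : pot b mu z = \int[mu]_w limn (fun n => (ktr b n.+1%:R^-1 (z - w))%:E).
  by apply: eq_integral => w _; apply/esym/cvg_lim => //; exact: ktr_cvg.
apply: cvg_monotone_convergence => //.
- by move=> n; apply/measurable_EFinP; exact: measurable_ktrr.
- by move=> n w _; rewrite lee_fin ktr_ge0.
- move=> w _ m n mn; rewrite lee_fin ktr_nonincreasing//.
  by rewrite lef_pV2 ?posrE// ler_nat.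
Qed.

Lemma le_pot_ktr b d (mu : {measure set R[i] -> \bar R}) z : (0 < d)%R ->
  \int[mu]_w (ktr b d (z - w))%:E <= pot b mu z.
Proof.
move=> d0; apply: ge0_le_integral => //.
- by move=> w _; rewrite lee_fin ktr_ge0.
- by apply/measurable_EFinP; exact: measurable_ktrr.
- exact: measurable_kapr.
- by move=> w _; exact: ktr_le_kap.
Qed.

Lemma le_ktr_shift b d (mu : probability R[i] R) z z' : (0 < d)%R ->
  \int[mu]_w (ktr b d (z - w))%:E <= \int[mu]_w (ktr b d (z' - w))%:E + (cmod (z - z') / d)%:E.
Proof.
move=> d0; have m1 : mu setT = 1 := probability_setT mu.
have c0 : (0 <= cmod (z - z') / d)%R by rewrite divr_ge0 ?cmod_ge0 ?ltW.
have -> : (cmod (z - z') / d)%:E = \int[mu]_w (cst (cmod (z - z') / d)%:E) w.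
  by rewrite integral_cst// [X in _ * X]m1 mule1.
rewrite -ge0_integralD//.
- apply: ge0_le_integral => //.
  + by move=> w _; rewrite lee_fin ktr_ge0.
  + by apply/measurable_EFinP; exact: measurable_ktrr.
  + by apply: emeasurable_funD => //; apply/measurable_EFinP; exact: measurable_ktrr.
  + move=> w _; rewrite -EFinD lee_fin -lerBlDl.
    rewrite (le_trans (ler_norm _))// (le_trans (ktr_lipschitz _ _ _ d0))//.
    by rewrite opprB addrA subrK.
- by move=> w _; rewrite lee_fin ktr_ge0.
- by apply/measurable_EFinP; exact: measurable_ktrr.
Qed.

(** The potential is the increasing limit of the integrals of the Lipschitz kernels [ktr], and each
    of these passes an upper bound on to limit points. *)
Lemma pot_lsc b (mu : probability R[i] R) (z : R[i]) (V : R) :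
  (forall e : R, (0 < e)%R -> exists2 z', (cmod (z - z') < e)%R & pot b mu z' <= V%:E) ->
  pot b mu z <= V%:E.
Proof.
move=> h; rewrite -(cvg_lim _ (@pot_ktr_cvg b mu z))//.
apply: lime_le; first exact: cvgP (@pot_ktr_cvg b mu z).
apply: nearW => n; set d := (n.+1%:R^-1)%R; have d0 : (0 < d)%R by rewrite invr_gt0.
apply/lee_addgt0Pr => e e0.
(* The truncated potential is Lipschitz with constant 1/d, so a move shorter than e d costs at most
   e. *)
have [z' zz' Vz'] := h (e * d)%R (mulr_gt0 e0 d0).
apply: (le_trans (le_ktr_shift _ _ _ _ d0)); apply: leeD.
  exact: le_trans (le_pot_ktr _ _ _ d0) Vz'.
by rewrite lee_fin ler_pdivrMr// ltW.
Qed.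

Lemma closed_pot_le b (mu : probability R[i] R) (V : R) : closed [set z | pot b mu z <= V%:E].
Proof.
move=> z zc; apply: pot_lsc => e e0.
have [w [wV wz]] := zc _ (near_disk z e0).
by exists w => //; rewrite cmodBC.
Qed.

Lemma potential_pot b (mu : probability R[i] R) (K : set R[i]) z : (0 < b)%R ->
  measurable K -> carried_by K mu -> (forall w, K w -> (cmod (z - w) <= b)%R) ->
  potential mu z = (ln b)%:E - pot b mu z.
Proof.
move=> b0 mK muK zK.
rewrite /potential (integral_carried mK _ muK); last exact: measurable_logmodr.
rewrite (eq_integral (fun w => (ln b)%:E - kap b (z - w)%R)); last first.
  move=> w; rewrite inE => Kw; rewrite kapE ?zK//.
  by rewrite logmodE; case: eqP => //= _; rewrite -!EFinB; congr EFin; ring.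
rewrite -(integral_carried mK _ muK); last first.
  by apply: emeasurable_funB => //; exact: measurable_kapr.
rewrite integral_cstB//; first exact: measurable_kapr.
by move=> w; exact: kap_ge0.
Qed.

Lemma measurable_potential (mu : probability R[i] R) : measurable_fun setT (potential mu).
Proof.
pose f (p : R[i] * R[i]) := logmod (p.1 - p.2)%R.
have mf : measurable_fun setT f.
  by apply: (measurableT_comp measurable_lne_EFin); exact: measurable_cmod_sub.
have -> : potential mu = fun z => \int[mu]_w f^\+ (z, w) - \int[mu]_w f^\- (z, w).
  apply/funext => z; rewrite /potential integralE; congr (_ - _).
    by apply: eq_integral => w _; rewrite !funeposE.
  by apply: eq_integral => w _; rewrite !funenegE.
apply: emeasurable_funB.
  by apply: (@measurable_fun_fubini_tonelli_F _ _ _ _ R mu f^\+) => //; exact: measurable_funepos.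
by apply: (@measurable_fun_fubini_tonelli_F _ _ _ _ R mu f^\-) => //; exact: measurable_funeneg.
Qed.

Lemma energy_pot b (mu : probability R[i] R) (K : set R[i]) : (0 < b)%R ->
  measurable K -> carried_by K mu -> (forall z w, K z -> K w -> (cmod (z - w) <= b)%R) ->
  energy mu = (ln b)%:E - \int[mu]_z pot b mu z.
Proof.
move=> b0 mK muK KK.
have E w : \int[mu]_z logmod (z - w)%R = potential mu w.
  by apply: eq_integral => z _; rewrite /logmod cmodBC.
rewrite /energy; under eq_integral do rewrite E.
have mE : measurable_fun setT (fun w => (ln b)%:E - pot b mu w).
  by apply: emeasurable_funB => //; exact: measurable_pot.
rewrite (integral_carried mK (measurable_potential mu) muK).
rewrite (eq_integral (fun w => (ln b)%:E - pot b mu w)); last first.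
  by move=> w; rewrite inE => Kw; apply: (potential_pot b0 mK muK) => v; exact: KK.
rewrite -(integral_carried mK mE muK) integral_cstB//; first exact: measurable_pot.
by move=> w; exact: pot_ge0.
Qed.

End potential.

(** * Continuity, mean value and domination principles *)

Section max_principle.
Context (R : realType).
Implicit Types (x y z w : R[i]) (b d : R).

Lemma seq_max (T : eqType) (f : T -> R) (s : seq T) (y0 : T) : y0 \in s ->
  exists2 y : T, y \in s & forall x : T, x \in s -> f x <= f y.
Proof.
elim: s y0 => // x s ih y0 _; case: s ih => [|x' s] ih.
  by exists x => [|x']; rewrite inE ?eqxx// => /eqP->.
have [y ys yP] := ih x' (mem_head _ _).
have [xy|yx] := leP (f x) (f y).
  exists y; first by rewrite inE ys orbT.
  by move=> z; rewrite inE => /predU1P[->//|/yP].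
exists x; first exact: mem_head.
by move=> z; rewrite inE => /predU1P[->//|/yP /le_trans]; apply; exact: ltW.
Qed.

(** Without a maximum, every [z] in [C] has some [m z] in [C] with a larger value, and [u] stays
    below [u (m z)] near [z]. In a finite subcover by such neighbourhoods, the centre [y] with the
    largest [u (m y)] makes [m y] a point that none of them covers. *)
Lemma compact_usc_max (C : set R[i]) (u : R[i] -> R) : compact C -> C !=set0 ->
  (forall z (c : R), C z -> u z < c -> \forall w \near z, u w < c) ->
  exists2 z, C z & forall w, C w -> u w <= u z.
Proof.
move=> cC [z0 Cz0] usc; apply: contrapT => nomax.
have /choice[m mP] : forall z, exists w, C z -> C w /\ u z < u w.
  move=> z; have [Cz|nCz] := pselect (C z); last by exists z.
  apply: contrapT => h; apply: nomax; exists z => // w Cw.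
  by rewrite leNgt; apply/negP => zw; apply: h; exists w.
have [|s [sC Cs]] := @compact_finite_cover R C (fun z => [set w | u w < u (m z)]) cC.
  by move=> z Cz; apply: usc => //; have [] := mP z Cz.
have [y0 y0s _] := Cs z0 Cz0.
have [y ys ymax] : exists2 y, y \in s & forall x, x \in s -> u (m x) <= u (m y).
  exact: (seq_max (fun x => u (m x)) y0s).
have [Cmy _] := mP _ (sC _ ys).
have [x xs] := Cs _ Cmy; rewrite /= ltNge => /negP; apply; exact: ymax.
Qed.

Lemma compact_nearest (S : set R[i]) z : compact S -> S !=set0 ->
  exists2 y, S y & forall w, S w -> cmod (z - y) <= cmod (z - w).
Proof.
move=> cS S0; have [|y Sy yP] := @compact_usc_max S (fun w => - cmod (w - z)) cS S0.
  move=> w c _ wc; have FF : Filter (nbhs w) by typeclasses eauto.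
  have e0 : 0 < c + cmod (w - z) by rewrite -ltrBlDr sub0r.
  apply: filterS (near_disk w e0) => v vw.
  rewrite ltrNl; have := ler_dist_cmod (w - z) (v - z).
  have -> : w - z - (v - z) = w - v by ring.
  by rewrite (cmodBC w v) ler_norml => /andP[_]; lra.
by exists y => // w /yP; rewrite lerN2 !(cmodBC z).
Qed.

(** Halving the distance to the pole raises the kernel by at most ln 2, also under the cutoff. *)
Lemma kap_doubling b x y : cmod y <= 2 * cmod x -> (kap b x <= kap b y + (ln 2)%:E)%E.
Proof.
rewrite /kap; have [->|x0] := eqVneq x 0.
  by rewrite cmod0 mulr0 => y0; rewrite ifT// -cmod_eq0 eq_le y0 cmod_ge0.
have [->|y0] := eqVneq y 0; first by rewrite leey.
rewrite -EFinD lee_fin => yx; have : ln (cmod y) <= ln 2 + ln (cmod x).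
  by rewrite -lnM ?posrE ?cmod_gt0// ler_ln// posrE ?mulr_gt0 ?cmod_gt0.
have l2 : 0 <= ln (2 : R) by rewrite ln_ge0// ler1n.
by rewrite !maxEle; case: (leP 0 (ln b - ln (cmod x))) => ?;
  case: (leP 0 (ln b - ln (cmod y))) => ? ?; lra.
Qed.

Lemma pot_carried b (mu : probability R[i] R) (S : set R[i]) z : measurable S ->
  mu (~` S) = 0%E -> pot b mu z = (\int[mu]_(w in S) kap b (z - w)%R)%E.
Proof.
by move=> mS muS; rewrite /pot (integral_carried mS _ muS)//; exact: measurable_kapr.
Qed.

Lemma pot_off b d (mu : probability R[i] R) (S : set R[i]) z : measurable S ->
  mu (~` S) = 0%E -> 0 < d -> (forall w, S w -> d <= cmod (z - w)) ->
  pot b mu z = (\int[mu]_w (ktr b d (z - w)%R)%:E)%E.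
Proof.
move=> mS muS d0 zS; rewrite (pot_carried _ _ mS muS) (integral_carried mS _ muS); last first.
  by apply/measurable_EFinP; exact: measurable_ktrr.
by apply: eq_integral => w; rewrite inE => Sw; rewrite ktr_kap ?zS.
Qed.

Lemma integral_ktr_le b d (mu : probability R[i] R) z : 0 < d ->
  (\int[mu]_w (ktr b d (z - w)%R)%:E <= (Num.max 0 (ln b - ln d))%R%:E)%E.
Proof.
move=> d0; have m1 : mu setT = 1%E := probability_setT mu.
have -> : (Num.max 0 (ln b - ln d))%R%:E = (\int[mu]_w (cst (Num.max 0 (ln b - ln d))%R%:E) w)%E.
  by rewrite integral_cst// [X in (_ * X)%E]m1 mule1.
apply: ge0_le_integral => //.
- by move=> w _; rewrite lee_fin ktr_ge0.
- by apply/measurable_EFinP; exact: measurable_ktrr.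
- move=> w _; rewrite lee_fin /ktr ge_max !le_max lexx/= lerD2l lerN2.
  by rewrite ler_ln ?posrE ?lt_max ?d0 ?orbT// le_max lexx !orbT.
Qed.

(* Continuity principle: [z'] is the point of [S] nearest to [z], so that
   [|z' - w| <= 2 |z - w|] for all [w] in [S]. *)
Lemma pot_near_support b (mu : probability R[i] R) (S : set R[i]) (V : R) y :
  0 < b -> compact S -> mu (~` S) = 0%E -> (forall z, S z -> (pot b mu z <= V%:E)%E) -> S y ->
  forall e : R, 0 < e -> exists2 rho : R, 0 < rho &
    forall z, cmod (z - y) < rho -> (pot b mu z <= (V + e)%R%:E)%E.
Proof.
move=> b0 cS muS SV Sy e e0.
have mS := compact_measurableC cS.
have V0 : 0 <= V by rewrite -lee_fin (le_trans _ (SV y Sy))// pot_ge0.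
have l2 : 0 < ln (2 : R) by rewrite ln_gt0// ltr1n.
(* On the ball of radius [d] = b exp(-A) about [y] the kernel is at least A, so the ball has mass at
   most V / A; since A > 2 ln 2 V / e, this mass times ln 2 is at most e/2. The summand 1 keeps A
   positive when V = 0. *)
pose A := 2 * ln 2 * V / e + 1.
have A0 : 0 < A by rewrite ltr_wpDl// divr_ge0 ?(ltW e0)// !mulr_ge0// ltW.
pose d := b * expR (- A).
have d0 : 0 < d by rewrite mulr_gt0// expR_gt0.
have muD : (mu (ball_at y d) * A%:E <= V%:E)%E.
  apply: le_trans (SV y Sy); rewrite muleC.
  have mB := measurable_ball_at y d.
  have -> : (A%:E * mu (ball_at y d) = \int[mu]_(w in ball_at y d) (cst A%:E) w)%E.
    by rewrite integral_cst.
  apply: (@le_trans _ _ (\int[mu]_(w in ball_at y d) kap b (y - w)%R)%E).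
    apply: ge0_le_integral => //.
    - by move=> w _; rewrite lee_fin ltW.
    - by apply: measurable_funTS; exact: measurable_kapr.
    move=> w; rewrite /ball_at /= => wy; rewrite /kap; case: eqVneq => [_|yw].
      by rewrite leey.
    rewrite lee_fin le_max; apply/orP; right; rewrite cmodBC lerBrDr addrC -lerBrDr.
    have -> : ln b - A = ln d by rewrite /d lnM ?posrE ?expR_gt0// expRK.
    by rewrite ler_ln ?posrE ?ltW// cmodBC cmod_gt0.
  apply: ge0_subset_integral => //; first exact: measurable_kapr.
  by move=> w _; exact: kap_ge0.
have muD2 : (mu (ball_at y d) * (ln 2)%:E <= (e / 2)%R%:E)%E.
  have mB := measurable_ball_at y d.
  move: muD; have : mu (ball_at y d) \is a fin_num by exact: fin_num_measure.
  move=> /fineK <-; rewrite -!EFinM !lee_fin; set m := fine _ => mA.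
  have m0 : 0 <= m by rewrite fine_ge0.
  rewrite -(@ler_pM2r _ A)// mulrAC; apply: (le_trans (ler_wpM2r (ltW l2) mA)).
  rewrite /A mulrDr mulr1 ler_wpDr ?divr_ge0 ?(ltW e0)//.
  by rewrite le_eqVlt; apply/orP; left; apply/eqP; field; rewrite gt_eqF.
(* If |z - y| < d/4, the nearest point z' is within d/2 of y, so z and z' are at least d/2 away from
   the part of [S] outside the ball. There the kernel is Lipschitz with constant 2/d, and |z - z'| <
   d e / 4 costs at most e/2. *)
exists (Num.min (d / 4) (d * e / 4)).
  by rewrite lt_min !divr_gt0// mulr_gt0.
move=> z; rewrite lt_min => /andP[zy1 zy2].
have [z' Sz' z'P] := compact_nearest z cS (ex_intro _ y Sy).
have zz' := z'P _ Sy.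
have pointwise w : S w -> (kap b (z - w)%R <=
   kap b (z' - w)%R + ((ln 2 * \1_(ball_at y d) w)%R%:E + (2 * cmod (z - z') / d)%R%:E))%E.
  move=> Sw; rewrite indicE; have [wD|wD] := boolP (w \in ball_at y d).
    rewrite mulr1 addeA; apply: (@le_trans _ _ (kap b (z' - w)%R + (ln 2)%:E)%E).
      apply: kap_doubling; have := z'P _ Sw; have := ler_cmod_dist z z' w.
      by rewrite (cmodBC z' z); lra.
    by rewrite leeDl// lee_fin divr_ge0 ?mulr_ge0 ?cmod_ge0// ltW.
  rewrite mulr0 add0e; move: wD; rewrite notin_setE /ball_at /= => /negP.
  rewrite -leNgt => wD; have d2 : 0 < d / 2 by rewrite divr_gt0.
  have h1 := ler_cmod_dist z w y; have h2 := ler_cmod_dist z' w y.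
  have h3 := ler_cmod_dist z z' y; rewrite (cmodBC z' z) in h3.
  rewrite (cmodBC w z) in h1; rewrite (cmodBC w z') in h2.
  rewrite -(@ktr_kap _ b (d / 2) (z - w))//; last lra.
  rewrite -(@ktr_kap _ b (d / 2) (z' - w))//; last lra.
  rewrite -EFinD lee_fin -lerBlDl (le_trans (ler_norm _))//.
  rewrite (le_trans (ktr_lipschitz _ _ _ d2))//.
  have -> : z - w - (z' - w) = z - z' by ring.
  by rewrite le_eqVlt; apply/orP; left; apply/eqP; field; rewrite gt_eqF.
apply: (@le_trans _ _ (pot b mu z' + (mu (ball_at y d) * (ln 2)%:E + (2 * cmod (z - z') / d)%R%:E))%E).
  have m1 : mu setT = 1%E := probability_setT mu.
  have mB := measurable_ball_at y d.
  have c0 : 0 <= 2 * cmod (z - z') / d by rewrite divr_ge0 ?mulr_ge0 ?cmod_ge0// ltW.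
  have -> : (mu (ball_at y d) * (ln 2)%:E)%E = (\int[mu]_w (ln 2 * \1_(ball_at y d) w)%R%:E)%E.
    under eq_integral do rewrite EFinM.
    rewrite ge0_integralZl//; last 2 first.
    - by apply/measurable_EFinP; exact: measurable_indic.
    - by rewrite lee_fin ltW.
    by rewrite integral_indic// setIT muleC.
  have -> : (2 * cmod (z - z') / d)%R%:E = (\int[mu]_w (cst (2 * cmod (z - z') / d)%R%:E) w)%E.
    by rewrite integral_cst// [X in (_ * X)%E]m1 mule1.
  have mi : measurable_fun setT (fun w => (ln 2 * \1_(ball_at y d) w)%R%:E : \bar R).
    by apply/measurable_EFinP; apply: measurable_funM => //; exact: measurable_indic.
  have i0 w : (0 <= (ln 2 * \1_(ball_at y d) w)%R%:E :> \bar R)%E.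
    by rewrite lee_fin mulr_ge0// ltW.
  rewrite -ge0_integralD// -ge0_integralD//.
  - rewrite (pot_carried _ _ mS muS) [leRHS](integral_carried mS _ muS).
      apply: ge0_le_integral => //.
      + by move=> w _; exact: kap_ge0.
      + by apply: measurable_funTS; exact: measurable_kapr.
      + apply: measurable_funTS; apply: emeasurable_funD; first exact: measurable_kapr.
        exact: emeasurable_funD.
    by apply: emeasurable_funD; [exact: measurable_kapr|exact: emeasurable_funD].
  - by move=> w _; exact: kap_ge0.
  - exact: measurable_kapr.
  - by move=> w _; rewrite adde_ge0// lee_fin.
  - exact: emeasurable_funD.
rewrite EFinD; apply: leeD; first exact: SV.
rewrite (splitr e) EFinD; apply: leeD => //.
rewrite lee_fin ler_pdivrMr//; lra.
Qed.

End max_principle.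

Section domination.
Context (R : realType).
Implicit Types (x y z w : R[i]) (b d : R).

(** The list of the N-th roots of u^N. The product identity turns a sum of logarithms over the orbit
    into a single logarithm. *)
Lemma unity_orbit (N : nat) (u : R[i]) : (0 < N)%N -> exists rs : seq R[i],
  [/\ size rs = N, u \in rs, forall v, v \in rs -> cmod v = cmod u &
      forall x, \prod_(v <- rs) (x - v) = x ^+ N - u ^+ N].
Proof.
move=> N0; have [rs] := closed_field_poly_normal ('X^N - (u ^+ N)%:P).
rewrite (monicP (monicXnsubC _ N0)) scale1r => pE; exists rs.
have ux v : (v \in rs) = (v ^+ N == u ^+ N).
  by rewrite -root_prod_XsubC -pE /root !hornerE subr_eq0.
split.
- by have := size_XnsubC (u ^+ N) N0; rewrite pE size_prod_XsubC => -[].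
- by rewrite ux.
- move=> v; rewrite ux => /eqP /(congr1 (@cmod R)); rewrite !cmodX => /eqP.
  by rewrite eqrXn2 ?cmod_ge0// => /eqP.
- move=> x; have := congr1 (fun p => p.[x]) pE; rewrite !hornerE horner_prod => ->.
  by apply: eq_bigr => v _; rewrite !hornerE.
Qed.

Lemma sum_ln_cmod (s : seq R[i]) (f : R[i] -> R[i]) : (forall v, v \in s -> f v != 0) ->
  \sum_(v <- s) ln (cmod (f v)) = ln (cmod (\prod_(v <- s) f v)).
Proof.
elim: s => [_|v s ih fs]; first by rewrite !big_nil cmod1 ln1.
have fs' w : w \in s -> f w != 0 by move=> ws; apply: fs; rewrite inE ws orbT.
rewrite !big_cons cmodM lnM ?posrE ?cmod_gt0 ?fs ?mem_head//; first by rewrite ih.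
by rewrite prodf_seq_neq0; apply/allP => w /fs' ->; rewrite implybT.
Qed.

(** From |x^N - u^N| <= |x|^N (1 + (|u| / |x|)^N) and ln (1 + t) <= t: the mean of the kernel over
    the orbit falls short of its central value by at most an exponentially small amount. *)
Lemma kap_unity_orbit b d (N : nat) (u : R[i]) (rs : seq R[i]) x : 0 < d -> d <= cmod x ->
  cmod x <= b -> cmod u < d -> size rs = N -> (forall v, v \in rs -> cmod v = cmod u) ->
  \prod_(v <- rs) (x - v) = x ^+ N - u ^+ N ->
  (N%:R%:E * kap b x <= \sum_(v <- rs) kap b (x - v)%R + ((cmod u / d) ^+ N)%:E)%E.
Proof.
move=> d0 dx xb ud sN ru prodE.
have x0 : 0 < cmod x := lt_le_trans d0 dx.
have b0 : 0 < b := lt_le_trans x0 xb.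
have nz v : v \in rs -> x - v != 0.
  move=> /ru vu; rewrite subr_eq0; apply/eqP => xv.
  by move: (lt_le_trans ud dx); rewrite xv vu ltxx.
have -> : (N%:R%:E * kap b x = (N%:R * (ln b - ln (cmod x)))%:E)%E.
  by rewrite kapE// logmodE -cmod_eq0 gt_eqF//= -EFinB -EFinM.
apply: (@le_trans _ _ ((\sum_(v <- rs) (ln b - ln (cmod (x - v))))%:E + ((cmod u / d) ^+ N)%:E)%E); last first.
  rewrite leeD2r// -sumEFin !big_seq; apply: lee_sum => v vs.
  by rewrite /kap (negbTE (nz v vs)) lee_fin le_max lexx orbT.
rewrite -EFinD lee_fin sumrB sum_ln_cmod// prodE.
have -> : \sum_(i <- rs) ln b = N%:R * ln b.
  by rewrite big_const_seq count_predT sN iter_addr_0 mulr_natl.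
suff : ln (cmod (x ^+ N - u ^+ N)) <= N%:R * ln (cmod x) + (cmod u / d) ^+ N.
  by rewrite mulrBr; lra.
have h : cmod (x ^+ N - u ^+ N) <= cmod x ^+ N * (1 + (cmod u / cmod x) ^+ N).
  rewrite (le_trans (ler_cmodB _ _))// !cmodX mulrDr mulr1 lerD2l -exprMn mulrC divfK//.
  by rewrite gt_eqF.
have h0 : 0 <= (cmod u / cmod x) ^+ N by rewrite exprn_ge0// divr_ge0 ?cmod_ge0.
have p0 : 0 < cmod (x ^+ N - u ^+ N).
  rewrite cmod_gt0 -prodE prodf_seq_neq0; apply/allP => w /nz ->.
  by rewrite implybT.
apply: (@le_trans _ _ (ln (cmod x ^+ N * (1 + (cmod u / cmod x) ^+ N)))).
  by rewrite ler_ln// posrE mulr_gt0// ?exprn_gt0//; lra.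
rewrite lnM ?posrE ?exprn_gt0//; last by lra.
rewrite lnXn// mulr_natl lerD2l (le_trans (le_ln1Dx _))//; first lra.
by rewrite lerXn2r ?nnegrE ?divr_ge0 ?cmod_ge0 ?(ltW d0)// ler_wpM2l ?cmod_ge0// lef_pV2.
Qed.

(* Discrete mean value inequality over the N-th roots of [u ^ N]. *)
Lemma pot_unity_orbit b d (mu : probability R[i] R) (S : set R[i]) (N : nat) (u : R[i])
    (rs : seq R[i]) z : measurable S -> mu (~` S) = 0%E -> 0 < d ->
  (forall w, S w -> d <= cmod (z - w) <= b) ->
  cmod u < d -> size rs = N -> (forall v, v \in rs -> cmod v = cmod u) ->
  (forall x, \prod_(v <- rs) (x - v) = x ^+ N - u ^+ N) ->
  (N%:R%:E * pot b mu z <= \sum_(v <- rs) pot b mu (z - v)%R + ((cmod u / d) ^+ N)%:E)%E.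
Proof.
move=> mS muS d0 Sz ud sN ru prodE.
have m1 : mu setT = 1%E := probability_setT mu.
have c0 : 0 <= (cmod u / d) ^+ N by rewrite exprn_ge0// divr_ge0 ?cmod_ge0 ?ltW.
have -> : ((cmod u / d) ^+ N)%:E = (\int[mu]_w (cst ((cmod u / d) ^+ N)%:E) w)%E.
  by rewrite integral_cst// [X in (_ * X)%E]m1 mule1.
rewrite /pot -ge0_integral_sum//; last 2 first.
- by move=> v; exact: measurable_kapr.
- by move=> v w _; exact: kap_ge0.
have ms : measurable_fun setT (fun w => \sum_(v <- rs) kap b (z - v - w)%R)%E.
  by apply: emeasurable_sum => v; exact: measurable_kapr.
rewrite -ge0_integralZl//; last 2 first.
- exact: measurable_kapr.
- by move=> w _; exact: kap_ge0.
rewrite -ge0_integralD//; last by move=> w _; apply: sume_ge0 => v _; exact: kap_ge0.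
have mr : measurable_fun setT (fun w => N%:R%:E * kap b (z - w)%R)%E.
  by apply: measurable_funeM; exact: measurable_kapr.
rewrite (integral_carried mS mr muS) [leRHS](integral_carried mS _ muS); last exact: emeasurable_funD.
apply: ge0_le_integral => //.
- by move=> w _; rewrite mule_ge0// kap_ge0.
- exact: measurable_funTS.
- by apply: measurable_funTS; exact: emeasurable_funD.
move=> w /Sz/andP[zw1 zw2].
rewrite (eq_bigr (fun v => kap b (z - w - v)%R)); last by move=> v _; congr kap; ring.
exact: kap_unity_orbit.
Qed.

(* At a point of the compact set where the potential attains a maximum larger than
   [V], the mean value inequality over circles makes it constant up to the nearest
   point of [S], where it is at most [V]. *)
Lemma domination_principle b (mu : probability R[i] R) (S : set R[i]) (V r : R) :
  0 < r -> 4 * r <= b -> compact S -> S `<=` cdisk r -> mu (~` S) = 0%E ->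
  ln b - ln (2 * r) <= V -> (forall z, S z -> (pot b mu z <= V%:E)%E) ->
  forall z, (pot b mu z <= V%:E)%E.
Proof.
move=> r0 rb cS Sr muS Vb SV.
have mS := compact_measurableC cS.
have b0 : 0 < b by lra.
have S0 : S !=set0.
  apply/set0P/negP => /eqP S0; move: muS; rewrite S0 setC0.
  have -> : mu setT = 1%E := probability_setT mu.
  by move=> /eqP; rewrite onee_eq0.
(* Outside the disk of radius 3r the distance to [S] exceeds 2r, and there the kernel is at most ln
   b - ln (2r) <= V. Only a compact disk remains. *)
have far z : ~ cdisk (3 * r) z -> (pot b mu z <= V%:E)%E.
  move=> /negP; rewrite -ltNge => zr; have r2 : 0 < 2 * r by rewrite mulr_gt0.
  rewrite (pot_off _ mS muS r2).
    apply: (le_trans (integral_ktr_le _ _ _ r2)); rewrite lee_fin ge_max Vb andbT.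
    by apply: le_trans Vb; rewrite subr_ge0 ler_ln ?posrE//; lra.
  move=> w /Sr; rewrite /cdisk /= => wr.
  have := ler_dist_cmod z w; rewrite ler_norml => /andP[_]; lra.
have off z : ~ S z -> exists d, [/\ 0 < d & forall w, S w -> d <= cmod (z - w)].
  move=> nSz; have [y Sy yP] := compact_nearest z cS S0.
  exists (cmod (z - y)); split=> //; rewrite cmod_gt0 subr_eq0.
  by apply/eqP => zy; apply: nSz; rewrite zy.
have fin z : pot b mu z = (fine (pot b mu z))%:E.
  rewrite fineK// ge0_fin_numE ?pot_ge0//.
  have [/SV Sz|/off[d [d0 dS]]] := pselect (S z); first by rewrite (le_lt_trans Sz)// ltry.
  by rewrite (pot_off _ mS muS d0 dS) (le_lt_trans (integral_ktr_le _ _ _ d0))// ltry.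
pose p z := fine (pot b mu z); have pE z : pot b mu z = (p z)%:E := fin z.
move=> z1; rewrite leNgt; apply/negP; rewrite pE lte_fin => Vz1.
have z1r : cdisk (3 * r) z1.
  by apply: contrapT => /far; rewrite pE lee_fin leNgt Vz1.
(* The maximum with [V] makes the function upper semicontinuous at the points of [S], near which the
   continuity principle bounds the potential by V + e; off [S] the potential is continuous. *)
have [|z0 z0r z0P] := @compact_usc_max R _ (fun z => Num.max (p z) V)
    (@compact_cdisk R (3 * r)) (ex_intro _ _ z1r).
  move=> z c _; rewrite gt_max => /andP[pc Vc].
  have [Sz|/off[d [d0 dS]]] := pselect (S z).
    have e0 : 0 < (c - V) / 2 by rewrite divr_gt0// subr_gt0.
    have [rho rho0 rhoP] := pot_near_support b0 cS muS SV Sz e0.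
    apply: filterS (near_disk z rho0) => w /rhoP.
    by rewrite pE lee_fin gt_max Vc andbT => pw; rewrite (le_lt_trans pw)//; lra.
  have d2 : 0 < d / 2 by rewrite divr_gt0.
  have e0 : 0 < Num.min (d / 2) ((c - p z) * (d / 2)).
    by rewrite lt_min d2 mulr_gt0// subr_gt0.
  apply: filterS (near_disk z e0) => w; rewrite lt_min => /andP[wz1 wz2].
  rewrite gt_max Vc andbT -lte_fin -pE (pot_off _ mS muS d2); last first.
    by move=> v /dS dv; have := ler_cmod_dist w z v; rewrite (cmodBC z w); lra.
  apply: (le_lt_trans (le_ktr_shift _ _ _ z d2)).
  rewrite -(pot_off _ mS muS d2); last by move=> v /dS; lra.
  by rewrite pE -EFinD lte_fin -ltrBrDl ltr_pdivrMr.
set M := Num.max (p z0) V in z0P.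
have VM : V < M by apply: (lt_le_trans Vz1); apply: le_trans (z0P _ z1r); rewrite le_max lexx.
have pz0 : p z0 = M by move: VM; rewrite /M lt_max ltxx orbF => /ltW/max_l ->.
have pM z : p z <= M.
  have [zr|/far] := pselect (cdisk (3 * r) z); last by rewrite pE lee_fin => /le_trans; apply; exact: ltW.
  by apply: le_trans (z0P _ zr); rewrite le_max lexx.
have nSz0 : ~ S z0 by move=> /SV; rewrite pE lee_fin pz0 leNgt VM.
have [y Sy yP] := compact_nearest z0 cS S0.
set d := cmod (z0 - y) in yP.
have d0 : 0 < d.
  by rewrite cmod_gt0 subr_eq0; apply/eqP => zy; apply: nSz0; rewrite zy.
have e0 : 0 < (M - V) / 2 by rewrite divr_gt0// subr_gt0.
have [rho rho0 rhoP] := pot_near_support b0 cS muS SV Sy e0.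
(* The circle about [z0] of radius s d stays off [S], yet passes within [rho] of [y], where the
   potential is at most (V + M) / 2. *)
have [s /andP[s0 s1] sd] : exists2 s : R, 0 <= s < 1 & (1 - s) * d < rho.
  have [dr|rd] := ltP d rho; first by exists 0; rewrite ?lexx ?ltr01// subr0 mul1r.
  exists (1 - rho / (2 * d)).
    rewrite subr_ge0 ltrBlDr ltrDl divr_gt0 ?mulr_gt0// andbT ler_pdivrMr ?mulr_gt0//; lra.
  have -> : (1 - (1 - rho / (2 * d))) * d = rho / 2 by field; rewrite gt_eqF.
  lra.
pose u := (s%:C * (z0 - y)).
have uE : cmod u = s * d by rewrite cmodM cmodR ger0_norm.
have ud : cmod u < d by rewrite uE gtr_pMl.
have pu : p (z0 - u) <= V + (M - V) / 2.
  rewrite -lee_fin -pE; apply: rhoP.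
  have -> : z0 - u - y = (1 - s)%:C * (z0 - y) by rewrite /u rmorphB/= rmorph1; ring.
  by rewrite cmodM cmodR ger0_norm// subr_ge0 ltW.
(* Of the N values on the orbit one lies at least (M - V) / 2 below M and the others are at most M.
   An error s^N below (M - V) / 2 then contradicts the mean value inequality at [z0], where the
   value is M. *)
have [N N0 sN] : exists2 N, (0 < N)%N & s ^+ N < (M - V) / 2.
  have : (fun n => s ^+ n) @ \oo --> (0 : R) by apply: cvg_expr; rewrite ger0_norm.
  move=> /cvgrPdist_lt/(_ _ e0)[n _ nP]; exists n.+1 => //.
  by have := nP n.+1 (leqnSn _); rewrite sub0r normrN ger0_norm// exprn_ge0.
have [rs [srs urs ru prodE]] := unity_orbit u N0.
(* This is where 4r <= b enters: distances from the disk of radius 3r to [S] are at most 3r + r, so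
   the kernel is not cut off. *)
have zS w : S w -> d <= cmod (z0 - w) <= b.
  move=> Sw; rewrite yP//=; have := Sr _ Sw; have := z0r; rewrite /cdisk /=.
  by have := ler_cmodB z0 w; lra.
have := pot_unity_orbit mS muS d0 zS ud srs ru prodE.
rewrite pE -EFinM (eq_bigr (fun v => (p (z0 - v))%:E)); last by move=> v _; exact: pE.
rewrite sumEFin -EFinD lee_fin pz0 (big_rem u)//= uE mulfK ?gt_eqF//.
have : \sum_(v <- rem u rs) p (z0 - v) <= (N%:R - 1) * M.
  have -> : (N%:R - 1) * M = \sum_(v <- rem u rs) M.
    rewrite big_const_seq count_predT iter_addr_0 size_rem// srs -[RHS]mulr_natl.
    by rewrite -subn1 natrB.
  by apply: ler_sum => v _; exact: pM.
lra.
Qed.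

End domination.

(** * Restrictions and mixtures of probability measures *)

Section probability_constructions.
Context d (T : measurableType d) (R : realType).
Local Open Scope ereal_scope.

(** [m] is the sum of its restrictions to [A] and to the complement, and the function cut to [A]
    does not see the second. *)
Lemma ge0_integral_mrestr (m : {measure set T -> \bar R}) (A : set T) (mA : measurable A)
    (f : T -> \bar R) : measurable_fun setT f -> (forall x, 0 <= f x) ->
  \int[mrestr m mA]_x f x = \int[m]_(x in A) f x.
Proof.
move=> mf f0; have mAC := measurableC mA.
have mfA : measurable_fun setT (f \_ A) by apply/(measurable_restrict f mA measurableT); rewrite setTI; exact: measurable_funTS.
have fA0 x : 0 <= (f \_ A) x by rewrite patchE; case: ifP.
rewrite [RHS]integral_mkcond.
rewrite (eq_measure_integral (measure_add (mrestr m mA) (mrestr m mAC))); last first.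
  move=> B mB _; apply: esym; apply: (etrans (measure_addE (mrestr m mA) (mrestr m mAC) B)).
  rewrite /= /mrestr -measureU//.
  - by rewrite -setIUr setUv setIT.
  - exact: measurableI.
  - exact: measurableI.
  - by rewrite setIACA setICr setI0.
rewrite ge0_integral_measure_add//.
have h1 : mrestr m mA (~` A) = 0 by rewrite /mrestr setICl measure0.
have h2 : mrestr m mAC (~` ~` A) = 0 by rewrite /mrestr setCK setICr measure0.
rewrite [X in X + _](ge0_integral_carried mA _ _ h1)// [X in _ + X](ge0_integral_carried mAC _ _ h2)//.
rewrite [LHS](ge0_integral_carried mA _ _ h1)// [X in _ + X]integral0_eq ?adde0.
  by apply: eq_integral => x xA; rewrite patchE xA.
by move=> x /= xA; rewrite patchE ifF//; apply/negP; rewrite inE.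
Qed.

Lemma restricted_probability (m : probability T R) (A : set T) : measurable A -> 0 < m A ->
  exists s : probability T R,
  [/\ forall B, measurable B -> A `&` B = set0 -> s B = 0 &
      forall f : T -> \bar R, measurable_fun setT f -> (forall x, 0 <= f x) ->
        \int[s]_x f x = ((fine (m A))^-1)%:E * \int[m]_(x in A) f x].
Proof.
move=> mA A0; have mAE : mrestr m mA setT = m A by rewrite /mrestr setTI.
have [|s sE] := @normalized_probability _ _ R (mrestr m mA).
  by rewrite /= /mrestr setTI A0 /= (le_lt_trans (probability_le1 _ mA))// ltry.
have c0 : (0 <= (fine (m A))^-1)%R by rewrite invr_ge0 fine_ge0// ltW.
exists s; split=> [B mB AB|f mf f0].
  by rewrite sE// /= /mrestr setIC AB measure0 mul0e.
rewrite (eq_measure_integral (mscale (NngNum c0) (mrestr m mA))).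
  by rewrite ge0_integral_mscale// ge0_integral_mrestr.
move=> B mB _; apply: (etrans (sE B mB)).
by rewrite /= /mscale /= /mrestr setTI muleC.
Qed.

Lemma mixture_probability (m s : probability T R) (t : R) : (0 <= t <= 1)%R ->
  exists u : probability T R,
  [/\ forall B, measurable B -> m B = 0 -> s B = 0 -> u B = 0 &
      forall f : T -> \bar R, measurable_fun setT f -> (forall x, 0 <= f x) ->
        \int[u]_x f x = (1 - t)%:E * \int[m]_x f x + t%:E * \int[s]_x f x].
Proof.
move=> /andP[t0 t1]; have t1' : (0 <= 1 - t)%R by rewrite subr_ge0.
pose mu : {measure set T -> \bar R} := measure_add (mscale (NngNum t1') m) (mscale (NngNum t0) s).
have m1 : m setT = 1 := probability_setT m.
have s1 : s setT = 1 := probability_setT s.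
have muE B : mu B = (1 - t)%:E * m B + t%:E * s B by apply: (etrans (measure_addE _ _ _)).
have [|u uE] := @probability_of_measure _ _ R mu.
  apply: (etrans (muE setT)).
  by rewrite [X in _ * X + _]m1 [X in _ + _ * X]s1 !mule1 -EFinD subrK.
exists u; split=> [B mB mB0 sB0|f mf f0].
  apply: (etrans (uE B mB)); apply: (etrans (muE B)).
  by rewrite [X in _ * X + _]mB0 [X in _ + _ * X]sB0 !mule0 adde0.
rewrite (eq_measure_integral mu); last by move=> B mB _; exact: uE.
by rewrite ge0_integral_measure_add// !ge0_integral_mscale.
Qed.

End probability_constructions.

(** * The equilibrium measure *)

Section equilibrium.
Context (R : realType) (K : set R[i]) (r b : R).
Hypotheses (cK : compact K) (r0 : 0 < r) (Kr : K `<=` cdisk r) (rb : 4 * r <= b).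
Implicit Types mu nu om m s : probability R[i] R.
Local Open Scope ereal_scope.

(** The equilibrium condition for the nonnegative kernel; [V] is the equilibrium constant, ln b
    minus the energy. *)
Definition minimizer V om := [/\ carried_by K om, \int[om]_z pot b om z = V%:E &
  forall nu, carried_by K nu -> V%:E <= \int[nu]_z pot b nu z].

Let mK := compact_measurableC cK.

Lemma minimizer_ge0 V om : minimizer V om -> (0 <= V)%R.
Proof.
move=> [_ E _]; rewrite -lee_fin -E; apply: integral_ge0 => z _; exact: pot_ge0.
Qed.

Lemma mixture_pot om s (u : probability R[i] R) (t : R) : (forall f : R[i] -> \bar R, measurable_fun setT f -> (forall x, 0 <= f x) ->
    \int[u]_x f x = (1 - t)%:E * \int[om]_x f x + t%:E * \int[s]_x f x) ->
  forall z, pot b u z = (1 - t)%:E * pot b om z + t%:E * pot b s z.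
Proof.
by move=> uE z; rewrite /pot uE//; [exact: measurable_kapr|move=> w; exact: kap_ge0].
Qed.

(** With X and S the integrals of [pot b om] and [pot b s] against [s], the mixture (1 - t) om + t s
    has mutual integral (1 - t)^2 V + 2 t (1 - t) X + t^2 S, which drops below V for small t if X <
    V. *)
Lemma minimizer_variation V om s : minimizer V om -> carried_by K s ->
  \int[s]_z pot b s z < +oo -> V%:E <= \int[s]_z pot b om z.
Proof.
move=> mV; have V0 := minimizer_ge0 mV; move: mV => [Kom E omin] Ks Soo.
rewrite leNgt; apply/negP => XV.
have X0 : 0 <= \int[s]_z pot b om z by apply: integral_ge0 => z _; exact: pot_ge0.
have S0 : 0 <= \int[s]_z pot b s z by apply: integral_ge0 => z _; exact: pot_ge0.
have Xf : \int[s]_z pot b om z \is a fin_num by rewrite ge0_fin_numE// (lt_trans XV)// ltry.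
have Sf : \int[s]_z pot b s z \is a fin_num by rewrite ge0_fin_numE.
move: X0 S0 XV Xf Sf; set XX := \int[s]_z pot b om z; set SS := \int[s]_z pot b s z.
have XXE : XX = \int[om]_z pot b s z by exact: pot_sym.
move=> + + + /fineK/esym EX /fineK/esym ES.
set X := fine XX in EX; set S := fine SS in ES.
rewrite EX ES !lee_fin lte_fin => X0 S0 XV.
(* Small enough for the linear gain 2 t (V - X) to beat the quadratic terms; the 1 keeps the
   denominator positive and t below 1. *)
pose t := ((V - X) / (V + S + 1))%R.
have D0 : (0 < V + S + 1)%R by lra.
have t0 : (0 < t)%R by rewrite divr_gt0// subr_gt0.
have t1 : (t < 1)%R by rewrite ltr_pdivrMr//; lra.
have [|u [uK uE]] := mixture_probability om s (t := t); first by rewrite !ltW.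
have Ku : carried_by K u by apply: uK => //; exact: measurableC.
have := omin u Ku.
have mp := measurable_pot b; have p0 := pot_ge0 b.
rewrite (eq_integral _ _ (fun z _ => mixture_pot uE z)).
have c1 : 0 <= (1 - t)%:E :> \bar R by rewrite lee_fin subr_ge0 ltW.
have c2 : 0 <= t%:E :> \bar R by rewrite lee_fin ltW.
rewrite ge0_integralD//; last 4 first.
- by move=> z _; rewrite mule_ge0.
- by apply: measurable_funeM; exact: mp.
- by move=> z _; rewrite mule_ge0.
- by apply: measurable_funeM; exact: mp.
have Zl m nu k : 0 <= k -> \int[m]_x (k * pot b nu x) = k * \int[m]_x pot b nu x.
  by move=> k0; apply: ge0_integralZl => //; exact: mp.
rewrite !Zl// !uE//; try exact: mp.
rewrite E -/XX -/SS -XXE EX ES => h'.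
have h : (V <= (1 - t) * ((1 - t) * V + t * X) + t * ((1 - t) * X + t * S))%R.
  by rewrite -lee_fin.
have td : (t * (V + S + 1) = V - X)%R by rewrite divfK// gt_eqF.
have h2 : (0 <= t * (- (V + V) + t * V + (X + X) - (t * (X + X)) + t * S))%R by move: h; lra.
move: h2; rewrite pmulr_rge0// => h3.
have tX : (0 <= t * X)%R by rewrite mulr_ge0// ltW.
lra.
Qed.

(** If [m] charged the part of K where the potential is at most V - 1/(n+1), its normalized
    restriction [s] to that part would have finite energy, as [pot b s] is at most a multiple of
    [pot b m], and would violate the variational inequality. *)
Lemma minimizer_le_negligible V om m : minimizer V om -> \int[m]_z pot b m z < +oo ->
  m (K `&` [set z | pot b om z < V%:E]) = 0.
Proof.
move=> mV moo; have mp := measurable_pot b.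
pose A n := K `&` [set z | pot b om z <= (V - n.+1%:R^-1)%:E].
have mA n : measurable (A n).
  by apply: measurableI => //; apply: closed_measurableC; exact: closed_pot_le.
have A0 n : m (A n) = 0.
  apply/eqP; rewrite eq_le measure_ge0 andbT leNgt; apply/negP => An0.
  have [s [sA sE]] := restricted_probability (mA n) An0.
  have mn : m (A n) \is a fin_num by exact: fin_num_measure.
  set c := ((fine (m (A n)))^-1)%R in sE.
  have mA0 : (0 < fine (m (A n)))%R by rewrite fine_gt0// An0 ltey_eq mn.
  have c0 : (0 <= c)%R by rewrite invr_ge0 ltW.
  have Ks : carried_by K s.
    apply: sA; first exact: measurableC.
    by rewrite /A setIAC setICr set0I.
  have ps z : pot b s z <= c%:E * pot b m z.
    rewrite /pot sE; [|exact: measurable_kapr|by move=> w; exact: kap_ge0].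
    apply: lee_wpmul2l => //; apply: ge0_subset_integral => //.
      exact: measurable_kapr.
    by move=> w _; exact: kap_ge0.
  have soo : \int[s]_z pot b s z < +oo.
    rewrite sE//; last by move=> z; exact: pot_ge0.
    apply: (@le_lt_trans _ _ (c%:E * (c%:E * \int[m]_z pot b m z))).
      apply: lee_wpmul2l => //.
      rewrite -ge0_integralZl//; last by move=> z _; exact: pot_ge0.
      apply: (@le_trans _ _ (\int[m]_(x in A n) (c%:E * pot b m x))).
        apply: ge0_le_integral => //.
        - by move=> z _; exact: pot_ge0.
        - by apply: measurable_funTS.
        - by apply: measurable_funTS; exact: measurable_funeM.
      apply: ge0_subset_integral => //; first exact: measurable_funeM.
      by move=> w _; rewrite mule_ge0// pot_ge0.
    by rewrite muleA lte_mul_pinfty// mule_ge0.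
  have := minimizer_variation mV Ks soo; rewrite sE//; last by move=> z; exact: pot_ge0.
  apply/negP; rewrite -ltNge.
  apply: (@le_lt_trans _ _ (V - n.+1%:R^-1)%:E); last by rewrite lte_fin ltrBlDr ltrDl invr_gt0.
  rewrite -[leRHS]mul1e; have -> : 1 = c%:E * m (A n).
    by rewrite -(fineK mn) -EFinM /c mulVf// gt_eqF.
  rewrite -muleA; apply: lee_wpmul2l => //.
  rewrite muleC -(integral_cst m (mA n)).
  apply: ge0_le_integral => //.
  - by move=> z _; exact: pot_ge0.
  - exact: measurable_funTS.
  - by move=> z [].
have sub : K `&` [set z | pot b om z < V%:E] `<=` \bigcup_n A n.
  move=> z [Kz /= zV]; have pf : pot b om z \is a fin_num.
    by rewrite ge0_fin_numE ?pot_ge0// (lt_trans zV)// ltry.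
  move: zV; rewrite -(fineK pf) lte_fin => zV.
  have e0 : (0 < V - fine (pot b om z))%R by rewrite subr_gt0.
  have [n _ nP] := nbhs_infty_gerS (V - fine (pot b om z))^-1%R.
  exists n => //; split=> //=; rewrite -(fineK pf) lee_fin lerBrDr addrC -lerBrDr.
  have := nP n (leqnn n); rewrite /= => h.
  by rewrite invf_ple ?posrE// invr_gt0.
have mlt : measurable (K `&` [set z | pot b om z < V%:E]).
  apply: measurableI => //.
  have -> : [set z | pot b om z < V%:E] = pot b om @^-1` [set x | x < V%:E] by [].
  rewrite -[X in measurable X]setTI; apply: emeasurable_fun_infty_o => //.
apply/eqP; rewrite eq_le measure_ge0 andbT.
apply: (le_trans (measure_sigma_subadditive m mA mlt sub)).
by rewrite eseries0// => n _ _; exact: A0.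
Qed.

Let measurable_pot_lt om (V : R) : measurable [set z | pot b om z < V%:E].
Proof.
rewrite -[X in measurable X]setTI; apply: emeasurable_fun_infty_o => //.
exact: measurable_pot.
Qed.

(** For [om] itself the potential is almost everywhere at least V, and its mean is V, hence it is V
    almost everywhere. Only the upper bound is kept, because it defines a closed set. *)
Lemma minimizer_concentrated V om : minimizer V om ->
  om (~` (K `&` [set z | pot b om z <= V%:E])) = 0.
Proof.
move=> mV; have V0 := minimizer_ge0 mV; have mp := measurable_pot b om.
have Ef : \int[om]_z pot b om z < +oo by case: mV => _ -> _; rewrite ltry.
have lt0 := minimizer_le_negligible mV Ef; have [Kom E _] := mV.
pose B n := [set z | (V + n.+1%:R^-1)%:E <= pot b om z].
have mB n : measurable (B n).
  by rewrite -[X in measurable X]setTI; exact: emeasurable_fun_c_infty.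
have mKlt : measurable (K `&` [set z | pot b om z < V%:E]) by apply: measurableI.
have mKC : measurable (~` K) by exact: measurableC.
pose D := K `&` [set z | V%:E <= pot b om z].
have DC : ~` D = ~` K `|` (K `&` [set z | pot b om z < V%:E]).
  apply/seteqP; split=> z /=; rewrite /D /= not_andP.
    have [Kz|nKz] := pselect (K z); last by left.
    by move=> [//|/negP]; rewrite -ltNge; right.
  by move=> [nK|[Kz zV]]; [left|right; apply/negP; rewrite -ltNge].
have mD : measurable D by rewrite -(setCK D) DC; apply: measurableC; exact: measurableU.
have DC0 : om (~` D) = 0.
  rewrite DC; apply/eqP; rewrite eq_le measure_ge0 andbT.
  apply: (le_trans (measureU2 _ mKC mKlt)).
  by rewrite [X in X + _](Kom : om _ = 0) add0e [X in X <= _]lt0.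
have B0 n : om (B n) = 0.
  have e0 : (0 < n.+1%:R^-1 :> R)%R by rewrite invr_gt0.
  set e : R := (n.+1%:R^-1)%R in e0 *.
  have mf : measurable_fun setT (fun z => V%:E + (e * \1_(B n) z)%:E).
    apply: emeasurable_funD => //; apply/measurable_EFinP; apply: measurable_funM => //.
  have h : \int[om]_z (V%:E + (e * \1_(B n) z)%:E) <= V%:E.
    rewrite (integral_carried mD mf DC0).
    rewrite -[leRHS](etrans (esym (integral_carried mD mp DC0)) E).
    apply: ge0_le_integral => //.
    - by move=> z _; rewrite adde_ge0// lee_fin mulr_ge0// ltW.
    - exact: measurable_funTS.
    - exact: measurable_funTS.
    move=> z [_ /= Vz]; rewrite indicE; case: (boolP (z \in B n)) => [|_].
      by rewrite inE /B /= mulr1 -EFinD.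
    by rewrite mulr0 adde0.
  have m1 : om setT = 1 := probability_setT om.
  move: h; rewrite ge0_integralD//; last 2 first.
  - by move=> z _; rewrite lee_fin mulr_ge0// ltW.
  - apply/measurable_EFinP; apply: measurable_funM => //; exact: measurable_indic.
  rewrite (@integral_cst _ _ _ om _ measurableT V%:E) [X in _ * X]m1 mule1.
  under eq_integral do rewrite EFinM.
  rewrite ge0_integralZl//; last 2 first.
  - by apply/measurable_EFinP; exact: measurable_indic.
  - by rewrite lee_fin ltW.
  rewrite integral_indic// setIT -[leRHS]adde0 leeD2lE// => h.
  apply/eqP; rewrite eq_le measure_ge0 andbT.
  by move: h; rewrite pmule_rle0// lte_fin.
have sub : ~` (K `&` [set z | pot b om z <= V%:E]) `<=` ~` K `|` \bigcup_n B n.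
  move=> z /=; rewrite not_andP => -[nKz|/negP]; first by left.
  rewrite -ltNge => Vz; right.
  case Ep : (pot b om z) => [p| |]; last 2 first.
  - by exists 0%N => //; rewrite /B /= Ep leey.
  - by move: Vz; rewrite Ep.
  move: Vz; rewrite Ep lte_fin => Vp.
  have [n _ nP] := nbhs_infty_gerS (p - V)^-1%R.
  exists n => //; rewrite /B /= Ep lee_fin -lerBrDl.
  have := nP n (leqnn n); rewrite /= => h.
  by rewrite invf_ple ?posrE// ?invr_gt0 subr_gt0.
have mS : measurable (~` (K `&` [set z | pot b om z <= V%:E])).
  by apply: measurableC; apply: measurableI => //; apply: closed_measurableC; exact: closed_pot_le.
have mBU : measurable (\bigcup_n B n) by exact: bigcup_measurable.
apply/eqP; rewrite eq_le measure_ge0 andbT.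
apply: (le_trans (le_measure om _ _ sub)); rewrite ?inE//; first exact: measurableU.
apply: (le_trans (measureU2 _ mKC mBU)).
rewrite [X in X + _](Kom : om _ = 0) add0e.
apply: (le_trans (measure_sigma_subadditive om mB mBU (@subset_refl _ _))).
by rewrite eseries0// => n _ _; exact: B0.
Qed.

(** K has diameter at most 2r. This is the bound on V that the domination principle asks for far
    away from K. *)
Lemma minimizer_lower_bound V om : minimizer V om -> (ln b - ln (2 * r) <= V)%R.
Proof.
move=> [Kom E _]; rewrite -lee_fin -E; have m1 : om setT = 1 := probability_setT om.
set c : R := (ln b - ln (2 * r))%R.
have r2 : (0 < 2 * r)%R by rewrite mulr_gt0.
have b0 : (0 < b)%R by apply: lt_le_trans rb; rewrite mulr_gt0.
have r2b : (2 * r <= b)%R by apply: le_trans rb; rewrite ler_pM2r// ler_nat.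
have c0 : (0 <= c)%R by rewrite subr_ge0 ler_ln.
have cE : c%:E = \int[om]_z (cst c%:E z) by rewrite integral_cst// [X in _ * X]m1 mule1.
have pc z : K z -> c%:E <= pot b om z.
  move=> Kz; rewrite cE (integral_carried mK _ Kom)// (pot_carried _ _ mK Kom).
  apply: ge0_le_integral => //.
  - by apply: measurable_funTS; exact: measurable_kapr.
  move=> w Kw; rewrite /kap; case: eqVneq => [_|zw]; first by rewrite leey.
  rewrite lee_fin le_max; apply/orP; right; rewrite lerD2l lerN2 ler_ln ?posrE ?cmod_gt0//.
  by have := Kr Kz; have := Kr Kw; have := ler_cmodB z w; rewrite /cdisk /=; lra.
rewrite cE (integral_carried mK _ Kom)// [leRHS](integral_carried mK _ Kom); last exact: measurable_pot.
apply: ge0_le_integral => //.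
by apply: measurable_funTS; exact: measurable_pot.
Qed.

(** The domination principle, with [S] the part of K where the potential is at most V: it carries
    [om], and it is compact by semicontinuity. *)
Theorem frostman V om : minimizer V om -> forall z, pot b om z <= V%:E.
Proof.
move=> mV; apply: (domination_principle r0 rb _ _ (minimizer_concentrated mV)).
- apply: (subclosed_compact _ cK); last by move=> z [].
  apply: closedI; [exact: compact_closedC|exact: closed_pot_le].
- by move=> z [/Kr].
- exact: minimizer_lower_bound mV.
- by move=> z [].
Qed.

Lemma minimizer_pot_eq V om m : minimizer V om -> \int[m]_z pot b m z < +oo ->
  m (K `&` [set z | pot b om z != V%:E]) = 0.
Proof.
move=> mV moo; rewrite -(minimizer_le_negligible mV moo); congr (m (_ `&` _)).
apply/seteqP; split=> z /=; last by move=> zV; rewrite lt_eqF.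
by move=> zV; rewrite lt_neqAle zV frostman.
Qed.

End equilibrium.

(** * Uniform measures on finite lists and on circles *)

Section uniform_on.
Context d (T : measurableType d) (R : realType).

(** Repetitions in the list count. The shape is that of [root_distribution], so that the two agree
    once the number of roots is the degree. *)
Definition uniform_on (x0 : T) (s : seq T) : {measure set T -> \bar R} :=
  mscale ((size s)%:R^-1)%:nng (msum (fun j => \d_(nth x0 s j)) (size s)).

Local Open Scope ereal_scope.

Lemma uniform_onE x0 s A : uniform_on x0 s A =
  ((size s)%:R^-1)%R%:E * \sum_(j < size s) \d_(nth x0 s j) A.
Proof. by []. Qed.

Lemma uniform_on_setT x0 s : (0 < size s)%N -> uniform_on x0 s setT = 1.
Proof.
move=> s0; rewrite uniform_onE (eq_bigr (fun=> 1)).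
  rewrite sumEFin -EFinM sumr_const card_ord -[(_ *+ _)%R]mulr_natl mulr1.
  by rewrite mulVf// pnatr_eq0 -lt0n.
by move=> j _; exact: diracT.
Qed.

Lemma uniform_on_null x0 s (A : set T) : measurable A -> (forall x, x \in s -> ~ A x) ->
  uniform_on x0 s A = 0.
Proof.
move=> mA sA; rewrite uniform_onE big1 ?mule0// => j _.
by rewrite diracE memNset//; apply: sA; exact: mem_nth.
Qed.

Lemma ge0_integral_uniform_on x0 s (f : T -> \bar R) : measurable_fun setT f ->
  (forall x, 0 <= f x) ->
  \int[uniform_on x0 s]_x f x = ((size s)%:R^-1)%R%:E * \sum_(x <- s) f x.
Proof.
move=> mf f0; rewrite ge0_integral_mscale// ge0_integral_measure_sum//.
congr (_ * _); rewrite (big_nth x0) big_mkord; apply: eq_bigr => j _.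
by rewrite integral_dirac// diracT mul1e.
Qed.

Lemma integral_uniform_on x0 s (f : T -> R) : measurable_fun setT f ->
  \int[uniform_on x0 s]_x (f x)%:E = ((size s)%:R^-1 * \sum_(x <- s) f x)%R%:E.
Proof.
move=> mf; have mf' : measurable_fun setT (EFin \o f) by exact/measurable_EFinP.
rewrite integralE !ge0_integral_uniform_on//; last 2 first.
- exact: measurable_funeneg.
- exact: measurable_funepos.
rewrite (eq_bigr (fun x => (Num.max (f x) 0)%R%:E)); last by move=> x _; rewrite funeposE EFin_max.
rewrite [X in _ - _ * X](eq_bigr (fun x => (Num.max (- f x) 0)%R%:E)); last by move=> x _; rewrite funenegE EFin_max.
rewrite !sumEFin -!EFinM -EFinB -mulrBr -sumrB; congr (_ * _)%R%:E.
apply: eq_bigr => x _; rewrite !maxEle.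
by case: (leP (f x) 0%R) => ?; case: (leP (- f x)%R 0%R) => ?; lra.
Qed.

End uniform_on.

Section null_integral.
Context d (T : measurableType d) (R : realType) (m : {measure set T -> \bar R}).

Lemma integral_eq0_null (f : T -> R) : measurable_fun setT f -> (forall x, 0 <= f x) ->
  (\int[m]_x (f x)%:E = 0)%E -> m [set x | f x != 0] = 0%E.
Proof.
move=> mf f0 If.
have mf' : measurable_fun setT (EFin \o f) by exact/measurable_EFinP.
have [h _] := ae_eq_integral_abs m measurableT mf'.
have : ae_eq m setT (EFin \o f) (cst 0%E).
  by apply: h; rewrite -[RHS]If; apply: eq_integral => x _; rewrite gee0_abs// lee_fin.
have mA : measurable [set x | f x != 0].
  have -> : [set x | f x != 0] = f @^-1` (~` [set 0]).
    by apply/seteqP; split => x /= /eqP.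
  by rewrite -[X in measurable X]setTI; apply: mf => //; apply: measurableC.
move=> ae0; apply/negligibleP => //.
apply: negligibleS ae0 => x /= fx0 h0; have := h0 I => -[fx].
by move: fx0; rewrite fx eqxx.
Qed.

End null_integral.

Section circle.
Context (R : realType).
Implicit Types (x z w a : R[i]) (b rho : R).

Lemma kap_cvg b (x : nat -> R[i]) (l : R[i]) : 0 < b -> cmod (x n - l) @[n --> \oo] --> 0 ->
  kap b (x n) @[n --> \oo] --> kap b l.
Proof.
move=> b0 xl; have [l0|l0] := eqVneq l 0.
  rewrite l0 {2}/kap eqxx; apply/cvgeyPge => A.
  have e0 : 0 < b * expR (- A) by rewrite mulr_gt0// expR_gt0.
  have := xl => /cvgrPdist_lt/(_ _ e0); apply: filterS => n.
  rewrite l0 subr0 sub0r normrN ger0_norm ?cmod_ge0// => xA.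
  rewrite /kap; case: eqVneq => [_|xn0]; first by rewrite leey.
  rewrite lee_fin le_max; apply/orP; right; rewrite lerBrDr addrC -lerBrDr.
  have -> : ln b - A = ln (b * expR (- A)) by rewrite lnM ?posrE ?expR_gt0// expRK.
  by rewrite ler_ln ?posrE ?cmod_gt0// ltW.
have c0 : 0 < cmod l by rewrite cmod_gt0.
have d0 : 0 < cmod l / 2 by rewrite divr_gt0.
have far : \forall n \near \oo, cmod l / 2 <= cmod (x n).
  have := xl => /cvgrPdist_lt/(_ _ d0); apply: filterS => n.
  rewrite sub0r normrN ger0_norm ?cmod_ge0// => h.
  have := ler_dist_cmod (x n) l; rewrite ler_norml => /andP[]; lra.
rewrite -(@ktr_kap _ b (cmod l / 2))//; last lra.
apply: (@cvg_trans _ ((fun n => (ktr b (cmod l / 2) (x n))%:E) @ \oo)).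
  by apply: near_eq_cvg; apply: filterS far => n h; rewrite ktr_kap.
apply: cvg_EFin; first exact: nearW.
apply/cvgrPdist_le => e e0.
have e1 : 0 < e * (cmod l / 2) by rewrite mulr_gt0.
have := xl => /cvgrPdist_lt/(_ _ e1); apply: filterS => n.
rewrite sub0r normrN ger0_norm ?cmod_ge0// => h.
by rewrite distrC (le_trans (ktr_lipschitz _ _ _ d0))// ler_pdivrMr// ltW.
Qed.

(** With M the larger and m the smaller of |X| and rho, and q = m / M < 1, the modulus of X^n -
    rho^n lies between (1 - q) M^n and 2 M^n. *)
Lemma cvg_ln_unity_orbit (x rho : R) : 0 <= x -> 0 < rho -> x != rho ->
  forall X : R[i], cmod X = x ->
  (n.+1%:R^-1 * ln (cmod (X ^+ n.+1 - rho%:C ^+ n.+1))) @[n --> \oo] --> ln (Num.max x rho).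
Proof.
move=> x0 rho0 xr X Xx; set M := Num.max x rho; set mm := Num.min x rho.
have M0 : 0 < M by rewrite lt_max rho0 orbT.
have mM : mm < M by rewrite /mm /M gt_min !lt_max !ltxx orbF /=; move: xr; rewrite neq_lt.
have mm0 : 0 <= mm by rewrite le_min x0 ltW.
pose q := mm / M.
have q0 : 0 <= q by rewrite divr_ge0// ltW.
have q1 : q < 1 by rewrite ltr_pdivrMr// mul1r.
have ub n : cmod (X ^+ n.+1 - rho%:C ^+ n.+1) <= 2 * M ^+ n.+1.
  rewrite (le_trans (ler_cmodB _ _))// !cmodX Xx cmodR (ger0_norm (ltW rho0)) mulr_natl mulr2n.
  by apply: lerD; apply: lerXn2r; rewrite ?nnegrE ?(ltW rho0) ?(ltW M0)// /M le_max lexx ?orbT.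
have lb n : (1 - q) * M ^+ n.+1 <= cmod (X ^+ n.+1 - rho%:C ^+ n.+1).
  have h : (1 - q) * M ^+ n.+1 <= M ^+ n.+1 - mm ^+ n.+1.
    rewrite mulrBl mul1r lerD2l lerN2 /q exprS [M ^+ n.+1]exprS mulrA divfK ?gt_eqF//.
    by rewrite ler_wpM2l// lerXn2r ?nnegrE ?(ltW M0)// ltW.
  apply: (le_trans h); have := ler_dist_cmod (X ^+ n.+1) (rho%:C ^+ n.+1).
  rewrite !cmodX Xx cmodR (ger0_norm (ltW rho0)); apply: le_trans.
  rewrite /M /mm minEle maxEle; case: (leP x rho) => _; last exact: ler_norm.
  by rewrite distrC ler_norm.
pose C := ln 2 - ln (1 - q).
have l2 : 0 < ln (2 : R) by rewrite ln_gt0// ltr1n.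
have lq : ln (1 - q) <= 0 by rewrite ln_le0//; lra.
have est n : `|n.+1%:R^-1 * ln (cmod (X ^+ n.+1 - rho%:C ^+ n.+1)) - ln M| <= C * n.+1%:R^-1.
  have n0 : 0 < n.+1%:R^-1 :> R by rewrite invr_gt0.
  have p0 : 0 < cmod (X ^+ n.+1 - rho%:C ^+ n.+1).
    by apply: lt_le_trans (lb n); rewrite mulr_gt0 ?exprn_gt0//; lra.
  have -> : ln M = n.+1%:R^-1 * (n.+1%:R * ln M) by rewrite mulrA mulVf ?mul1r.
  rewrite -mulrBr normrM (ger0_norm (ltW n0)) mulrC ler_wpM2r ?(ltW n0)//.
  have h1 : ln (cmod (X ^+ n.+1 - rho%:C ^+ n.+1)) <= ln 2 + n.+1%:R * ln M.
    rewrite mulr_natl -lnXn// -lnM ?posrE ?exprn_gt0// ler_ln ?posrE ?mulr_gt0 ?exprn_gt0//.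
  have h2 : ln (1 - q) + n.+1%:R * ln M <= ln (cmod (X ^+ n.+1 - rho%:C ^+ n.+1)).
    rewrite mulr_natl -lnXn// -lnM ?posrE ?exprn_gt0//; last lra.
    by rewrite ler_ln ?posrE ?mulr_gt0 ?exprn_gt0//; lra.
  rewrite ler_norml /C; lra.
apply/cvgrPdist_le => e e0.
have := @nbhs_infty_gerS R (C / e); apply: filterS => n h.
rewrite distrC (le_trans (est n))// ler_pdivrMr//.
by rewrite mulrC -ler_pdivrMr.
Qed.

Lemma measurable_circle a rho : measurable [set z : R[i] | cmod (z - a) = rho].
Proof.
rewrite -(setCK (mkset _)); apply: measurableC; apply: open_measurableC.
have -> : ~` [set z : R[i] | cmod (z - a) = rho] = (fun z => cmod (z - a)) @^-1` (~` [set rho]) by [].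
apply: open_comp => [x _|]; first exact: continuous_cmodB.
by apply: closed_openC; exact: closed_eq.
Qed.

(** A limit along an ultrafilter of uniform measures on the points a + v with v^n = rho^n. Off the
    circle the potential is a limit of normalized logarithms; on the circle its value is reached by
    moving out along a radius. *)
Lemma circle_probability a rho : 0 < rho -> exists m : probability R[i] R,
  m (~` [set z | cmod (z - a) = rho]) = 0%E /\
  forall b w, cmod (w - a) + rho <= b ->
    pot b m w = (ln b - ln (Num.max (cmod (w - a)) rho))%:E.
Proof.
move=> rho0.
have [F [FU FN]] := @ultraFilterLemma _ (nbhs (\oo : set_system nat)) _.
have /choice[rs rsP] : forall n, exists rs : seq R[i],
  [/\ size rs = n.+1, rho%:C \in rs, forall v, v \in rs -> cmod v = cmod rho%:C &
      forall x, \prod_(v <- rs) (x - v) = x ^+ n.+1 - rho%:C ^+ n.+1].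
  by move=> n; exact: unity_orbit.
have rsrho n v : v \in rs n -> cmod v = rho.
  by have [_ _ h _] := rsP n => /h ->; rewrite cmodR ger0_norm ?ltW.
pose s n : seq R[i] := [seq a + v | v <- rs n].
have ss n : size (s n) = n.+1 by rewrite size_map; have [] := rsP n.
have mD := @measurable_cdisk R (cmod a + rho).
have sv n z : z \in s n -> cmod (z - a) = rho.
  by move=> /mapP[v /rsrho vr ->]; rewrite addrAC subrr add0r.
have sD n z : z \in s n -> cdisk (cmod a + rho) z.
  by move=> /sv zr; rewrite /cdisk /=; have := ler_cmodD (z - a) a; rewrite subrK; lra.
have [||m [mD0 mcvg]] := @helly_selection R F FU (fun n => uniform_on R a (s n)) (cmod a + rho).
- by apply: nearW => n; apply: uniform_on_setT; rewrite ss.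
- apply: nearW => n; apply: uniform_on_null; first exact: measurableC.
  by move=> z /sD zD; rewrite /setC /=.
have mcvg' (f : R[i] -> R) : continuous f ->
    (n.+1%:R^-1 * \sum_(z <- s n) f z)%:E @[n --> F] --> (\int[m]_z (f z)%:E)%E.
  move=> cf; have := mcvg f cf; apply: cvg_trans; apply: near_eq_cvg; apply: nearW => n.
  by rewrite integral_uniform_on ?ss//; exact: continuous_measurableC.
have mC0 : m (~` [set z | cmod (z - a) = rho]) = 0%E.
  have cf : continuous (fun z : R[i] => `|cmod (z - a) - rho|).
    apply: (@lipschitz_continuous_cmod _ _ 1) => x y; rewrite mul1r.
    rewrite (le_trans (ler_dist_dist _ _))//.
    have -> : cmod (x - a) - rho - (cmod (y - a) - rho) = cmod (x - a) - cmod (y - a) by ring.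
    by rewrite (le_trans (ler_dist_cmod _ _))// opprB addrA subrK.
  have If : (\int[m]_z (`|cmod (z - a) - rho|)%:E = 0)%E.
    rewrite -(cvg_lim _ (mcvg' _ cf))//.
    apply/cvg_lim => //; apply: cvg_near_cst; apply: nearW => n.
    rewrite big_seq big1 ?mulr0// => z /sv ->.
    by rewrite subrr normr0.
  rewrite -(integral_eq0_null (continuous_measurableC cf) _ If)//.
  congr (m _); apply/seteqP; split => z /=.
    by move=> h; rewrite normr_eq0 subr_eq0; apply/eqP.
  by rewrite normr_eq0 subr_eq0 => /eqP.
exists m; split=> // b w wb.
have b0 : 0 < b by have := cmod_ge0 (w - a); lra.
have mS := measurable_circle a rho.
have off v : cmod (v - a) + rho <= b -> cmod (v - a) != rho ->
    pot b m v = (ln b - ln (Num.max (cmod (v - a)) rho))%:E.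
  move=> vb vr; set d := `|cmod (v - a) - rho|.
  have d0 : 0 < d by rewrite normr_gt0 subr_eq0.
  have dS z : cmod (z - a) = rho -> d <= cmod (v - z).
    move=> zr; rewrite /d -zr (le_trans (ler_dist_cmod _ _))//.
    by rewrite opprB addrA subrK.
  rewrite (pot_off _ mS mC0 d0 dS).
  have cf : continuous (fun z => ktr b d (v - z)).
    apply: (@lipschitz_continuous_cmod _ _ d^-1) => x y.
    rewrite mulrC (le_trans (ktr_lipschitz _ _ _ d0))//.
    by rewrite opprB addrC addrA subrK cmodBC.
  rewrite -(cvg_lim _ (mcvg' _ cf))//; apply/cvg_lim => //.
  apply: cvg_EFin; first exact: nearW.
  have h := cvg_ln_unity_orbit (cmod_ge0 (v - a)) rho0 vr (erefl (cmod (v - a))).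
  have h' : (fun n => n.+1%:R^-1 * ln (cmod ((v - a) ^+ n.+1 - rho%:C ^+ n.+1))) @ F -->
     ln (Num.max (cmod (v - a)) rho) by apply: cvg_trans h; exact: cvg_app.
  have h2 : (fun n => ln b - n.+1%:R^-1 * ln (cmod ((v - a) ^+ n.+1 - rho%:C ^+ n.+1))) @ F -->
     ln b - ln (Num.max (cmod (v - a)) rho) by apply: cvgB => //; exact: cvg_cst.
  apply: cvg_trans h2; apply: near_eq_cvg; apply: nearW => n.
  have [_ _ _ prodE] := rsP n; rewrite -prodE.
  have nz y : y \in rs n -> v - a - y != 0.
    move=> yrs; rewrite -cmod_gt0 (lt_le_trans d0)// -addrA -opprD dS//.
    by rewrite addrAC subrr add0r (rsrho n).
  rewrite /= /s -sum_ln_cmod// big_map.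
  have -> : ln b = n.+1%:R^-1 * \sum_(y <- rs n) ln b.
    rewrite big_const_seq count_predT iter_addr_0; have [-> _ _ _] := rsP n.
    by rewrite -[X in _ * X]mulr_natl mulrA mulVf ?mul1r.
  rewrite -mulrBr -sumrB; congr (_ * _); rewrite !big_seq; apply: eq_bigr => y yrs.
  have yr : cmod y = rho by rewrite (rsrho n).
  have dy : d <= cmod (v - (a + y)) by apply: dS; rewrite addrAC subrr add0r.
  rewrite -addrA -opprD /ktr (max_l dy) max_r// subr_ge0 ler_ln ?posrE//.
    rewrite opprD addrA; have := ler_cmodB (v - a) y; lra.
  exact: lt_le_trans d0 dy.
have [wr|] := eqVneq (cmod (w - a)) rho; last exact: off.
(* Points inside the circle that tend to [w] along the radius; the potential is ln b - ln rho at
   each of them. *)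
pose wt n : R[i] := a + (1 - n.+2%:R^-1)%:C * (w - a).
have t01 n : 0 <= (1 - n.+2%:R^-1 : R) < 1.
  have h0 : 0 < n.+2%:R^-1 :> R by rewrite invr_gt0.
  have h1 : n.+2%:R^-1 <= 1 :> R by rewrite invf_le1// ler1n.
  by rewrite subr_ge0 h1 /= ltrBlDr ltrDl.
have wta n : cmod (wt n - a) = (1 - n.+2%:R^-1) * rho.
  rewrite /wt addrAC subrr add0r cmodM cmodR wr ger0_norm//.
  by have /andP[] := t01 n.
have wtw n : cmod (wt n - w) = n.+2%:R^-1 * rho.
  have -> : wt n - w = - ((n.+2%:R^-1)%:C * (w - a)).
    by rewrite /wt rmorphB/= rmorph1; ring.
  by rewrite cmodN cmodM cmodR wr ger0_norm// invr_ge0.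
have potwt n : pot b m (wt n) = (ln b - ln rho)%:E.
  have /andP[t0 t1] := t01 n.
  have lt : cmod (wt n - a) < rho by rewrite wta gtr_pMl.
  by rewrite off ?lt_eqF ?(max_r (ltW lt))//; rewrite wr in wb; lra.
rewrite wr maxxx.
have wtcvg : cmod (wt n - w) @[n --> \oo] --> 0.
  apply/cvgrPdist_lt => e e0; have := @nbhs_infty_gtr R (rho / e); apply: filterS => n h.
  rewrite sub0r normrN ger0_norm ?cmod_ge0// wtw mulrC ltr_pdivrMr//.
  rewrite mulrC -ltr_pdivrMr// (lt_le_trans h)// ler_nat; exact: leqW.
(* Semicontinuity gives one inequality, and with it the integrability of the kernel at [w] on which
   dominated convergence relies for equality. *)
have potle : (pot b m w <= (ln b - ln rho)%:E)%E.
  apply: pot_lsc => e e0; have := wtcvg => /cvgrPdist_lt/(_ _ e0)[n _ nP].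
  exists (wt n); last by rewrite potwt.
  by have := nP n (leqnn n); rewrite sub0r normrN ger0_norm ?cmod_ge0// cmodBC.
set S := [set z | cmod (z - a) = rho] in mS mC0.
have kint : m.-integrable setT (fun z => kap b (w - z)).
  apply/integrableP; split; first exact: measurable_kapr.
  rewrite (eq_integral (fun z => kap b (w - z))); last by move=> z _; rewrite gee0_abs// kap_ge0.
  by rewrite (le_lt_trans potle)// ltry.
have gint : m.-integrable S (fun z => kap b (w - z)%R + (ln 2)%:E)%E.
  apply: (integrableS measurableT) => //; apply: integrableD => //.
  exact: finite_measure_integrable_cst.
have lim1 : (\int[m]_(z in S) kap b (wt n - z)%R)%E @[n --> \oo] -->
    (\int[m]_(z in S) kap b (w - z)%R)%E.
  have [] // := @dominated_convergence _ _ R m S mS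
    (fun n z => kap b (wt n - z)) (fun z => kap b (w - z)) (fun z => kap b (w - z)%R + (ln 2)%:E)%E.
  - by move=> n; apply: measurable_funTS; exact: measurable_kapr.
  - by apply: measurable_funTS; exact: measurable_kapr.
  - apply: aeW => z zr; apply: kap_cvg => //.
    by under eq_fun do rewrite opprB addrA subrK.
  (* |wt n - w| is exactly the distance from [wt n] to the circle, so |w - z| <= 2 |wt n - z| for z
     on it, and the doubling bound dominates the kernels. *)
  - apply: aeW => z n zr; rewrite gee0_abs ?kap_ge0//; apply: kap_doubling.
    have /andP[t0 t1] := t01 n.
    have h1 := ler_cmod_dist (wt n) w z; rewrite (cmodBC w (wt n)) wtw in h1.
    have := ler_dist_cmod (z - a) (wt n - a); rewrite (zr : cmod (z - a) = rho) wta.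
    have -> : z - a - (wt n - a) = z - wt n by ring.
    rewrite (cmodBC z) => /(le_trans (ler_norm _)).
    move: h1; set i : R := n.+2%:R^-1; lra.
rewrite (pot_carried _ _ mS mC0) -(cvg_lim _ lim1)//; apply/cvg_lim => //.
apply: cvg_near_cst; apply: nearW => n.
by rewrite -(pot_carried _ _ mS mC0).
Qed.

End circle.

(** * Equilibrium measures tested against circle potentials *)

Section equilibrium_test.
Context (R : realType) (K : set R[i]) (r : R).
Hypotheses (cK : compact K) (r0 : 0 < r) (Kr : K `<=` cdisk r).
Implicit Types (a w z : R[i]) (b rho : R) (mu nu om m : probability R[i] R).
Local Open Scope ereal_scope.

Let mK := compact_measurableC cK.

Let diamK z w : K z -> K w -> (cmod (z - w) <= 2 * r)%R.
Proof.
by move=> /Kr + /Kr; rewrite /cdisk /=; have := ler_cmodB z w; lra.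
Qed.

(** Non-polarity provides a measure of finite energy, so the maximal energy is not -oo and V is a
    real number. *)
Lemma equilibrium_minimizer b om : (4 * r <= b)%R -> non_polar K -> equilibrium_measure K om ->
  exists V, minimizer K b V om /\ energy om = (ln b - V)%:E.
Proof.
move=> rb npK [Kom omax].
have b0 : (0 < b)%R by apply: lt_le_trans rb; rewrite mulr_gt0.
have KK z w : K z -> K w -> (cmod (z - w) <= b)%R.
  by move=> Kz Kw; have := diamK Kz Kw; lra.
have enE mu : carried_by K mu -> energy mu = (ln b)%:E - \int[mu]_z pot b mu z.
  by move=> Kmu; exact: (energy_pot b0 mK Kmu KK).
have E0 mu : 0 <= \int[mu]_z pot b mu z by apply: integral_ge0 => z _; exact: pot_ge0.
have [nu [Knu nuoo]] : exists nu : probability R[i] R, carried_by K nu /\ energy nu != -oo.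
  apply: contrapT => h; move: npK; rewrite /non_polar /log_capacity.
  rewrite (_ : ereal_sup _ = -oo) ?ltxx//.
  apply/eqP; rewrite -leeNy_eq; apply: ge_ereal_sup => _ [nu Knu <-].
  by rewrite leeNy_eq; apply/negPn/negP => nuoo; apply: h; exists nu.
have Eom : \int[om]_z pot b om z \is a fin_num.
  rewrite ge0_fin_numE// ltey; apply/eqP => Eoo.
  by have := omax nu Knu; rewrite (enE om Kom) Eoo /= leeNy_eq (negbTE nuoo).
exists (fine (\int[om]_z pot b om z)); split; last first.
  by rewrite enE// -{1}(fineK Eom).
split=> //; first by rewrite fineK.
move=> mu Kmu; have := omax mu Kmu; rewrite !enE// -{1 2}(fineK Eom).
case: (\int[mu]_z pot b mu z) (E0 mu) => [x| |] //= _; last by rewrite leey.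
by rewrite -!EFinB !lee_fin lerD2l lerN2.
Qed.

(* The difference of the potentials of the uniform measures on the circles of radii
   [2 rho] and [rho] about [a]; it vanishes outside the disk of radius [2 rho]. *)
Definition ring_kernel a rho w : R :=
  (ln (Num.max (cmod (w - a)) (2 * rho)) - ln (Num.max (cmod (w - a)) rho))%R.

Lemma ring_kernel_ge0 a rho w : (0 < rho)%R -> (0 <= ring_kernel a rho w)%R.
Proof.
move=> rho0; rewrite subr_ge0 ler_ln ?posrE ?lt_max ?rho0 ?mulr_gt0 ?orbT//.
rewrite ge_max !le_max lexx/=; apply/orP; right.
by rewrite ler_peMl ?ler1n// ltW.
Qed.

Lemma measurable_ring_kernel rho :
  measurable_fun setT (fun p : R[i] * R[i] => ring_kernel p.2 rho p.1).
Proof.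
apply: measurable_funB; apply: measurableT_comp => //; apply: measurable_maxr => //;
  exact: measurable_cmod_sub.
Qed.

Lemma measurable_ring_kernel1 a rho : measurable_fun setT (ring_kernel a rho).
Proof.
apply: (measurableT_comp (f := fun p : R[i] * R[i] => ring_kernel p.2 rho p.1) (g := fun w => (w, a))).
  exact: measurable_ring_kernel.
exact: measurable_pair2.
Qed.

Lemma circle_pot_finite_energy a rho b m : (0 < rho)%R -> (2 * rho <= b)%R ->
  m (~` [set z | (cmod (z - a) = rho)%R]) = 0 ->
  (forall b w, (cmod (w - a) + rho <= b)%R ->
    pot b m w = (ln b - ln (Num.max (cmod (w - a)) rho))%:E) ->
  \int[m]_z pot b m z < +oo.
Proof.
move=> rho0 rb mS mP; have m1 : m setT = 1 := probability_setT m.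
set S := [set z | _] in mS; have mmS : measurable S.
  by have := measurable_circle a rho.
rewrite (integral_carried mmS (measurable_pot b m) mS).
rewrite (eq_integral (cst (ln b - ln rho)%:E)).
  rewrite integral_cst//; have : m S \is a fin_num by exact: fin_num_measure.
  by move=> /fineK muE; rewrite -[X in _ * X]muE -EFinM ltry.
move=> z; rewrite inE /S /= => zr; rewrite mP zr ?maxxx//; lra.
Qed.

(** Stated as a sum, so that no possibly infinite integrals are subtracted. *)
Lemma pot_circle_split a rho b mu m1 m2 : (0 < rho)%R -> carried_by K mu ->
  (forall w, K w -> (cmod (w - a) + 2 * rho <= b)%R) ->
  (forall b w, (cmod (w - a) + rho <= b)%R ->
    pot b m1 w = (ln b - ln (Num.max (cmod (w - a)) rho))%:E) ->
  (forall b w, (cmod (w - a) + 2 * rho <= b)%R ->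
    pot b m2 w = (ln b - ln (Num.max (cmod (w - a)) (2 * rho)))%:E) ->
  \int[mu]_z pot b m1 z = \int[mu]_z pot b m2 z + \int[mu]_z (ring_kernel a rho z)%:E.
Proof.
move=> rho0 Kmu wb h1 h2.
have mr : measurable_fun setT (fun z => (ring_kernel a rho z)%:E : \bar R).
  by apply/measurable_EFinP; exact: measurable_ring_kernel1.
have mp m := measurable_pot b m.
rewrite -ge0_integralD//; last 2 first.
- by move=> z _; exact: pot_ge0.
- by move=> z _; rewrite lee_fin ring_kernel_ge0.
rewrite (integral_carried mK (mp m1) Kmu) [RHS](integral_carried mK _ Kmu); last exact: emeasurable_funD.
apply: eq_integral => w; rewrite inE => Kw; have := wb w Kw => wbw.
rewrite h1 ?h2//; last lra.
by rewrite -EFinD /ring_kernel; congr EFin; ring.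
Qed.

Lemma minimizer_integral b V om m : (4 * r <= b)%R -> minimizer K b V om -> carried_by K m ->
  \int[m]_z pot b m z < +oo -> \int[m]_z pot b om z = V%:E.
Proof.
move=> rb mV Km moo; have m1 : m setT = 1 := probability_setT m.
have mp := measurable_pot b om.
have n0 := minimizer_pot_eq cK r0 Kr rb mV moo.
have mN : measurable (K `&` [set z | pot b om z != V%:E]).
  apply: measurableI => //; rewrite -[X in measurable X]setTI.
  exact: emeasurable_neq.
have mD : measurable (K `\` (K `&` [set z | pot b om z != V%:E])) by exact: measurableD.
have mKC : measurable (~` K) by exact: measurableC.
set D := K `\` _ in mD.
have mD0 : m (~` D) = 0.
  rewrite /D setCD; apply/eqP; rewrite eq_le measure_ge0 andbT.
  apply: (le_trans (measureU2 _ mKC mN)).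
  by rewrite [X in X + _](Km : m _ = 0) add0e [X in X <= _]n0.
rewrite (integral_carried mD mp mD0) (eq_integral (cst V%:E)).
  rewrite integral_cst//.
  have mD1 : m D = 1 := etrans (measure_carried mD mD0) m1.
  by rewrite [X in _ * X]mD1 mule1.
move=> z; rewrite inE /D /= => -[Kz nz]; apply/eqP/negPn/negP => h; exact: nz.
Qed.

Lemma minimizer_interior_null b V om a rho : (4 * r <= b)%R -> minimizer K b V om ->
  (0 < rho)%R -> (forall z, (cmod (z - a) <= rho)%R -> K z) -> om (ball_at a rho) = 0.
Proof.
move=> rb mV rho0 aK.
have b0 : (0 < b)%R by apply: lt_le_trans rb; rewrite mulr_gt0.
have Ka : K a by apply: aK; rewrite subrr cmod0 ltW.
have rr : (rho <= 2 * r)%R.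
  have -> : rho = cmod (a + rho%:C - a)%R by rewrite addrAC subrr add0r cmodR ger0_norm// ltW.
  by apply: diamK => //; apply: aK; rewrite addrAC subrr add0r cmodR ger0_norm// ltW.
(* The circles of radii s and 2s = rho both lie in K, and [ring_kernel a s] is positive exactly on
   [ball_at a rho]. *)
pose s := (rho / 2)%R; have s0 : (0 < s)%R by rewrite divr_gt0.
have sE : (2 * s = rho)%R by rewrite /s; field.
have s20 : (0 < 2 * s)%R by rewrite sE.
have [m1 [m1S m1P]] := circle_probability a s0.
have [m2 [m2S m2P]] := circle_probability a s20.
have carK t m : (t <= rho)%R -> m (~` [set z | (cmod (z - a) = t)%R]) = 0 -> carried_by K m.
  move=> tr mt; apply: (subset_measure0 _ _ _ mt) => //.
  - exact: measurableC.
  - by apply: measurableC; exact: measurable_circle.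
  - by apply: subsetC => z /= zt; apply: aK; rewrite zt.
have Kom : carried_by K om by case: mV.
have I1 : \int[m1]_z pot b om z = V%:E.
  apply: (minimizer_integral rb mV); first by apply: (carK s); [lra|].
  by apply: circle_pot_finite_energy m1P => //; lra.
have I2 : \int[m2]_z pot b om z = V%:E.
  apply: (minimizer_integral rb mV); first by apply: (carK (2 * s)%R); [lra|].
  by apply: circle_pot_finite_energy m2P => //; lra.
have wb w : K w -> (cmod (w - a) + 2 * s <= b)%R.
  by move=> Kw; have := diamK Kw Ka; lra.
have := pot_circle_split s0 Kom wb m1P m2P.
rewrite pot_sym I1 pot_sym I2 => Vs.
have If : \int[om]_z (ring_kernel a s z)%:E = 0.
  have i0 : 0 <= \int[om]_z (ring_kernel a s z)%:E.
    by apply: integral_ge0 => z _; rewrite lee_fin ring_kernel_ge0.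
  move: Vs i0; case: (\int[om]_z _) => [x| |]//=; rewrite -EFinD => -[].
  by move=> h _; congr EFin; lra.
have nul := integral_eq0_null (measurable_ring_kernel1 a s) (fun z => ring_kernel_ge0 a z s0) If.
apply: (subset_measure0 (measurable_ball_at a rho) _ _ nul).
  rewrite -[X in measurable X]setTI; have := measurable_ring_kernel1 a s.
  have -> : [set x | ring_kernel a s x != 0%R] = ring_kernel a s @^-1` (~` [set 0%R]).
    by apply/seteqP; split => x /= /eqP.
  by apply => //; exact: measurableC.
move=> z; rewrite /ball_at /= => zr; rewrite gt_eqF// subr_gt0 ltr_ln ?posrE ?lt_max ?s0 ?s20 ?orbT//.
apply/orP; right; rewrite sE gt_max zr /=; lra.
Qed.

(** By symmetry it suffices to integrate [pot b om] and [pot b nu] against the two circle measures.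
    Off K these potentials agree by assumption; on K both equal V outside a set that is null for the
    circle measures, which have finite energy. *)
Lemma equilibrium_ring_kernel om nu a rho : non_polar K -> equilibrium_measure K om ->
  equilibrium_measure K nu -> (forall z, ~ K z -> potential om z = potential nu z) ->
  (0 < rho)%R ->
  \int[om]_w (ring_kernel a rho w)%:E = \int[nu]_w (ring_kernel a rho w)%:E.
Proof.
move=> npK eom enu potE rho0.
(* Exceeds all distances between K and the two circles, and is at least the 4r of Frostman's
   theorem. *)
pose b := (4 * r + cmod a + 4 * rho)%R.
have ca := cmod_ge0 a; have r0' : (0 < r)%R by exact: r0.
have rb : (4 * r <= b)%R by rewrite /b; lra.
have b0 : (0 < b)%R by apply: lt_le_trans rb; rewrite mulr_gt0.
have [V [mV EV]] := equilibrium_minimizer rb npK eom.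
have [W [mW EW]] := equilibrium_minimizer rb npK enu.
have Kom : carried_by K om by case: mV.
have Knu : carried_by K nu by case: mW.
have VW : V = W.
  have h1 : W%:E <= V%:E by have [_ <- _] := mV; have [_ _] := mW; apply.
  have h2 : V%:E <= W%:E by have [_ <- _] := mW; have [_ _] := mV; apply.
  by apply/eqP; rewrite eq_le -!lee_fin h1 h2.
subst W.
have wb w : K w -> (cmod (w - a) + 2 * rho <= b)%R.
  by move=> /Kr; rewrite /cdisk /= /b => wr; have := ler_cmodB w a; move: ca r0' rho0; lra.
have key t m : (0 < t)%R -> (t <= 2 * rho)%R -> m (~` [set z | (cmod (z - a) = t)%R]) = 0 ->
    (forall b w, (cmod (w - a) + t <= b)%R ->
      pot b m w = (ln b - ln (Num.max (cmod (w - a)) t))%:E) ->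
    \int[om]_z pot b m z = \int[nu]_z pot b m z /\ \int[om]_z pot b m z \is a fin_num.
  move=> t0 tr mS mP.
  have moo : \int[m]_z pot b m z < +oo.
    by apply: circle_pot_finite_energy mP => //; rewrite /b; lra.
  have mmS := measurable_circle a t.
  split; last first.
    rewrite (integral_carried mK (measurable_pot b m) Kom).
    have hb w : K w -> 0 <= pot b m w <= (Num.max 0 (ln b - ln t))%:E.
      move=> /wb wbw; rewrite pot_ge0 /= mP; last lra.
      rewrite lee_fin le_max; apply/orP; right; rewrite lerD2l lerN2.
      by rewrite ler_ln ?posrE ?lt_max ?t0 ?orbT// le_max lexx orbT.
    rewrite ge0_fin_numE; last by apply: integral_ge0 => w /hb/andP[].
    apply: (@le_lt_trans _ _ (\int[om]_(w in K) (cst (Num.max 0 (ln b - ln t))%:E w))).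
      apply: ge0_le_integral => //.
      - by move=> w /hb/andP[].
      - by apply: measurable_funTS; exact: measurable_pot.
      - by move=> w /hb/andP[].
    rewrite integral_cst//; have : om K \is a fin_num by exact: fin_num_measure.
    by move=> /fineK muE; rewrite -[X in _ * X]muE -EFinM ltry.
  rewrite pot_sym [RHS]pot_sym.
  have n1 := minimizer_pot_eq cK r0 Kr rb mV moo.
  have n2 := minimizer_pot_eq cK r0 Kr rb mW moo.
  have mN mu : measurable (K `&` [set z | pot b mu z != V%:E]).
    apply: measurableI => //; rewrite -[X in measurable X]setTI.
    by apply: emeasurable_neq => //; exact: measurable_pot.
  pose N := (~` [set z | (cmod (z - a) = t)%R]) `|`
    ((K `&` [set z | pot b om z != V%:E]) `|` (K `&` [set z | pot b nu z != V%:E])).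
  have mU : measurable ((K `&` [set z | pot b om z != V%:E]) `|` (K `&` [set z | pot b nu z != V%:E])).
    exact: measurableU.
  have mmSC := measurableC mmS.
  have mNN : measurable N by exact: measurableU.
  have N0 : m (~` ~` N) = 0.
    rewrite setCK; apply/eqP; rewrite eq_le measure_ge0 andbT.
    apply: (le_trans (measureU2 _ mmSC mU)); rewrite [X in X + _](mS : m _ = 0) add0e.
    apply: (le_trans (measureU2 _ (mN om) (mN nu))).
    by rewrite [X in X + _]n1 add0e [X in X <= _]n2.
  have mNC := measurableC mNN.
  rewrite (integral_carried mNC (measurable_pot b om) N0).
  rewrite (integral_carried mNC (measurable_pot b nu) N0).
  apply: eq_integral => z; rewrite inE /N /= !not_orP => -[/contrapT zt [h1 h2]].
  have [Kz|nKz] := pselect (K z).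
    have -> : pot b om z = V%:E by apply/eqP/negPn/negP => h; exact: h1.
    by apply/esym/eqP/negPn/negP => h; exact: h2.
  have zb w : K w -> (cmod (z - w) <= b)%R.
    move=> /Kr; rewrite /cdisk /= /b => wr; have := ler_cmodB z w.
    by have := ler_cmodD (z - a)%R a; rewrite subrK zt; move: ca r0' rho0; lra.
  have := potE z nKz; rewrite (potential_pot b0 mK Kom zb) (potential_pot b0 mK Knu zb).
  have := pot_ge0 b om z; have := pot_ge0 b nu z.
  case: (pot b om z) => [x| |]//; case: (pot b nu z) => [y| |]//= _ _.
  by rewrite -!EFinB => -[] /addrI/oppr_inj ->.
have [m1 [m1S m1P]] := circle_probability a rho0.
have rho20 : (0 < 2 * rho)%R by rewrite mulr_gt0.
have [m2 [m2S m2P]] := circle_probability a rho20.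
have [k1 f1] : \int[om]_z pot b m1 z = \int[nu]_z pot b m1 z /\ \int[om]_z pot b m1 z \is a fin_num.
  by apply: (key rho) m1S m1P => //; lra.
have [k2 f2] : \int[om]_z pot b m2 z = \int[nu]_z pot b m2 z /\ \int[om]_z pot b m2 z \is a fin_num.
  by apply: (key (2 * rho)%R) m2S m2P => //; lra.
have s1 := pot_circle_split rho0 Kom wb m1P m2P.
have s2 := pot_circle_split rho0 Knu wb m1P m2P.
rewrite k1 in s1; rewrite k2 in s1 f2; rewrite s2 in s1.
move: s1; rewrite -(fineK f2); set c := fine _; clearbody c.
case: (\int[nu]_z (ring_kernel a rho z)%:E) => [x| |]//=; case: (\int[om]_z (ring_kernel a rho z)%:E) => [y| |]//=.
by move=> -[] /addrI ->.
Qed.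

End equilibrium_test.

(** * Measures determined by their integrals against ring kernels *)

Lemma ge0_integral_lebesgue_shift (R : realType) (c : R) (G : R -> \bar R) :
  measurable_fun setT G -> (forall x, 0 <= G x)%E ->
  (\int[lebesgue_measure]_x G (x - c)%R = \int[lebesgue_measure]_x G x)%E.
Proof.
move=> mG G0.
have mS : measurable_fun (setT : set (measurableTypeR R)) (fun x : measurableTypeR R => x - c : measurableTypeR R).
  exact: measurable_funB.
pose S : {mfun measurableTypeR R >-> measurableTypeR R} :=
  MeasurableFun.Pack (MeasurableFun.Class (isMeasurableFun.Build _ _ _ _ _ mS)).
transitivity (\int[pushforward lebesgue_measure S]_x G x)%E.
  by rewrite ge0_integral_pushforward.
(* Lebesgue measure is determined by its values on half-open intervals, which translation
   preserves. *)
apply: eq_measure_integral => A mA _; apply/esym/lebesgue_measure_unique => //= _ [[a b]] _ <-.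
rewrite /pushforward.
have -> : S @^-1` `]a, b]%classic = `]a + c, b + c]%classic.
  by apply/seteqP; split => x /=; rewrite !in_itv/= ltrBrDr lerBlDr.
by rewrite !lebesgue_measure_itv/= !lte_fin ltrD2r -!EFinB; case: ifP => // _; congr (_%:E); ring.
Qed.

Section plane_measure.
Context (R : realType).

(** Named so that it can carry the sigma-finite structure on which Tonelli's theorem rests. *)
Definition plane_measure : set (measurableTypeR R * measurableTypeR R) -> \bar R :=
  product_measure1 (@lebesgue_measure R) (@lebesgue_measure R).

HB.instance Definition _ := Measure.on plane_measure.

Let plane_measure_sigma_finite : sigma_finite setT plane_measure.
Proof.
have /sigma_finiteP[F [TF ndF Foo]] := sigma_finiteT (@lebesgue_measure R).
exists (fun n => F n `*` F n).
  rewrite -setXTT TF predeqE => -[x y]; split.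
    move=> [/= [n _ Fnx] [k _ Fky]]; exists (maxn n k) => //; split.
    - by move: x Fnx; exact/subsetPset/ndF/leq_maxl.
    - by move: y Fky; exact/subsetPset/ndF/leq_maxr.
  by move=> [n _ []/= ? ?]; split; exists n.
move=> k; have [mF Fk] := Foo k; split; first exact: measurableX.
apply: (@le_lt_trans _ _ (lebesgue_measure (F k) * lebesgue_measure (F k))%E).
  by rewrite le_eqVlt; apply/orP; left; apply/eqP; exact: product_measure1E.
by rewrite lte_mul_pinfty// ge0_fin_numE.
Qed.

HB.instance Definition _ := Measure_isSigmaFinite.Build _ _ _ plane_measure
  plane_measure_sigma_finite.

End plane_measure.

Section identification.
Context (R : realType) (K : set R[i]).
Hypothesis (cK : compact K).
Implicit Types (a w z : R[i]) (rho : R) (om nu : probability R[i] R).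

Let mK := compact_measurableC cK.

(** Only [w] is confined to K, since the averaging also involves centres [a] outside K. *)
Lemma compact_uniformly_continuous (f : R[i] -> R) (e : R) : continuous f -> 0 < e ->
  exists2 d : R, 0 < d & forall w a, K w -> cmod (a - w) < d -> `|f a - f w| <= e.
Proof.
move=> cf e0; have e2 : 0 < e / 2 by rewrite divr_gt0.
have /choice[d dP] : forall z, exists d : R, 0 < d /\
    forall w, cmod (w - z) < d + d -> `|f z - f w| < e / 2.
  move=> z; have FF : Filter (nbhs z) by typeclasses eauto.
  have fz : \forall w \near z, `|f z - f w| < e / 2.
    by have [h _] := @cvgrPdist_lt _ _ _ _ FF f (f z); apply: h => //; exact: cf.
  have /nbhs_cmodP[d d0 dP] := fz.
  by exists (d / 2); rewrite divr_gt0//; split=> // w; rewrite -splitr => /dP.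
have [|s [sK Ks]] := @compact_finite_cover R K (fun z => ball_at z (d z)) cK.
  by move=> z _; apply: near_disk; have [] := dP z.
have [s0|s0] := eqVneq s [::].
  by exists 1 => // w a /Ks[y]; rewrite s0.
have [y0 y0s] : exists y, y \in s by case: s s0 {sK Ks} => // y s _; exists y; rewrite mem_head.
have [y ys yP] := seq_max (fun z => - d z) y0s.
exists (d y); first by have [] := dP y.
move=> w a /Ks[x xs]; rewrite /ball_at /= => wx aw.
have [dx0 dx] := dP x; have := yP x xs; rewrite lerN2 => yx.
have h1 : `|f x - f w| < e / 2 by apply: dx; lra.
have h2 : `|f x - f a| < e / 2.
  by apply: dx; have := ler_cmod_dist w a x; lra.
have := ler_normD (f x - f w) (- (f x - f a)); rewrite normrN.
have -> : f x - f w + - (f x - f a) = f a - f w by ring.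
lra.
Qed.

Let T2 : measurableType _ := (measurableTypeR R * measurableTypeR R)%type.
Let leb2 : {sigma_finite_measure set T2 -> \bar R} := @plane_measure R.
Let cpt (p : T2) : R[i] := p.1 +i* p.2.

Let measurable_cpt : measurable_fun setT cpt.
Proof. by apply: measurable_fun_complex; [exact: measurable_fst|exact: measurable_snd]. Qed.

Let measurable_rk rho : measurable_fun setT (fun p : R[i] * T2 => ring_kernel (cpt p.2) rho p.1).
Proof.
apply: (measurableT_comp (f := fun p : R[i] * R[i] => ring_kernel p.2 rho p.1)
  (g := fun p : R[i] * T2 => (p.1, cpt p.2))); first exact: measurable_ring_kernel.
apply: measurable_fun_pair => //=.
exact: measurableT_comp measurable_cpt (@measurable_snd _ _ _ _).
Qed.

Let measurable_rk2 rho w : measurable_fun setT (fun p : T2 => ring_kernel (cpt p) rho w).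
Proof.
apply: (measurableT_comp (f := fun p : R[i] * T2 => ring_kernel (cpt p.2) rho p.1)
  (g := fun p : T2 => (w, p))); first exact: measurable_rk.
exact: pair1_measurable.
Qed.

(** Total mass of the kernel over all centres; by translation invariance the origin may be replaced
    by any point of the plane. *)
Let S rho : \bar R := (\int[leb2]_p (ring_kernel (cpt p) rho 0)%R%:E)%E.

Let ring_kernel_shift rho w : 0 < rho ->
  (\int[leb2]_p (ring_kernel (cpt p) rho w)%:E)%E = S rho.
Proof.
move=> rho0; have rk0 w' p : (0 <= (ring_kernel (cpt p) rho w')%:E)%E.
  by rewrite lee_fin ring_kernel_ge0.
have mrk w' : measurable_fun setT (fun p : T2 => (ring_kernel (cpt p) rho w')%:E : \bar R).
  by apply/measurable_EFinP; exact: measurable_rk2.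
rewrite /S (fubini_tonelli1 _ (mrk w) (rk0 w)) (fubini_tonelli1 _ (mrk 0) (rk0 0)) /fubini_F.
have mF : measurable_fun setT (fun x => \int[@lebesgue_measure R]_y (ring_kernel (cpt (x, y)) rho 0)%R%:E)%E.
  exact: measurable_fun_fubini_tonelli_F (mrk 0) (rk0 0).
rewrite -(ge0_integral_lebesgue_shift (complex.Re w) mF); last first.
  by move=> x; apply: integral_ge0.
apply: eq_integral => x _.
have mG : measurable_fun setT (fun y : R => (ring_kernel (cpt (x - complex.Re w, y)%R) rho 0)%R%:E : \bar R).
  apply: (measurableT_comp (f := fun p : T2 => (ring_kernel (cpt p) rho 0)%R%:E)
    (g := fun y : measurableTypeR R => ((x - complex.Re w, y) : T2))) => //.
  exact: pair1_measurable.
rewrite -(ge0_integral_lebesgue_shift (complex.Im w) mG)//.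
apply: eq_integral => y _; rewrite /ring_kernel.
suff -> : 0 - cpt (x - complex.Re w, y - complex.Im w) = w - cpt (x, y) by [].
by rewrite /cpt; case: w {mG} => u v /=; apply/eqP; rewrite eq_complex /=; apply/andP; split; apply/eqP; ring.
Qed.

Let box (s : R) : set T2 := `[- s, s]%classic `*` `[- s, s]%classic.

Let leb2_box (s : R) : 0 < s -> leb2 (box s) = (2 * s * (2 * s))%:E.
Proof.
move=> s0; pose I : set R := `[- s, s]%classic.
have -> : leb2 (box s) = (lebesgue_measure I * lebesgue_measure I)%E.
  exact: product_measure1E.
rewrite /I !lebesgue_measure_itv/= lte_fin.
have -> : - s < s by lra.
by rewrite -!EFinB -EFinM; congr EFin; ring.
Qed.

Let measurable_box s : measurable (box s).
Proof. by apply: measurableX. Qed.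

(** The kernel is at most ln 2, vanishes outside the square of half-side 2 rho, and equals ln 2 on
    the square of half-side rho / 2. *)
Let S_fin rho : 0 < rho -> exists2 c : R, 0 < c & S rho = c%:E.
Proof.
move=> rho0; have l2 : 0 < ln (2 : R) by rewrite ln_gt0// ltr1n.
have rk0 p : (0 <= (ring_kernel (cpt p) rho 0)%R%:E)%E.
  by rewrite lee_fin ring_kernel_ge0.
have mrk : measurable_fun setT (fun p : T2 => (ring_kernel (cpt p) rho 0)%R%:E : \bar R).
  by apply/measurable_EFinP; exact: measurable_rk2.
have gI (c s : R) : 0 <= c -> ((c%:E * leb2 (box s)) = \int[leb2]_p (c * \1_(box s) p)%R%:E)%E.
  move=> c0; under eq_integral do rewrite EFinM.
  rewrite ge0_integralZl// ?lee_fin//; last first.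
    by apply/measurable_EFinP; exact: measurable_indic.
  by congr (_ * _)%E; have := integral_indic leb2 measurableT (measurable_box s); rewrite setIT => h; exact: esym h.
have mI (c s : R) : measurable_fun setT (fun p : T2 => (c * \1_(box s) p)%:E : \bar R).
  by apply/measurable_EFinP; apply: measurable_funM => //; exact: measurable_indic.
have rkE p : ring_kernel (cpt p) rho 0 =
    ln (Num.max (cmod (cpt p)) (2 * rho)) - ln (Num.max (cmod (cpt p)) rho).
  by rewrite /ring_kernel sub0r cmodN.
have ub : (S rho <= (ln 2)%:E * leb2 (box (2 * rho)))%E.
  rewrite gI; last exact: ltW.
  apply: ge0_le_integral => //.
  move=> p _; rewrite lee_fin rkE indicE; have [pb|pb] := boolP (p \in _).
    rewrite mulr1 lerBlDl -lnM ?posrE ?lt_max ?rho0 ?orbT//.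
    rewrite ler_ln ?posrE ?mulr_gt0 ?lt_max ?rho0 ?mulr_gt0 ?orbT//.
    rewrite ge_max; apply/andP; split.
      rewrite (@le_trans _ _ (Num.max (cmod (cpt p)) rho))// ?le_max ?lexx//.
      by rewrite ler_peMr ?ler1n// le_max cmod_ge0.
    by rewrite mulrC ler_pM2r// le_max lexx orbT.
  rewrite mulr0; move: pb; rewrite notin_setE /box /= !in_itv/= -!ler_norml => pb.
  have h : 2 * rho <= cmod (cpt p).
    rewrite leNgt; apply/negP => h; apply: pb; split.
      exact: le_trans (normr_Re_le (cpt p)) (ltW h).
    exact: le_trans (normr_Im_le (cpt p)) (ltW h).
  by rewrite !max_l ?subrr//; lra.
have lb : ((ln 2)%:E * leb2 (box (rho / 2)) <= S rho)%E.
  rewrite gI; last exact: ltW.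
  apply: ge0_le_integral => //.
    by move=> p _; rewrite lee_fin mulr_ge0// ltW.
  move=> p _; rewrite indicE; have [|_] := boolP (p \in _); last by rewrite mulr0.
  rewrite inE /box /= !in_itv/= -!ler_norml => -[p1 p2].
  have h : cmod (cpt p) <= rho by rewrite (le_trans (ler_cmod_ReIm _))//= (splitr rho) lerD.
  rewrite mulr1 lee_fin rkE !max_r//; last lra.
  by rewrite lnM ?posrE// addrK.
rewrite leb2_box ?mulr_gt0// -EFinM in ub.
rewrite leb2_box ?divr_gt0// -EFinM in lb.
have Sf : S rho \is a fin_num.
  rewrite ge0_fin_numE; first by rewrite (le_lt_trans ub)// ltry.
  by apply: integral_ge0.
exists (fine (S rho)); last by rewrite fineK.
rewrite -(fineK Sf) lee_fin in lb; apply: lt_le_trans lb.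
by rewrite !mulr_gt0// divr_gt0.
Qed.

(* Averages [f] against the translates of the ring kernel over the plane. *)
Lemma ring_kernel_le om nu (f : R[i] -> R) : carried_by K om -> carried_by K nu ->
  (forall a rho, 0 < rho ->
    (\int[om]_w (ring_kernel a rho w)%:E = \int[nu]_w (ring_kernel a rho w)%:E)%E) ->
  continuous f -> (forall z, 0 <= f z) ->
  (\int[om]_w (f w)%:E <= \int[nu]_w (f w)%:E)%E.
Proof.
move=> Kom Knu rkE cf f0; apply/lee_addgt0Pr => e e0.
have e2 : 0 < e / 2 by rewrite divr_gt0.
have [d d0 dP] := compact_uniformly_continuous cf e2.
(* The kernel about [a] vanishes from distance 2 rho = d on, so for [w] in K only centres at which
   [f] is within e/2 of [f w] contribute. *)
pose rho := d / 2; have rho0 : 0 < rho by rewrite divr_gt0.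
have [c c0 Sc] := S_fin rho0.
have mf := continuous_measurableC cf.
pose k (p : R[i] * T2) := ring_kernel (cpt p.2) rho p.1.
have k0 p : 0 <= k p by rewrite ring_kernel_ge0.
have mk : measurable_fun setT k by exact: measurable_rk.
pose h (p : R[i] * T2) := (f (cpt p.2) * k p)%:E.
have h0 p : (0 <= h p)%E by rewrite lee_fin mulr_ge0.
have mfc : measurable_fun setT (fun p : T2 => f (cpt p)) by apply: measurableT_comp.
have mh : measurable_fun setT h.
  apply/measurable_EFinP; apply: measurable_funM => //.
  exact: (measurableT_comp mfc (@measurable_snd _ _ _ _)).
(* After exchanging the integrals, the value of [f] at a fixed centre is a factor and what remains
   is the same for both measures by assumption. *)
have hE : (\int[om]_w \int[leb2]_p h (w, p) = \int[nu]_w \int[leb2]_p h (w, p))%E.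
  rewrite (fubini_tonelli (m1 := om) (m2 := leb2) h mh h0).
  rewrite (fubini_tonelli (m1 := nu) (m2 := leb2) h mh h0).
  apply: eq_integral => p _.
  have E (mu : probability R[i] R) : (\int[mu]_w h (w, p) =
      (f (cpt p))%:E * \int[mu]_w (ring_kernel (cpt p) rho w)%:E)%E.
    rewrite -ge0_integralZl//.
    - by apply/measurable_EFinP; exact: measurable_ring_kernel1.
    - by move=> w _; rewrite lee_fin ring_kernel_ge0.
    - by rewrite lee_fin.
  by rewrite !E rkE.
have mF : measurable_fun setT (fun w => \int[leb2]_p h (w, p))%E.
  have hF := measurable_fun_fubini_tonelli_F (m2 := leb2) h mh h0; exact hF.
have F0 w : (0 <= \int[leb2]_p h (w, p))%E by apply: integral_ge0.
have kw0 w a : d <= cmod (a - w) -> ring_kernel a rho w = 0.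
  move=> aw; rewrite /ring_kernel cmodBC.
  by rewrite !max_l ?subrr//; rewrite /rho; lra.
have mkw w : measurable_fun setT (fun p : T2 => k (w, p)) by exact: measurable_rk2.
have kS w (x : R) : 0 <= x -> (\int[leb2]_p (x * k (w, p))%:E = (x * c)%:E)%E.
  move=> x0; under eq_integral do rewrite EFinM.
  rewrite ge0_integralZl//; first by rewrite ring_kernel_shift// Sc.
    by have /measurable_EFinP := mkw w.
  by move=> p _; rewrite lee_fin.
have mhw w : measurable_fun setT (fun p => h (w, p)).
  by apply/measurable_EFinP; apply: measurable_funM.
have up w : K w -> (\int[leb2]_p h (w, p) <= ((f w + e / 2) * c)%R%:E)%E.
  move=> Kw; have x0 : 0 <= f w + e / 2 by rewrite addr_ge0// ltW.
  rewrite -(kS w)//; apply: ge0_le_integral => //.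
    by apply/measurable_EFinP; apply: measurable_funM.
  move=> p _; rewrite lee_fin; have [wp|pw] := leP d (cmod (cpt p - w)).
    by rewrite /k /= kw0// !mulr0.
  rewrite ler_wpM2r//; have := dP w (cpt p) Kw pw; rewrite ler_norml => /andP[_]; lra.
have lo w : K w -> ((f w * c)%R%:E <= \int[leb2]_p h (w, p) + (e / 2 * c)%R%:E)%E.
  have e20 := ltW e2; move=> Kw; rewrite -!(kS w)// -ge0_integralD//; last 2 first.
  - by move=> p _; rewrite lee_fin mulr_ge0// ltW.
  - by apply/measurable_EFinP; apply: measurable_funM.
  apply: ge0_le_integral => //.
  - by move=> p _; rewrite lee_fin mulr_ge0.
  - by apply/measurable_EFinP; apply: measurable_funM.
  - by apply: emeasurable_funD => //; apply/measurable_EFinP; apply: measurable_funM.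
  move=> p _; rewrite /h -EFinD -mulrDl lee_fin; have [wp|pw] := leP d (cmod (cpt p - w)).
    by rewrite /k /= kw0// !mulr0.
  rewrite ler_wpM2r//; have := dP w (cpt p) Kw pw; rewrite ler_norml => /andP[]; lra.
have om1 : om setT = 1%E := probability_setT om.
have nu1 : nu setT = 1%E := probability_setT nu.
have cstE (mu : probability R[i] R) (x : R) : (\int[mu]_w (cst x%:E) w = x%:E)%E.
  have mu1 : mu setT = 1%E := probability_setT mu.
  by rewrite integral_cst// [X in (_ * X)%E]mu1 mule1.
have mfc' (x : R) : measurable_fun setT (fun w => (f w * x)%:E : \bar R).
  by apply/measurable_EFinP; apply: measurable_funM.
have fc (mu : probability R[i] R) : (\int[mu]_w (f w * c)%:E = c%:E * \int[mu]_w (f w)%:E)%E.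
  have mf' : measurable_fun setT (fun w => (f w)%:E) by exact/measurable_EFinP.
  have cc : (0 <= c%:E)%E by rewrite lee_fin ltW.
  rewrite -ge0_integralZl//; last by move=> w _; rewrite lee_fin.
  by apply: eq_integral => w _; rewrite -EFinM mulrC.
have ec0 : (0 <= (e / 2 * c)%R%:E :> \bar R)%E by rewrite lee_fin mulr_ge0 ?ltW.
have h1 : (c%:E * \int[om]_w (f w)%:E <= \int[om]_w \int[leb2]_p h (w, p) + (e / 2 * c)%R%:E)%E.
  rewrite -fc -[X in (_ + X)%E](cstE om) -ge0_integralD//.
  have mFD : measurable_fun setT (fun w => \int[leb2]_p h (w, p) + cst (e / 2 * c)%R%:E w)%E.
    exact: emeasurable_funD.
  rewrite (integral_carried mK _ Kom)// [leRHS](integral_carried mK mFD Kom).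
  apply: ge0_le_integral => //.
  - by move=> w _; rewrite lee_fin mulr_ge0// ltW.
  - exact: measurable_funTS.
  - exact: measurable_funTS.
have h2 : (\int[nu]_w \int[leb2]_p h (w, p) <= c%:E * \int[nu]_w (f w)%:E + (e / 2 * c)%R%:E)%E.
  have f0' w : (0 <= (f w * c)%:E :> \bar R)%E by rewrite lee_fin mulr_ge0// ltW.
  rewrite -fc -[X in (_ + X)%E](cstE nu) -ge0_integralD//.
  have mFD : measurable_fun setT (fun w => (f w * c)%R%:E + cst (e / 2 * c)%R%:E w)%E.
    exact: emeasurable_funD.
  rewrite (integral_carried mK _ Knu)// [leRHS](integral_carried mK mFD Knu).
  apply: ge0_le_integral => //.
  - exact: measurable_funTS.
  - exact: measurable_funTS.
  by move=> w Kw; rewrite /= -EFinD -mulrDl; exact: up.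
have : (c%:E * \int[om]_w (f w)%:E <= c%:E * (\int[nu]_w (f w)%:E + e%:E))%E.
  apply: (le_trans h1); rewrite hE.
  apply: (le_trans (leeD2r _ h2)).
  rewrite [leRHS]muleDr//; last by rewrite fin_num_adde_defl.
  rewrite -addeA leeD2l// -EFinM -EFinD lee_fin; lra.
by rewrite lee_pmul2l.
Qed.

Lemma ring_kernel_eq om nu (f : R[i] -> R) : carried_by K om -> carried_by K nu ->
  (forall a rho, 0 < rho ->
    (\int[om]_w (ring_kernel a rho w)%:E = \int[nu]_w (ring_kernel a rho w)%:E)%E) ->
  continuous f -> (\int[om]_w (f w)%:E = \int[nu]_w (f w)%:E)%E.
Proof.
move=> Kom Knu rkE cf.
have pos (g : R[i] -> R) : continuous g -> (forall z, 0 <= g z) ->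
    (\int[om]_w (g w)%:E = \int[nu]_w (g w)%:E)%E.
  move=> cg g0; apply/eqP; rewrite eq_le; apply/andP; split.
    exact: ring_kernel_le.
  by apply: ring_kernel_le => // a rho rho0; rewrite rkE.
have cm (g : R[i] -> R) : continuous g -> continuous (fun z => Num.max (g z) 0).
  move=> cg z; have FF : Filter (nbhs z) by typeclasses eauto.
  apply/cvgrPdist_le => e e0; have := cg z => /cvgrPdist_le/(_ _ e0).
  by apply: filterS => w; exact: le_trans (ler_max_dist _ _ _).
rewrite [LHS]integralE [RHS]integralE; congr (_ - _)%E.
  have E (mu : probability R[i] R) : (\int[mu]_w (fun w => (f w)%:E)^\+ w =
      \int[mu]_w (Num.max (f w) 0)%R%:E)%E.
    by apply: eq_integral => w _; rewrite funeposE EFin_max.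
  by rewrite !E; apply: pos; [exact: cm|move=> z; rewrite le_max lexx orbT].
have E (mu : probability R[i] R) : (\int[mu]_w (fun w => (f w)%:E)^\- w =
    \int[mu]_w (Num.max (- f w) 0)%R%:E)%E.
  by apply: eq_integral => w _; rewrite funenegE EFin_max.
rewrite !E; apply: pos; last by move=> z; rewrite le_max lexx orbT.
by apply: (cm (fun z => - f z)) => z; exact: (cvgN (cf z)).
Qed.

End identification.

(** * Unique continuation of potentials *)

Section log_expansion.
Context (R : realType).
Implicit Types (x t : R) (z w : R[i]).

Lemma complex_ReZ x z : complex.Re (x%:C * z) = x * complex.Re z.
Proof. by case: z => a b; rewrite /= mul0r subr0. Qed.

Lemma complex_ReB z w : complex.Re (z - w) = complex.Re z - complex.Re w.
Proof. by case: z w => [a b] [c d]. Qed.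

(** The remainder of a geometric series; it is the derivative in t of ln |1 + t z| minus its Taylor
    sum. *)
Lemma Re_geometric t z n : 1 + t%:C * z != 0 ->
  complex.Re (z / (1 + t%:C * z)) - \sum_(i < n) (- t) ^+ i * complex.Re (z ^+ i.+1) =
  complex.Re (z * (- t%:C * z) ^+ n / (1 + t%:C * z)).
Proof.
move=> nz; elim: n => [|n IH]; first by rewrite big_ord0 subr0 expr0 mulr1.
rewrite big_ord_recr /= opprD addrA {}IH -complex_ReZ -complex_ReB; congr complex.Re.
rewrite rmorphXn rmorphN /= !exprMn !exprS.
by field.
Qed.

(** Up to the factor |w|^2, both sides are the derivative of ln |w| in direction z. *)
Lemma Re_quotient z w : complex.Re z * complex.Re w + complex.Im z * complex.Im w =
  complex.Re (z / w) * cmod w ^+ 2.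
Proof.
have [->|w0] := eqVneq w 0; first by rewrite cmod0 /= !mulr0 expr0n mulr0 addr0.
rewrite -{1 2}(divfK w0 z); case: (z / w) => p q; case: w {w0} => a b.
by rewrite cmodE sqr_sqrtr ?addr_ge0 ?sqr_ge0//=; ring.
Qed.

(** The mean value theorem for [F] on [0, 1], with ln |1 + t z| written as half the logarithm of the
    real polynomial [Q]. The derivative of [F] is a geometric remainder, bounded by |z|^(n+1) / (1 -
    |z|). *)
Lemma ln_cmod_expansion z n : cmod z < 1 ->
  `|ln (cmod (1 + z)) - \sum_(i < n) (-1) ^+ i / i.+1%:R * complex.Re (z ^+ i.+1)|
    <= cmod z ^+ n.+1 / (1 - cmod z).
Proof.
move=> z1; set s := cmod z in z1 *.
pose a := complex.Re z; pose b := complex.Im z.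
pose Q : {poly R} := (1 + a *: 'X) ^+ 2 + (b *: 'X) ^+ 2.
pose P : {poly R} := \sum_(i < n) ((-1) ^+ i / i.+1%:R * complex.Re (z ^+ i.+1)) *: 'X^(i.+1).
have QE t : Q.[t] = cmod (1 + t%:C * z) ^+ 2.
  rewrite /Q !hornerE /a /b; case: z {z1 s a b Q P} => a b /=.
  by rewrite cmodE sqr_sqrtr ?addr_ge0 ?sqr_ge0//; ring.
have Q'E t : Q^`().[t] = 2 * (complex.Re z * complex.Re (1 + t%:C * z)
    + complex.Im z * complex.Im (1 + t%:C * z)).
  rewrite /Q /a /b; case: z {z1 s a b Q P QE} => a b /=.
  rewrite !expr2 !(derivD, derivM, derivZ, derivX) (derivC 1) !hornerE /=.
  by ring.
have P'E t : P^`().[t] = \sum_(i < n) (- t) ^+ i * complex.Re (z ^+ i.+1).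
  rewrite /P raddf_sum horner_sum; apply: eq_bigr => i _ /=.
  rewrite derivZ derivXn hornerZ hornerMn hornerXn /=.
  have i0 : i.+1%:R != 0 :> R by rewrite pnatr_eq0.
  rewrite (exprNn t) -(mulr_natr (t ^+ i)); set x := i.+1%:R in i0 *; set c := complex.Re _.
  by field.
have lo t : t \in `[0, 1] -> 1 - s <= cmod (1 + t%:C * z).
  rewrite in_itv /= => /andP[t0 t1].
  have := ler_cmodB (1 + t%:C * z) (t%:C * z).
  rewrite addrK cmodM cmodR cmod1 ger0_norm// -lerBlDr => h; apply: le_trans h.
  by rewrite lerD2l lerN2 ler_piMl// cmod_ge0.
have pos t : t \in `[0, 1] -> 0 < cmod (1 + t%:C * z).
  by move=> /lo; apply: lt_le_trans; rewrite subr_gt0.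
pose F : R -> R := 2^-1 *: (@ln R \o horner Q) - horner P.
pose dF t := 2^-1 * (Q.[t]^-1 * Q^`().[t]) - P^`().[t].
have FD t : t \in `[0, 1] -> is_derive t 1 F (dF t).
  move=> t01; have Q0 : 0 < Q.[t] by rewrite QE exprn_gt0// pos.
  have h1 := is_derive1_comp (is_derive1_ln Q0) (is_derive_poly Q t).
  exact: is_deriveB.
have dFE t : t \in `[0, 1] -> `|dF t| <= s ^+ n.+1 / (1 - s).
  move=> t01; have w0 := pos t t01; have wn0 : 1 + t%:C * z != 0 by rewrite -cmod_gt0.
  have -> : dF t = complex.Re (z * (- t%:C * z) ^+ n / (1 + t%:C * z)).
    rewrite -Re_geometric// /dF P'E Q'E Re_quotient QE; congr (_ - _).
    have : cmod (1 + t%:C * z) ^+ 2 != 0 by rewrite expf_neq0// gt_eqF.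
    set c := _ ^+ 2; set y := complex.Re _ => c0.
    by field.
  apply: (le_trans (normr_Re_le _)); rewrite !cmodM cmodV cmodX cmodM cmodN cmodR exprS.
  have /andP[t0 t1] := t01; rewrite !bnd_simp in t0 t1.
  rewrite ger0_norm//; apply: ler_pM.
  - by rewrite !mulr_ge0 ?cmod_ge0// exprn_ge0// mulr_ge0 ?cmod_ge0.
  - by rewrite invr_ge0 cmod_ge0.
  - rewrite ler_wpM2l ?cmod_ge0// lerXn2r ?nnegrE ?mulr_ge0 ?cmod_ge0//.
    by rewrite ler_piMl// cmod_ge0.
  by rewrite lef_pV2 ?posrE ?lo// subr_gt0.
have FD' t : t \in `]0, 1[ -> is_derive t 1 F (dF t).
  by move=> t01; apply: FD; exact: subset_itv_oo_cc.
have Fc : {within `[0, 1], continuous F}.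
  by apply: derivable_within_continuous => t t01; have [] := FD t t01.
have [c c01] := MVT ltr01 FD' Fc.
rewrite subr0 mulr1 => FE.
have F1 : F 1 = ln (cmod (1 + z)) - \sum_(i < n) (-1) ^+ i / i.+1%:R * complex.Re (z ^+ i.+1).
  rewrite /F /= !fctE /= QE mul1r; congr (_ - _); last first.
    rewrite /P horner_sum; apply: eq_bigr => i _.
    by rewrite hornerZ hornerXn expr1n mulr1.
  rewrite lnXn ?posrE; last by rewrite -[z]mul1r pos// in_itv/= ler01 lexx.
  by set x := ln _; rewrite -[LHS]/(2^-1 * (x *+ 2)); lra.
have F0 : F 0 = 0.
  rewrite /F /= !fctE /= QE mul0r addr0 cmod1 expr1n ln1 scaler0 sub0r.
  rewrite /P horner_sum big1 ?oppr0// => i _.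
  by rewrite hornerZ hornerXn expr0n mulr0.
rewrite -F1 -[F 1]subr0 -F0 FE; apply: dFE; exact: subset_itv_oo_cc.
Qed.

End log_expansion.

(** A first nonzero coefficient would dominate for small t, where [phi] vanishes. So all
    coefficients are 0, and the error bound, which tends to 0 at every t in [0, d[, finishes.
    One-sided in t, for use along rays. *)
Lemma power_series_zero (R : realType) (phi : R -> R) (a : nat -> R) (C d e : R) :
  0 <= C -> 0 < d -> 0 < e ->
  (forall t n, 0 <= t -> t < d ->
    `|phi t - \sum_(i < n) a i * t ^+ i.+1| <= C * ((t / d) ^+ n.+1 / (1 - t / d))) ->
  (forall t, 0 <= t -> t < e -> phi t = 0) ->
  forall t, 0 <= t -> t < d -> phi t = 0.
Proof.
move=> C0 d0 e0 phiE phi0.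
have td t : t < d -> t / d < 1 by rewrite ltr_pdivrMr// mul1r.
have a0 n : a n = 0.
  elim/ltn_ind: n => n IH; apply/eqP; rewrite -normr_eq0 eq_le normr_ge0 andbT.
  rewrite leNgt; apply/negP => an.
  (* For t <= d/2 the error bound is at most M t^(n+2), whence |a n| <= M t; the last term of the
     minimum makes M t at most |a n| / 2. *)
  pose M := 2 * C / d ^+ n.+2.
  have M0 : 0 <= M by apply: divr_ge0; [exact: mulr_ge0|exact/ltW/exprn_gt0].
  pose t := Num.min (e / 2) (Num.min (d / 2) (`|a n| / (2 * (M + 1)))).
  have M1 : 0 < 2 * (M + 1) by lra.
  have t0 : 0 < t by rewrite !lt_min !divr_gt0.
  have te : t < e by rewrite (@le_lt_trans _ _ (e / 2))// ?ge_min ?lexx//; lra.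
  have td2 : t <= d / 2 by rewrite !ge_min lexx orbT.
  have tM : t <= `|a n| / (2 * (M + 1)) by rewrite !ge_min lexx !orbT.
  have tld : t < d by lra.
  have := phiE t n.+1 (ltW t0) tld.
  rewrite (phi0 t (ltW t0) te) sub0r normrN big_ord_recr /= big1 ?add0r; last first.
    by move=> i _; rewrite IH// mul0r.
  rewrite normrM normrX (gtr0_norm t0) => h.
  have : `|a n| * t ^+ n.+1 <= M * t * t ^+ n.+1.
    apply: (le_trans h); rewrite exprMn exprVn /M.
    have q : (1 - t / d)^-1 <= 2.
      rewrite -[leRHS]invrK lef_pV2 ?posrE ?invr_gt0// ?subr_gt0 ?td//.
      have : t / d <= 2^-1 by rewrite ler_pdivrMr//; lra.
      lra.
    have -> : 2 * C / d ^+ n.+2 * t * t ^+ n.+1 = C * (t ^+ n.+2 / d ^+ n.+2 * 2).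
      by rewrite (exprS t n.+1); ring.
    rewrite ler_wpM2l// ler_wpM2l// divr_ge0// exprn_ge0// ltW//.
  rewrite ler_pM2r ?exprn_gt0// => h2.
  have : M * t <= M * (`|a n| / (2 * (M + 1))) by rewrite ler_wpM2l.
  have -> : M * (`|a n| / (2 * (M + 1))) = (M / (M + 1)) * (`|a n| / 2) by field; lra.
  have : M / (M + 1) * (`|a n| / 2) <= `|a n| / 2.
    by rewrite ler_piMl ?divr_ge0// ler_pdivrMr; lra.
  lra.
move=> t t0 tld; apply/eqP; rewrite -normr_eq0 eq_le normr_ge0 andbT leNgt; apply/negP => pt.
have x1 := td _ tld; set x := t / d in x1.
have x0 : 0 <= x by rewrite divr_ge0// ltW.
pose D := C / (1 - x) + 1.
have D0 : 0 < D by rewrite ltr_wpDl// divr_ge0// subr_ge0 ltW.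
have nx : `|x| < 1 by rewrite ger0_norm.
have := @cvg_expr _ x nx => /cvgrPdist_lt/(_ (`|phi t| / D)).
rewrite divr_gt0// => /(_ isT)[n _ /(_ n.+1 (leqnSn n))] /=.
rewrite sub0r normrN normrX ger0_norm// ltr_pdivlMr// => h.
have := phiE t n t0 tld; rewrite big1 ?subr0; last by move=> i _; rewrite a0 mul0r.
rewrite -/x; move: h; rewrite /D mulrDr mulr1 => h h2.
have E : C * (x ^+ n.+1 / (1 - x)) = x ^+ n.+1 * (C / (1 - x)) by ring.
have : 0 <= x ^+ n.+1 by rewrite exprn_ge0.
lra.
Qed.

Section continuation.
Context (R : realType) (K : set R[i]).
Hypothesis (cK : compact K).
Implicit Types (z w e u : R[i]) (mu om nu : probability R[i] R) (t : R).

Let mK := compact_measurableC cK.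

Lemma compl_compact_dist z : ~ K z -> exists2 d : R, 0 < d &
  forall w, K w -> d <= cmod (z - w).
Proof.
move=> Kz; have oK : open (~` K) by apply: closed_openC; exact: compact_closedC.
have /nbhs_cmodP[d d0 dP] : nbhs z (~` K) by exact: open_nbhs_nbhs.
exists d => // w Kw; rewrite leNgt cmodBC; apply/negP => /dP; exact.
Qed.

Lemma bounded_integrable mu (g : R[i] -> R) (C : R) : measurable_fun K g ->
  (forall w, K w -> `|g w| <= C) -> mu.-integrable K (EFin \o g).
Proof.
move=> mg gC; apply: measurable_bounded_integrable => //.
  exact: (le_lt_trans (probability_le1 mu mK) (ltry _)).
by exists C; split; [exact: num_real|move=> M CM w Kw /=; rewrite (le_trans (gC w Kw))// ltW].
Qed.

Lemma normr_Rintegral_le mu (g : R[i] -> R) (C : R) : 0 <= C -> measurable_fun K g ->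
  (forall w, K w -> `|g w| <= C) -> `|\int[mu]_(w in K) g w|%R <= C.
Proof.
move=> C0 mg gC; have ig := bounded_integrable mu mg gC.
apply: (le_trans (le_normr_Rintegral mK ig)).
have mKf : mu K \is a fin_num.
  by rewrite ge0_fin_numE//; exact: (le_lt_trans (probability_le1 mu mK) (ltry _)).
apply: (@le_trans _ _ (C * fine (mu K))); last first.
  by rewrite ler_piMr// -lee_fin fineK//; exact: probability_le1.
rewrite -Rintegral_cst//; apply: le_Rintegral => //.
- apply: (@bounded_integrable mu (fun w => `|g w|) C); first exact: measurableT_comp.
  by move=> w Kw; rewrite normr_id gC.
- apply: (@bounded_integrable mu (fun=> C) C) => //.
  by move=> w _; rewrite ger0_norm.
Qed.

(** Real-valued form of [potential], faithful at points off K, from which the logarithm is bounded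
    on K. *)
Definition rpot mu z : R := (\int[mu]_(w in K) ln (cmod (z - w)))%R.

Lemma measurable_lnB z : measurable_fun setT (fun w => ln (cmod (z - w))).
Proof. apply: (measurableT_comp (f := @ln R)) => //.
under eq_fun do rewrite cmodBC.
exact: continuous_measurableC (@continuous_cmodB R z). Qed.

Lemma ln_bounded z : ~ K z -> exists2 C : R, 0 <= C &
  forall w, K w -> `|ln (cmod (z - w))| <= C.
Proof.
move=> Kz; have [d d0 dP] := compl_compact_dist Kz.
have [r r0 Kr] := bounded_compact cK.
exists (`|ln d| + `|ln (cmod z + r)|); first by rewrite addr_ge0.
move=> w Kw; have dw := dP w Kw.
have wr : cmod (z - w) <= cmod z + r.
  by rewrite (le_trans (ler_cmodB _ _))// lerD2l; apply: ltW; exact: Kr.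
have h1 : ln d <= ln (cmod (z - w)) by rewrite ler_ln ?posrE// (lt_le_trans d0).
have h2 : ln (cmod (z - w)) <= ln (cmod z + r).
  by rewrite ler_ln ?posrE// (lt_le_trans d0)// (le_trans dw).
have := ler_norm (ln (cmod z + r)); have := ler_norm (- ln d); rewrite normrN.
have := normr_ge0 (ln d); have := normr_ge0 (ln (cmod z + r)).
by rewrite ler_norml; lra.
Qed.

Lemma integrable_ln mu z : ~ K z ->
  mu.-integrable K (EFin \o (fun w => ln (cmod (z - w)))).
Proof.
move=> /ln_bounded[C _ CP]; apply: bounded_integrable CP.
exact: measurable_funTS (measurable_lnB z).
Qed.

Lemma potential_rpot mu z : carried_by K mu -> ~ K z -> potential mu z = (rpot mu z)%:E.
Proof.
move=> Kmu Kz; rewrite /potential (integral_carried mK _ Kmu); last exact: measurable_logmodr.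
transitivity (\int[mu]_(w in K) (ln (cmod (z - w)%R))%:E)%E.
  apply: eq_integral => w; rewrite inE => Kw; rewrite logmodE.
  by case: eqP => // /eqP; rewrite subr_eq0 => /eqP zw; case: Kz; rewrite zw.
by rewrite /rpot /Rintegral fineK//; apply: integrable_fin_num => //; exact: integrable_ln.
Qed.

(* A globally measurable version of [e / (z - w)], off the pole. *)
Let quo e z w : R[i] := (expR (- 2 * ln (cmod (z - w))))%:C * (e * (z - w)^*).

Let quoE e z w : z != w -> quo e z w = e / (z - w).
Proof.
move=> zw; have d0 : 0 < cmod (z - w) by rewrite cmod_gt0 subr_eq0.
have -> : quo e z w = (cmod (z - w) ^- 2)%:C * (e * (z - w)^*).
  congr (_%:C * _); rewrite mulNr expRN -[2]/(2%:R) mulr_natl -lnXn ?posrE// lnK// posrE exprn_gt0//.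
have zw0 : z - w != 0 by rewrite subr_eq0.
apply: (mulIf zw0); rewrite divfK// -!mulrA [_^* * _]mulrC.
have -> : (z - w) * (z - w)^* = (cmod (z - w) ^+ 2)%:C.
  case: (z - w) => a b; rewrite cmodE sqr_sqrtr ?addr_ge0 ?sqr_ge0//=.
  by apply/eqP; rewrite eq_complex /=; apply/andP; split; apply/eqP; ring.
by rewrite mulrC -mulrA -rmorphM /= mulfV ?mulr1// expf_neq0// gt_eqF.
Qed.

Let cmeas (f : R[i] -> R[i]) := measurable_fun setT (fun w => complex.Re (f w)) /\
  measurable_fun setT (fun w => complex.Im (f w)).

Let cmeasM f g : cmeas f -> cmeas g -> cmeas (fun w => f w * g w).
Proof.
move=> [f1 f2] [g1 g2]; split.
  rewrite (_ : (fun w => _) = (fun w => complex.Re (f w) * complex.Re (g w)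
      - complex.Im (f w) * complex.Im (g w))).
    by apply: measurable_funB; apply: measurable_funM.
  by apply/funext => w; case: (f w) (g w) => [a b] [c d].
rewrite (_ : (fun w => _) = (fun w => complex.Re (f w) * complex.Im (g w)
    + complex.Im (f w) * complex.Re (g w))).
  by apply: measurable_funD; apply: measurable_funM.
by apply/funext => w; case: (f w) (g w) => [a b] [c d].
Qed.

Let cmeas_quo e z n : cmeas (fun w => quo e z w ^+ n).
Proof.
have mRe : measurable_fun setT (fun w => complex.Re (z - w)).
  rewrite (_ : (fun w => _) = (fun w => complex.Re z - complex.Re w)); last first.
    by apply/funext => w; exact: complex_ReB.
  by apply: measurable_funB => //; exact: continuous_measurableC (@continuous_Re R).
have mIm : measurable_fun setT (fun w => complex.Im (z - w)).
  rewrite (_ : (fun w => _) = (fun w => complex.Im z - complex.Im w)); last first.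
    by apply/funext => w; case: z {mRe} w => [a b] [c d].
  by apply: measurable_funB => //; exact: continuous_measurableC (@continuous_Im R).
elim: n => [|n IH]; first by split; rewrite /=; exact: measurable_cst.
have -> : (fun w => quo e z w ^+ n.+1) = (fun w => quo e z w * quo e z w ^+ n).
  by apply/funext => w; rewrite exprS.
apply: cmeasM IH; apply: (@cmeasM (fun w => (expR (- 2 * ln (cmod (z - w))))%:C)
  (fun w => e * (z - w)^*)).
  split => /=; last exact: measurable_cst.
  apply: measurableT_comp => //; apply: measurable_funM => //; exact: measurable_lnB.
apply: (@cmeasM (fun=> e) (fun w => (z - w)^*)); first by split; exact: measurable_cst.
split.
  by rewrite (_ : (fun w => _) = (fun w => complex.Re (z - w)))//; apply/funext => w; case: (z - w).
rewrite (_ : (fun w => _) = (fun w => - complex.Im (z - w))).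
  exact: measurableT_comp.
by apply/funext => w; case: (z - w).
Qed.

Let coef mu z e i : R :=
  (-1) ^+ i / i.+1%:R * (\int[mu]_(w in K) complex.Re (quo e z w ^+ i.+1))%R.

(** Integrates the expansion of ln |1 + t e / (z - w)| over w in K; the bound |t e / (z - w)| <= t /
    d makes the error uniform in w. *)
Lemma rpot_expansion mu z e d t n : 0 < d -> (forall w, K w -> d <= cmod (z - w)) ->
  cmod e = 1 -> 0 <= t -> t < d ->
  `|rpot mu (z + t%:C * e) - rpot mu z - \sum_(i < n) coef mu z e i * t ^+ i.+1|
    <= (t / d) ^+ n.+1 / (1 - t / d).
Proof.
move=> d0 dP e1 t0 td.
have x1 : t / d < 1 by rewrite ltr_pdivrMr// mul1r.
have x0 : 0 <= t / d by rewrite divr_ge0// ltW.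
have Kz : ~ K z by move=> /dP; rewrite subrr cmod0 leNgt d0.
have Kt : ~ K (z + t%:C * e).
  move=> /dP; rewrite opprD addrA subrr sub0r cmodN cmodM cmodR e1 mulr1 ger0_norm//.
  by rewrite leNgt td.
have zw w : K w -> z != w by move=> Kw; apply/eqP => E; apply: Kz; rewrite E.
have qd w : K w -> cmod (t%:C * quo e z w) <= t / d.
  move=> Kw; rewrite quoE ?zw// !cmodM cmodR e1 mul1r cmodV ger0_norm//.
  by rewrite ler_wpM2l// lef_pV2 ?posrE ?dP// (lt_le_trans d0)// dP.
have mq i : measurable_fun K (fun w => complex.Re (quo e z w ^+ i)).
  exact: measurable_funTS (cmeas_quo e z i).1.
have iq i : mu.-integrable K (EFin \o (fun w => complex.Re (quo e z w ^+ i))).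
  apply: (@bounded_integrable mu _ (d ^- i) (mq i)) => w Kw.
  rewrite (le_trans (normr_Re_le _))// cmodX quoE ?zw// cmodM e1 mul1r cmodV.
  have zw0 : 0 < cmod (z - w) by rewrite cmod_gt0 subr_eq0 zw.
  have d00 : 0 <= d := ltW d0.
  by rewrite -exprVn lerXn2r ?nnegrE ?invr_ge0 ?cmod_ge0// lef_pV2 ?posrE// dP.
pose s n w := \sum_(i < n) (-1) ^+ i / i.+1%:R * complex.Re ((t%:C * quo e z w) ^+ i.+1).
have sS m w : s m.+1 w = s m w +
    (-1) ^+ m / m.+1%:R * t ^+ m.+1 * complex.Re (quo e z w ^+ m.+1).
  rewrite /s big_ord_recr /=; congr (_ + _).
  by rewrite exprMn -rmorphXn /= complex_ReZ mulrA.
have icq (c : R) i : mu.-integrable K (EFin \o (fun w => c * complex.Re (quo e z w ^+ i))).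
  have := integrableZl mK c (iq i); apply: eq_integrable => // w _ /=.
have is_ m : mu.-integrable K (EFin \o s m) /\
    (\int[mu]_(w in K) s m w)%R = \sum_(i < m) coef mu z e i * t ^+ i.+1.
  elim: m => [|m [IH1 IH2]].
    rewrite big_ord0; split.
      apply: (@bounded_integrable mu _ 0); last by move=> w _; rewrite /s big_ord0 normr0.
      by rewrite (_ : s 0 = cst 0)//; apply/funext => w; rewrite /s big_ord0.
    under eq_Rintegral do rewrite /s big_ord0.
    by rewrite Rintegral_cst// mul0r.
  have sE : s m.+1 = (fun w => s m w +
      (-1) ^+ m / m.+1%:R * t ^+ m.+1 * complex.Re (quo e z w ^+ m.+1)).
    by apply/funext => w; exact: sS.
  split; first by rewrite sE; apply: eq_integrable (integrableD mK IH1 (icq _ _)).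
  rewrite sE RintegralD// IH2 RintegralZl// big_ord_recr /=; congr (_ + _).
  by rewrite /coef; ring.
have [is1 <-] := is_ n.
have iB : mu.-integrable K (EFin \o
    (fun w => ln (cmod (z + t%:C * e - w)) - ln (cmod (z - w)))).
  by apply: eq_integrable (integrableB mK (integrable_ln mu Kt) (integrable_ln mu Kz)).
rewrite /rpot -RintegralB//; [|exact: integrable_ln|exact: integrable_ln].
rewrite -RintegralB//; apply: normr_Rintegral_le.
- by rewrite divr_ge0 ?exprn_ge0// subr_ge0 ltW.
- apply: measurable_funB; last by have /measurable_int/measurable_EFinP := is1.
  by have /measurable_int/measurable_EFinP := iB.
move=> w Kw.
have zw0 : 0 < cmod (z - w) by rewrite cmod_gt0 subr_eq0 zw.
have zwn : z - w != 0 by rewrite subr_eq0 zw.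
have q1 : cmod (t%:C * quo e z w) < 1 by rewrite (le_lt_trans (qd w Kw)).
have -> : ln (cmod (z + t%:C * e - w)) - ln (cmod (z - w)) = ln (cmod (1 + t%:C * quo e z w)).
  have E : z + t%:C * e - w = (z - w) * (1 + t%:C * quo e z w).
    by rewrite quoE ?zw//; field.
  have p : 0 < cmod (1 + t%:C * quo e z w).
    rewrite cmod_gt0; apply/eqP => h; apply: Kt.
    by have := E; rewrite h mulr0 => /eqP; rewrite subr_eq0 => /eqP ->.
  by rewrite E cmodM lnM ?posrE// addrAC subrr add0r.
apply: (le_trans (ln_cmod_expansion n q1)).
apply: ler_pM.
- by rewrite exprn_ge0// cmod_ge0.
- by rewrite invr_ge0 subr_ge0 ltW.
- by rewrite lerXn2r ?nnegrE ?cmod_ge0// qd.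
- by rewrite lef_pV2 ?posrE ?subr_gt0// lerD2l lerN2 qd.
Qed.

(** Along each ray from z the difference of the potentials has an expansion valid up to distance d,
    and it vanishes near z. *)
Lemma rpot_eq_disk om nu z (d e : R) : 0 < d -> (forall w, K w -> d <= cmod (z - w)) ->
  0 < e -> (forall y, cmod (y - z) < e -> rpot om y = rpot nu y) ->
  forall y, cmod (y - z) < d -> rpot om y = rpot nu y.
Proof.
move=> d0 dP e0 eqe y yd; have [->|yz] := eqVneq y z.
  by apply: eqe; rewrite subrr cmod0.
have t0 : 0 < cmod (y - z) by rewrite cmod_gt0 subr_eq0.
pose u := (cmod (y - z))%:C^-1 * (y - z).
have tn0 : (cmod (y - z))%:C != 0 :> R[i] by rewrite fmorph_eq0 gt_eqF.
have u1 : cmod u = 1 by rewrite cmodM cmodV cmodR gtr0_norm// mulVf// gt_eqF.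
have yE : y = z + (cmod (y - z))%:C * u by rewrite mulrA mulfV// mul1r addrC subrK.
have zE : rpot om z = rpot nu z by apply: eqe; rewrite subrr cmod0.
pose phi t := rpot om (z + t%:C * u) - rpot nu (z + t%:C * u).
suff : phi (cmod (y - z)) = 0 by rewrite /phi -yE => /eqP; rewrite subr_eq0 => /eqP.
(* The factor 2 adds the errors of the two expansions. *)
apply: (@power_series_zero R phi (fun i => coef om z u i - coef nu z u i) 2 d e) => //.
- move=> t n t0' td.
  have h1 := rpot_expansion om n d0 dP u1 t0' td.
  have h2 := rpot_expansion nu n d0 dP u1 t0' td.
  have -> : phi t - \sum_(i < n) (coef om z u i - coef nu z u i) * t ^+ i.+1 =
      (rpot om (z + t%:C * u) - rpot om z - \sum_(i < n) coef om z u i * t ^+ i.+1) -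
      (rpot nu (z + t%:C * u) - rpot nu z - \sum_(i < n) coef nu z u i * t ^+ i.+1).
    under eq_bigr do rewrite mulrBl.
    by rewrite sumrB /phi zE; ring.
  by rewrite (le_trans (ler_normB _ _))// mulrDl !mul1r lerD.
- move=> t t0' te; rewrite /phi eqe ?subrr//.
  by rewrite addrAC subrr add0r cmodM cmodR u1 mulr1 ger0_norm.
- exact: ltW.
Qed.

(** The points near which the potentials agree form a nonempty subset of the complement of K that is
    both open and closed in it. *)
Lemma unique_continuation om nu r : carried_by K om -> carried_by K nu ->
  connected (~` K) ->
  (forall z, r <= cmod z -> ~ K z -> potential om z = potential nu z) ->
  forall z, ~ K z -> potential om z = potential nu z.
Proof.
move=> Kom Knu conn out.
have oK : open (~` K) by apply: closed_openC; exact: compact_closedC.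
pose Z := [set z | ~ K z /\ exists2 e : R, 0 < e &
  forall y, cmod (y - z) < e -> rpot om y = rpot nu y].
suff ZE : Z = ~` K.
  move=> z Kz; rewrite !potential_rpot//; congr (_%:E).
  have [_ [e e0 eP]] : Z z by rewrite ZE.
  by apply: eP; rewrite subrr cmod0.
apply: conn.
- have [s s0 Ks] := bounded_compact cK.
  (* The unit disk about x lies beyond both [r] and a disk of radius [s] containing K. *)
  pose x := Num.max r s + 2.
  have xr : r <= Num.max r s by rewrite le_max lexx.
  have xs : s <= Num.max r s by rewrite le_max lexx orbT.
  have far y : cmod (y - x%:C) < 1 -> r <= cmod y /\ s < cmod y.
    move=> yx; have := ler_cmodB (y - x%:C) y; rewrite addrAC subrr sub0r cmodN cmodR.
    by rewrite ger0_norm /x; [lra|rewrite addr_ge0// (le_trans _ xs)// ltW].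
  have farK y : cmod (y - x%:C) < 1 -> ~ K y.
    by move=> /far[_ sy] /Ks; rewrite /disk /= ltNge ltW.
  exists x%:C; split; first by apply: farK; rewrite subrr cmod0.
  exists 1 => // y y1; have := out y (far y y1).1 (farK y y1).
  by rewrite !potential_rpot//; [case|exact: farK|exact: farK].
- exists Z; last by apply/seteqP; split => [z Zz|z []//]; split => //; case: Zz.
  rewrite openE => z [Kz [e e0 eP]].
  have /nbhs_cmodP[d d0 dP] : nbhs z (~` K) by exact: open_nbhs_nbhs.
  apply/nbhs_cmodP; exists (Num.min d (e / 2)); first by rewrite lt_min d0 divr_gt0.
  move=> w; rewrite lt_min => /andP[wd we]; split; first exact: dP.
  exists (e / 2); first by rewrite divr_gt0.
  by move=> y yw; apply: eP; have := ler_cmod_dist w y z; lra.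
- exists (closure Z); first exact: closed_closure.
  apply/seteqP; split => [z Zz|z [Kz clz]].
    by split; [case: Zz|exact: subset_closure].
  have [d d0 dP] := compl_compact_dist Kz.
  have d3 : 0 < d / 3 by rewrite divr_gt0.
  (* A point [z1] of [Z] within d/3 of z is at least 2d/3 away from K. Agreement spreads over the
     disk of that radius about [z1], which contains the disk of radius d/3 about z. *)
  have [z1 [[Kz1 [e e0 eP]] z1z]] := clz _ (near_disk z d3).
  have d1 w : K w -> d * 2 / 3 <= cmod (z1 - w).
    by move=> Kw; have := dP w Kw; have := ler_cmod_dist z1 z w; rewrite (cmodBC z z1) /= in z1z *; lra.
  have d20 : 0 < d * 2 / 3 by rewrite divr_gt0// mulr_gt0.
  split => //; exists (d / 3) => // y yz.
  apply: (rpot_eq_disk d20 d1 e0 eP).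
  by have := ler_cmod_dist z y z1; rewrite (cmodBC z z1) /= in z1z *; lra.
Qed.

End continuation.

(** * Root distributions *)

Section roots.
Context (R : realType).
Implicit Types (p : {poly R[i]}) (z : R[i]).

Lemma proots_prod p : p = lead_coef p *: \prod_(x <- proots p) ('X - x%:P).
Proof. exact: (svalP (closed_field_poly_normal p)). Qed.

Lemma size_proots p : p != 0 -> size (proots p) = pdeg p.
Proof.
move=> p0; rewrite /pdeg {2}(proots_prod p) size_scale ?lead_coef_eq0//.
by rewrite size_prod_XsubC.
Qed.

Lemma root_proots p z : p != 0 -> root p z = (z \in proots p).
Proof.
by move=> p0; rewrite {1}(proots_prod p) rootZ ?lead_coef_eq0// root_prod_XsubC.
Qed.

Lemma root_distributionE p : p != 0 -> root_distribution p = uniform_on R (0 : R[i]) (proots p).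
Proof. by move=> p0; rewrite /root_distribution /uniform_on -size_proots. Qed.

Lemma logmod_horner p z : p != 0 -> z \notin proots p ->
  logmod p.[z] = (ln (cmod (lead_coef p)) + \sum_(x <- proots p) ln (cmod (z - x)))%:E.
Proof.
move=> p0 zp; rewrite logmodE; have pz : (p.[z] == 0) = false.
  by apply/negbTE; move: zp; rewrite -root_proots.
rewrite pz; congr (_%:E); rewrite {1}(proots_prod p) hornerZ horner_prod.
under eq_bigr do rewrite hornerXsubC.
have zx x : x \in proots p -> z - x != 0.
  by move=> xp; rewrite subr_eq0; apply: contraNneq zp => ->.
rewrite (sum_ln_cmod zx) cmodM lnM// posrE cmod_gt0 ?lead_coef_eq0//.
by rewrite prodf_seq_neq0; apply/allP => x /zx.
Qed.

End roots.

(** * Tent functions, limits along ultrafilters and finite covers *)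

Section tent.
Context (R : realType).
Implicit Types (z w : R[i]) (rho : R).

(** Lies between the indicator of the disk of radius rho and twice that of the disk of radius 2 rho,
    so masses of disks and integrals of continuous functions bound each other. *)
Definition tent z rho w : R := Num.max (2 - cmod (w - z) / rho) 0.

Lemma tent_ge0 z rho w : 0 <= tent z rho w.
Proof. by rewrite le_max lexx orbT. Qed.

Lemma tent_le2 z rho w : 0 < rho -> tent z rho w <= 2.
Proof.
move=> rho0; rewrite ge_max ler0n andbT gerBl.
by rewrite divr_ge0 ?cmod_ge0// ltW.
Qed.

Lemma tent_ge1 z rho w : 0 < rho -> cmod (w - z) < rho -> 1 <= tent z rho w.
Proof.
move=> rho0 wz; rewrite le_max; apply/orP; left.
by have : cmod (w - z) / rho < 1 by [rewrite ltr_pdivrMr// mul1r]; lra.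
Qed.

Lemma tent_eq0 z rho w : 0 < rho -> 2 * rho <= cmod (w - z) -> tent z rho w = 0.
Proof.
move=> rho0 wz; apply: max_r.
by have : 2 <= cmod (w - z) / rho by [rewrite ler_pdivlMr]; lra.
Qed.

Lemma continuous_tent z rho : 0 < rho -> continuous (tent z rho).
Proof.
move=> rho0; apply: (@lipschitz_continuous_cmod _ _ rho^-1) => x y.
apply: (le_trans (ler_max_dist _ _ _)).
have -> : 2 - cmod (x - z) / rho - (2 - cmod (y - z) / rho) =
  rho^-1 * (cmod (y - z) - cmod (x - z)) by ring.
rewrite normrM gtr0_norm ?invr_gt0// ler_pM2l ?invr_gt0//.
by rewrite (le_trans (ler_dist_cmod _ _))// opprB addrA subrK cmodBC.
Qed.

Lemma measurable_tent z rho : 0 < rho -> measurable_fun setT (fun w => (tent z rho w)%:E).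
Proof.
by move=> rho0; apply/measurable_EFinP; apply: continuous_measurableC; exact: continuous_tent.
Qed.

Lemma compact_tent z rho : 0 < rho -> compact (closure [set w | tent z rho w != 0]).
Proof.
move=> rho0; apply: (@subclosed_compact _ _ (cdisk (cmod z + 2 * rho))).
- exact: closed_closure.
- exact: compact_cdisk.
have cd : closed [set w | cmod (w - z) <= 2 * rho] := @closed_cdisk_at R z (2 * rho).
apply: (@subset_trans _ [set w | cmod (w - z) <= 2 * rho]).
  rewrite [X in _ `<=` X](closure_id _).1//; apply: closureS => w /=.
  by rewrite /=; apply: contraNle => /ltW h; rewrite (tent_eq0 rho0 h).
move=> w /= wz; rewrite /cdisk /=; have := ler_cmodD (w - z) z.
by rewrite subrK; lra.
Qed.

Lemma ball_at_le_tent (mu : {measure set R[i] -> \bar R}) z rho : 0 < rho ->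
  (mu (ball_at z rho) <= \int[mu]_w (tent z rho w)%:E)%E.
Proof.
move=> rho0; have mB := measurable_ball_at z rho.
have <- : (\int[mu]_w (\1_(ball_at z rho) w)%:E)%E = mu (ball_at z rho).
  by rewrite integral_indic// setIT.
apply: ge0_le_integral => //.
- by apply/measurable_EFinP; exact: measurable_indic.
- exact: measurable_tent.
move=> w _; rewrite lee_fin indicE; have [|_] := boolP (w \in _); last exact: tent_ge0.
by rewrite inE => wB; exact: tent_ge1.
Qed.

Lemma tent_le_measure (mu : {measure set R[i] -> \bar R}) z rho A : 0 < rho ->
  measurable A -> (forall w, cmod (w - z) < 2 * rho -> A w) ->
  (\int[mu]_w (tent z rho w)%:E <= 2%:E * mu A)%E.
Proof.
move=> rho0 mA AP; have m1 : measurable_fun setT (fun w => (\1_A w : R)%:E).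
  by apply/measurable_EFinP; exact: measurable_indic.
have <- : (\int[mu]_w (2%:E * (\1_A w)%:E) = 2%:E * mu A)%E.
  by rewrite ge0_integralZl// integral_indic// setIT.
apply: ge0_le_integral => //.
- by move=> w _; rewrite lee_fin tent_ge0.
- exact: measurable_tent.
- exact: measurable_funeM.
move=> w _; rewrite -EFinM lee_fin indicE; have [_|] := boolP (w \in _).
  by rewrite mulr1 tent_le2.
rewrite notin_setE mulr0 => wA; rewrite tent_eq0// leNgt; apply/negP => /AP; exact: wA.
Qed.

End tent.

(** If the preimage of a neighbourhood of [l] were not eventual, some ultrafilter finer than [\oo]
    would contain its complement. *)
Lemma cvg_ultra (T : topologicalType) (u : nat -> T) (l : T) :
  (forall F : set_system nat, UltraFilter F -> \oo `<=` F -> u @ F --> l) ->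
  u @ \oo --> l.
Proof.
move=> uF A lA; apply: contrapT => nA.
have PG : ProperFilter (within (~` (u @^-1` A)) \oo).
  apply: Build_ProperFilter => h; apply: nA.
  by move: h; rewrite /within /=; apply: filterS => k; exact: contrapT.
have [F [UF GF]] := ultraFilterLemma PG.
have FA : F (u @^-1` A).
  apply: uF => // B oB; apply: GF; rewrite /within /=; exact: filterS oB.
have FnA : F (~` (u @^-1` A)).
  by apply: GF; rewrite /within /=; exact: filterE.
have PF : ProperFilter F by exact: ultra_proper.
by have [k []] := filter_ex (filterI FA FnA).
Qed.

Lemma ge0_cvg_null (R : realType) (T : Type) (F : set_system T) {FF : Filter F}
    (u v : T -> \bar R) : (forall x, 0 <= u x)%E -> (\forall x \near F, (u x <= v x)%E) ->
  v @ F --> 0%E -> u @ F --> 0%E.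
Proof.
move=> u0 uv v0; apply: (@squeeze_cvge _ _ FF _ (fun=> 0%E) u v _ _ _ v0); last exact: cvg_cst.
by apply: filterS uv => x ->; rewrite u0.
Qed.

Lemma cvg_sum_null (R : realType) (T : Type) (I : Type) (F : set_system T) {FF : Filter F}
    (s : seq I) (u : I -> T -> \bar R) : (forall i, u i @ F --> 0%E) ->
  (fun x => \sum_(i <- s) u i x)%E @ F --> 0%E.
Proof.
move=> u0; elim: s => [|i s IH].
  by rewrite (_ : (fun x => _) = fun=> 0%E); [exact: cvg_cst|apply/funext => x; rewrite big_nil].
rewrite (_ : (fun x => _) = (fun x => u i x + \sum_(j <- s) u j x)%E); last first.
  by apply/funext => x; rewrite big_cons.
by rewrite -[X in _ --> X]adde0; apply: cvgeD.
Qed.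

Lemma measure_le_cover (R : realType) d (T : measurableType d) (I : eqType)
    (mu : {measure set T -> \bar R}) (D A : set T) (B : I -> set T) (s : seq I) :
  measurable D -> measurable A -> (forall i, measurable (B i)) ->
  (forall x, A x -> D x \/ exists2 i, i \in s & B i x) ->
  (mu A <= mu D + \sum_(i <- s) mu (B i))%E.
Proof.
move=> mD mA mB AP.
elim: s A mA AP => [|i s IH] A mA AP.
  rewrite big_nil adde0; apply: le_measure; rewrite ?inE//.
  by move=> x /AP[|[j]].
have mAB : measurable (A `\` B i) by exact: measurableD.
rewrite big_cons addeCA.
apply: (@le_trans _ _ (mu (B i `|` (A `\` B i)))).
  apply: le_measure; rewrite ?inE//; first exact: measurableU.
  by move=> x Ax; have [|] := pselect (B i x); [left|right].
apply: (le_trans (measureU2 _ (mB i) mAB)); rewrite leeD2l//.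
apply: IH => // x [/AP[|[j]]]; first by left.
rewrite in_cons => /predU1P[->|js] Bj nB //.
by right; exists j.
Qed.

Lemma closed_frontier (T : topologicalType) (A : set T) : closed (frontier A).
Proof.
rewrite /frontier setDE; apply: closedI; first exact: closed_closure.
by apply: open_closedC; exact: open_interior.
Qed.

(** * Root distributions of a regular sequence *)

Section regular_sequence.
Context (R : realType) (K : set R[i]) (om : probability R[i] R)
  (q : nat -> {poly R[i]}) (r : R).
Hypotheses (cK : compact K) (npK : non_polar K) (conn : polynomially_convex K)
  (eqom : equilibrium_measure K om)
  (degq : forall k, (0 < k)%N -> (0 < pdeg (q k))%N)
  (r0 : 0 < r) (Kr : K `<=` disk r)
  (reg : forall e : R, 0 < e -> \forall k \near \oo, forall z, ~ disk r z ->
      (`| ((pdeg (q k))%:R^-1)%:E * logmod (q k).[z] - green om z | < e%:E)%E).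
Implicit Types (z w : R[i]) (nu : probability R[i] R).

Let mu k := root_distribution (q k).
Let s k := proots (q k).
Let K2 : K `<=` cdisk r. Proof. by move=> z /Kr /ltW. Qed.
Let mK := compact_measurableC cK.
Let clK : closed K := compact_closedC cK.
Let Kom : carried_by K om := eqom.1.
Let KnD z : r <= cmod z -> ~ K z.
Proof. by move=> rz /Kr; rewrite /disk /= ltNge rz. Qed.
Let JK : frontier K `<=` K.
Proof. by move=> z [+ _]; rewrite -(closure_id K).1. Qed.

(** Regularity in real numbers. Outside the disk the Green's function is finite, so [q k] can have
    no root there, where its logarithm would be -oo; this confines the roots. *)
Lemma regular_expansion : exists2 E : R, energy om = E%:E &
  forall e : R, 0 < e -> \forall k \near \oo,
    [/\ q k != 0, (0 < size (s k))%N, (forall x, x \in s k -> cmod x < r) &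
      forall z, r <= cmod z -> `|(size (s k))%:R^-1 * ln (cmod (lead_coef (q k)))
        + (size (s k))%:R^-1 * (\sum_(x <- s k) ln (cmod (z - x)))
        - (rpot K om z - E)| < e].
Proof.
have [V [_ EV]] := equilibrium_minimizer cK r0 K2 (lexx _) npK eqom.
exists (ln (4 * r) - V) => // e e0.
have gE z : r <= cmod z -> green om z = (rpot K om z - (ln (4 * r) - V))%:E.
  by move=> rz; rewrite /green EV (potential_rpot cK Kom (KnD rz)).
near=> k.
have qk0 : q k != 0.
  apply/eqP => qk; have : (0 < pdeg (q k))%N by apply: degq; near: k; exact: nbhs_infty_gt.
  by rewrite /pdeg qk size_poly0.
have sk : size (s k) = pdeg (q k) := size_proots qk0.
have sk0 : (0 < size (s k))%N by rewrite sk; apply: degq; near: k; exact: nbhs_infty_gt.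
have regk : forall z, ~ disk r z ->
    (`| ((pdeg (q k))%:R^-1)%:E * logmod (q k).[z] - green om z | < e%:E)%E.
  by near: k; exact: reg.
have nD z : r <= cmod z -> ~ disk r z by move=> rz; rewrite /disk /= ltNge rz.
have n0 : 0 < (pdeg (q k))%:R^-1 :> R by rewrite invr_gt0 ltr0n -sk.
have rt x : x \in s k -> cmod x < r.
  move=> xs; rewrite ltNge; apply/negP => rx; have := regk x (nD x rx).
  have -> : (q k).[x] = 0 by apply/eqP; rewrite -[_ == 0]/(root _ _) root_proots.
  by rewrite logmodE eqxx gt0_muleNy ?lte_fin// gE.
split => // z rz.
have zs : z \notin s k by apply/negP => /rt; rewrite ltNge rz.
have := regk z (nD z rz); rewrite logmod_horner// gE// -sk -EFinM -EFinB abse_EFin lte_fin.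
by rewrite mulrDr.
Unshelve. all: by end_near. Qed.

Let near_roots : \forall k \near \oo,
  [/\ q k != 0, (0 < size (s k))%N & forall x, x \in s k -> cmod x < r].
Proof.
by have [E _ /(_ 1 ltr01)] := regular_expansion; apply: filterS => k [].
Qed.

Lemma near_root_distribution_setT : \forall k \near \oo, mu k setT = 1%E.
Proof.
apply: filterS near_roots => k [qk sk _].
by rewrite /mu root_distributionE//; exact: uniform_on_setT.
Qed.

Lemma near_root_distribution_cdisk : \forall k \near \oo, mu k (~` cdisk r) = 0%E.
Proof.
apply: filterS near_roots => k [qk sk rt].
rewrite /mu root_distributionE//; apply: uniform_on_null.
  by apply: measurableC; exact: measurable_cdisk.
by move=> x /rt xr; apply; exact: ltW.
Qed.

(** The part of [L] in the disk is covered by finitely many disks, each below a tent supported where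
    [om] has no mass; weak-star convergence applies to each tent. *)
Lemma centers_of_cvg : weak_star_cvg mu om -> weakly_centers q (frontier K).
Proof.
move=> wk; split.
  have [N _ NP] := near_roots; exists N, r; split=> // k Nk z /=.
  by have [qk _ rt] := NP k Nk; rewrite root_proots//; exact: rt.
move=> L cL LJ.
have [V [mV EV]] := equilibrium_minimizer cK r0 K2 (lexx _) npK eqom.
have null z : ~ frontier K z -> exists2 d : R, 0 < d & om (ball_at z d) = 0.
  move=> Jz; have [Kz|Kz] := pselect (K z).
    have /nbhs_cmodP[d d0 dP] : nbhs z K.
      apply: contrapT => nK; apply: Jz; split; first exact: subset_closure.
      by [].
    exists (d / 2); first by rewrite divr_gt0.
    apply: (minimizer_interior_null cK r0 K2 (lexx _) mV); first by rewrite divr_gt0.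
    by move=> w wz; apply: dP; lra.
  have [d d0 dP] := compl_compact_dist cK Kz; exists d => //.
  apply/eqP; rewrite eq_le measure_ge0 andbT; rewrite -Kom; apply: le_measure.
  - by rewrite inE; exact: measurable_ball_at.
  - by rewrite inE; exact: measurableC.
  - by move=> w /= wz Kw; have := dP w Kw; rewrite cmodBC leNgt wz.
(* Twice the radius, because the tent over a disk of radius d lives on the disk of radius 2d. *)
have /choice[d dP] : forall z, exists d : R, 0 < d /\
    (~ frontier K z -> om (ball_at z (2 * d)) = 0).
  move=> z; have [Jz|/null[d d0 dz]] := pselect (frontier K z); first by exists 1.
  exists (d / 2); split; first by rewrite divr_gt0.
  by move=> _; rewrite mulrC divfK.
have cLr : compact (L `&` cdisk r).
  apply: (@subclosed_compact _ _ (cdisk r)); last by move=> ? [].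
    by apply: closedI => //; exact: closed_cdisk.
  exact: compact_cdisk.
have [|S [SL LS]] := @compact_finite_cover R _ (fun z => ball_at z (d z)) cLr.
  by move=> z _; apply: near_disk; have [] := dP z.
have tent0 z : ~ frontier K z -> (fun k => \int[mu k]_w (tent z (d z) w)%:E)%E @ \oo --> 0%E.
  move=> Jz; have [d0 /(_ Jz) omz] := dP z.
  have -> : 0%E = (\int[om]_w (tent z (d z) w)%:E)%E.
    apply/eqP; rewrite eq_le; apply/andP; split; first by apply: integral_ge0 => w _; rewrite lee_fin tent_ge0.
    have := @tent_le_measure R om z (d z) (ball_at z (2 * d z)) d0 (measurable_ball_at _ _) (fun _ h => h).
    by rewrite [X in (_ * X)%E]omz mule0.
  by apply: wk; [exact: continuous_tent|exact: compact_tent].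
have nJ z : z \in S -> ~ frontier K z.
  by move=> /SL[Lz _] Jz; have : (L `&` frontier K) z by []; rewrite LJ.
(* Set to 0 off the list: convergence is known for centres in [S], whereas [cvg_sum_null] asks for
   it at every index. *)
pose u z k := if z \in S then mu k (ball_at z (d z)) else 0%E.
have u0 z : u z @ \oo --> 0%E.
  have [zS|zS] := boolP (z \in S); last first.
    by rewrite (_ : u z = fun=> 0%E); [exact: cvg_cst|apply/funext => k; rewrite /u (negbTE zS)].
  rewrite (_ : u z = fun k => mu k (ball_at z (d z))); last by apply/funext => k; rewrite /u zS.
  apply: (ge0_cvg_null _ _ (tent0 z (nJ z zS))); first by [].
  by apply: nearW => k; apply: ball_at_le_tent; have [] := dP z.
apply: (ge0_cvg_null _ _ (cvg_sum_null S u0)); first by [].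
apply: filterS near_root_distribution_cdisk => k muk.
have -> : (\sum_(z <- S) u z k = \sum_(z <- S) mu k (ball_at z (d z)))%E.
  by rewrite big_seq [RHS]big_seq; apply: eq_bigr => z zS; rewrite /u zS.
suff : (mu k L <= mu k (~` cdisk r) + \sum_(z <- S) mu k (ball_at z (d z)))%E.
  by rewrite [X in (_ <= X + _)%E]muk add0e.
apply: measure_le_cover.
- by apply: measurableC; exact: measurable_cdisk.
- exact: closed_measurableC.
- by move=> z; exact: measurable_ball_at.
move=> z Lz; have [zr|] := pselect (cdisk r z); last by left.
by right; apply: LS.
Qed.

Let integral_ln nu z : carried_by K nu -> ~ K z ->
  (\int[nu]_(w in K) (ln (cmod (z - w)%R))%:E = (rpot K nu z)%:E)%E.
Proof.
move=> Knu Kz; rewrite /rpot /Rintegral fineK//.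
by apply: integrable_fin_num => //; exact: integrable_ln.
Qed.

(** The potential of a probability measure on K is ln |z| + O(1/|z|), which will fix the additive
    constant. *)
Lemma rpot_infinity nu z : carried_by K nu -> r < cmod z ->
  `|rpot K nu z - ln (cmod z)| <= r / (cmod z - r).
Proof.
move=> Knu rz; have Kz := KnD (ltW rz).
have d0 : 0 < cmod z - r by rewrite subr_gt0.
have nK : fine (nu K) = 1 by rewrite (measure_carried mK Knu) [X in fine X](@probability_setT _ _ _ nu).
have icst : nu.-integrable K (EFin \o (fun=> ln (cmod z))).
  by apply: (@bounded_integrable _ _ cK nu _ `|ln (cmod z)|).
have -> : ln (cmod z) = (\int[nu]_(w in K) ln (cmod z))%R by rewrite Rintegral_cst// nK mulr1.
rewrite /rpot -RintegralB//; last exact: integrable_ln.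
apply: normr_Rintegral_le => //.
- by rewrite divr_ge0// ltW.
- by apply: measurable_funB => //; exact: measurable_funTS (measurable_lnB z).
move=> w Kw; have wr : cmod w <= r := K2 Kw.
have h := ler_dist_cmod (z - w) z; rewrite addrAC subrr add0r cmodN in h.
apply: (@le_trans _ _ (`|cmod (z - w) - cmod z| / (cmod z - r))).
  apply: ler_ln_dist => //; last by rewrite gerBl ltW.
  by have := ler_cmodD (z - w) w; rewrite subrK; lra.
by rewrite ler_pM2r ?invr_gt0// (le_trans h).
Qed.

(* [nu] is a weak limit of the root distributions along an ultrafilter. *)
Section ultralimit.
Context (F : set_system nat) (nu : probability R[i] R).
Hypotheses (UF : UltraFilter F) (Foo : \oo `<=` F) (wc : weakly_centers q (frontier K))
  (nuE : forall f : R[i] -> R, continuous f ->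
    (\int[mu k]_w (f w)%:E)%E @[k --> F] --> (\int[nu]_w (f w)%:E)%E).

Let PF : ProperFilter F. Proof. exact: ultra_proper. Qed.

Let b : R := 4 * r.

(** A tent about a point off the frontier is dominated by the mass of a closed disk that misses the
    frontier, and weak centering sends this mass to 0. *)
Let nu_frontier : carried_by (frontier K) nu.
Proof.
have cJ := @closed_frontier _ K.
apply: locally_null; last by apply: measurableC; exact: closed_measurableC.
move=> z Jz; have oJ : open (~` frontier K) by exact: closed_openC.
have /nbhs_cmodP[d d0 dP] : nbhs z (~` frontier K) by exact: open_nbhs_nbhs.
pose rho := d / 4; have rho0 : 0 < rho by rewrite divr_gt0.
exists (ball_at z rho); first exact: near_disk.
split; first exact: measurable_ball_at.
pose L := [set w | cmod (w - z) <= 2 * rho].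
have cL : closed L := @closed_cdisk_at R z (2 * rho).
have LJ : L `&` frontier K = set0.
  apply/seteqP; split => // w [Lw Jw]; apply: (dP w) Jw.
  by apply: le_lt_trans Lw _; rewrite /rho; lra.
have muL : (fun k => 2%:E * mu k L)%E @ F --> 0%E.
  rewrite -[X in _ --> X](mule0 (2%:E : \bar R)); apply: cvgeZl => // A /(wc.2 L cL LJ).
  exact: Foo.
have h0 : (fun k => \int[mu k]_w (tent z rho w)%:E)%E @ F --> 0%E.
  apply: (ge0_cvg_null _ _ muL).
    by move=> k; apply: integral_ge0 => w _; rewrite lee_fin tent_ge0.
  apply: nearW => k; apply: tent_le_measure => //; first exact: closed_measurableC.
  by move=> w /ltW.
have E := cvg_unique (@ereal_hausdorff R) (@nuE _ (@continuous_tent R z rho rho0)) h0.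
by apply/eqP; rewrite eq_le measure_ge0 andbT -E; exact: ball_at_le_tent.
Qed.

Let Knu : carried_by K nu.
Proof.
apply/eqP; rewrite eq_le measure_ge0 andbT -nu_frontier; apply: le_measure.
- by rewrite inE; exact: measurableC.
- by rewrite inE; apply: measurableC; apply: closed_measurableC; exact: closed_frontier.
- by move=> z Kz /JK.
Qed.

(** Normalized logarithm of the monic polynomial with the roots of [q k]. *)
Let U k z : R := (size (s k))%:R^-1 * (\sum_(x <- s k) ln (cmod (z - x))).

(** [f] flattens ln |z - w| at distance |z| - r from z: it becomes continuous on the plane and keeps
    its values on the disk of radius r, which carries [nu] and eventually the root distributions. *)
Let cvg_U z : r < cmod z -> U ^~ z @ F --> rpot K nu z.
Proof.
move=> rz; have d0 : 0 < cmod z - r by rewrite subr_gt0.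
pose f w := ln (Num.max (cmod (w - z)) (cmod z - r)).
have cf : continuous f.
  apply: (@lipschitz_continuous_cmod _ _ (cmod z - r)^-1) => x y; rewrite mulrC.
  apply: (le_trans (ler_ln_dist d0 _ _)); rewrite ?le_max ?lexx ?orbT//.
  rewrite ler_pM2r ?invr_gt0// (le_trans (ler_max_dist _ _ _))//.
  by rewrite (le_trans (ler_dist_cmod _ _))// opprB addrA subrK.
have fE w : cmod w <= r -> f w = ln (cmod (z - w)).
  move=> wr; rewrite /f cmodBC max_l//.
  by have := ler_cmodD (z - w) w; rewrite subrK; lra.
have nuf : (\int[nu]_w (f w)%:E = (rpot K nu z)%:E)%E.
  rewrite (integral_carried mK _ Knu); last by apply/measurable_EFinP; exact: continuous_measurableC.
  rewrite -(integral_ln Knu (KnD (ltW rz))); apply: eq_integral => w; rewrite inE => Kw.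
  by rewrite fE//; exact: K2.
have muf : \forall k \near F, (\int[mu k]_w (f w)%:E)%E = (U k z)%:E.
  apply: Foo; apply: filterS near_roots => k [qk sk rt].
  rewrite /mu root_distributionE// integral_uniform_on; last exact: continuous_measurableC.
  congr (_ * _)%:E; rewrite big_seq [RHS]big_seq; apply: eq_bigr => x xs.
  by rewrite fE// ltW// rt.
have := @nuE f cf; rewrite nuf => h.
have : (fun k => (U k z)%:E) @ F --> (rpot K nu z)%:E.
  move=> A /h FA; have FA' : F [set k | A (\int[mu k]_w (f w)%:E)%E] := FA.
  have : F [set k | A (U k z)%:E] by apply: filterS (filterI FA' muf) => k [/= + <-].
  exact.
by move=> /fine_cvg.
Qed.

(** For every y beyond [r] the normalized logarithms [c] of the leading coefficients tend to
    [rpot K om y - E - rpot K nu y]. So the difference of the potentials does not depend on y, and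
    at infinity it tends to 0. *)
Let rpot_eq_infinity z : r < cmod z -> rpot K om z = rpot K nu z.
Proof.
have [E _ EP] := regular_expansion.
pose c k := (size (s k))%:R^-1 * ln (cmod (lead_coef (q k))).
have cvg_c y : r < cmod y -> c @ F --> rpot K om y - E - rpot K nu y.
  move=> ry; apply/cvgrPdist_lt => e e0; have e2 : 0 < e / 2 by rewrite divr_gt0.
  have h1 := Foo (EP _ e2).
  have /cvgrPdist_lt/(_ _ e2) h2 := cvg_U ry.
  apply: filterS (filterI h1 h2) => k [[_ _ _ /(_ y (ltW ry)) k1] k2].
  rewrite -/(c k) -/(U k y) in k1; rewrite /= in k2.
  have := ler_normB (rpot K nu y - U k y) (- (c k + U k y - (rpot K om y - E))).
  rewrite normrN => h.
  have -> : rpot K om y - E - rpot K nu y - c k =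
    - (rpot K nu y - U k y - - (c k + U k y - (rpot K om y - E))) by ring.
  by rewrite normrN; apply: le_lt_trans h _; lra.
move=> rz; apply/eqP; rewrite -subr_eq0 -normr_eq0 eq_le normr_ge0 andbT leNgt.
apply/negP; set D := `|_| => D0.
(* Chosen so that r / (t - r) = D / 4: at t the two potentials are within D / 2 of each other,
   although they should differ by D. *)
pose t := r + 4 * r / D; have t0 : 0 < 4 * r / D by rewrite divr_gt0// mulr_gt0.
have ct : cmod (t%:C : R[i]) = t by rewrite cmodR gtr0_norm// addr_gt0.
have rt : r < cmod (t%:C : R[i]) by rewrite ct /t; lra.
have E1 := @cvg_unique _ (@Rhausdorff R) _ (fmap_proper_filter c PF) _ _ (cvg_c _ rz) (cvg_c _ rt).
have h1 := rpot_infinity Kom rt; have h2 := rpot_infinity Knu rt.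
rewrite ct in h1 h2.
have Et : r / (t - r) = D / 4 by rewrite /t addrAC subrr add0r; field; rewrite !gt_eqF.
rewrite Et in h1 h2.
have := ler_normB (rpot K om t%:C - ln t) (rpot K nu t%:C - ln t).
have -> : rpot K om t%:C - ln t - (rpot K nu t%:C - ln t) = rpot K om z - rpot K nu z by lra.
rewrite -/D; lra.
Qed.

Let potential_eq z : ~ K z -> potential om z = potential nu z.
Proof.
apply: (unique_continuation cK (r := r + 1) Kom Knu conn) => y ry Ky.
rewrite !(potential_rpot cK)//; congr (_%:E); apply: rpot_eq_infinity; lra.
Qed.

Let pot_rpot (om' : probability R[i] R) z : carried_by K om' -> ~ K z -> cmod z <= 2 * r ->
  pot b om' z = (ln b - rpot K om' z)%:E.
Proof.
move=> Kom' Kz zr; have b0 : 0 < b by rewrite mulr_gt0.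
have zb w : K w -> cmod (z - w) <= b.
  move=> Kw; have wr : cmod w <= r := K2 Kw; have r0' : 0 < r by exact: r0.
  by apply: (le_trans (ler_cmodB _ _)); rewrite /b; lra.
have := potential_pot b0 mK Kom' zb; rewrite (potential_rpot cK Kom' Kz).
by case: (pot b om' z) => //= x [->]; congr (_%:E); ring.
Qed.

Let equilibrium_nu : equilibrium_measure K nu.
Proof.
have [V [mV EV]] := equilibrium_minimizer cK r0 K2 (lexx b) npK eqom.
have JV z : frontier K z -> (pot b nu z <= V%:E)%E.
  move=> Jz; apply: pot_lsc => e e0.
  have rz : cmod z < r by apply: Kr; exact: JK.
  (* The bound [r] keeps z' in the disk of radius 2r, from which the kernel with b = 4r is not cut
     off on K. *)
  pose d := Num.min e r; have d0 : 0 < d by rewrite lt_min e0.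
  have [z' Kz' zz'] : exists2 z', ~ K z' & cmod (z' - z) < d.
    apply: contrapT => h; apply: Jz.2; apply/nbhs_cmodP; exists d => // w wz.
    by apply: contrapT => Kw; apply: h; exists w.
  move: zz'; rewrite lt_min => /andP[ze zr].
  exists z'; first by rewrite cmodBC.
  have z'r : cmod z' <= 2 * r by have := ler_cmodD (z' - z) z; rewrite subrK; lra.
  have E : rpot K nu z' = rpot K om z'.
    by have := potential_eq Kz'; rewrite !(potential_rpot cK)//; case.
  by have := frostman cK r0 K2 (lexx b) mV z'; rewrite !pot_rpot// E.
have mJ : measurable (frontier K) by apply: closed_measurableC; exact: closed_frontier.
have intV : (\int[nu]_z pot b nu z <= V%:E)%E.
  rewrite (ge0_integral_carried mJ _ _ nu_frontier); [|exact: measurable_pot|exact: pot_ge0].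
  have -> : V%:E = (\int[nu]_(z in frontier K) cst V%:E z)%E.
    rewrite integral_cst// [X in (_ * X)%E](measure_carried mJ nu_frontier).
    by rewrite [X in (_ * X)%E](@probability_setT _ _ _ nu) mule1.
  apply: ge0_le_integral => //.
  - by move=> z _; exact: pot_ge0.
  - exact: measurable_funTS (measurable_pot _ _).
split=> // nu' Knu'; apply: (le_trans (eqom.2 nu' Knu')).
have b0 : 0 < b by rewrite mulr_gt0.
have Kb z w : K z -> K w -> cmod (z - w) <= b.
  move=> Kz Kw; have zr : cmod z <= r := K2 Kz; have wr : cmod w <= r := K2 Kw.
  have r0' : 0 < r by exact: r0.
  by apply: (le_trans (ler_cmodB _ _)); rewrite /b; lra.
by rewrite EV (energy_pot b0 mK Knu Kb) EFinB leeB.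
Qed.

Lemma ultralimit_equilibrium f : continuous f ->
  (\int[om]_w (f w)%:E = \int[nu]_w (f w)%:E)%E.
Proof.
apply: (ring_kernel_eq cK Kom Knu) => a rho rho0.
exact: (equilibrium_ring_kernel cK r0 K2).
Qed.

End ultralimit.

Lemma cvg_of_centers : weakly_centers q (frontier K) -> weak_star_cvg mu om.
Proof.
move=> wc f cf _; apply: cvg_ultra => F UF Foo.
have [nu [_ nuE]] := @helly_selection R F UF mu r
  (Foo _ near_root_distribution_setT) (Foo _ near_root_distribution_cdisk).
by rewrite (ultralimit_equilibrium UF Foo wc nuE cf); exact: nuE.
Qed.

End regular_sequence.

Theorem theorem3 (R : realType) (K : set R[i]) (omega : probability R[i] R)
    (q : nat -> {poly R[i]})
    (K_compact : compact K) (K_non_polar : non_polar K)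
    (K_convex : polynomially_convex K)
    (omega_equilibrium : equilibrium_measure K omega)
    (q_degree : forall k, (0 < k)%N -> (0 < pdeg (q k))%N)
    (q_degree_cvg : pdeg (q k) @[k --> \oo] --> \oo)
    (q_regular : K_regular K omega q) :
  weak_star_cvg (fun k => root_distribution (q k)) omega <->
  weakly_centers q (frontier K).
Proof.
have [r [r0 Kr reg]] := q_regular; split.
  exact: (centers_of_cvg K_compact K_non_polar omega_equilibrium q_degree r0 Kr reg).
exact: (cvg_of_centers K_compact K_non_polar K_convex omega_equilibrium q_degree r0 Kr reg).
Qed.
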